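(* Let $G$ be a topological group, and let $k$ be a Hausdorff topological field of characteristic zero. Then the continuous homomorphism $G\to U_{G,k}(k)$ constructed from the neutral Tannakian category $\mathbf{URep}_{k,\mathrm{cont}}(G)$ exhibits $U_{G,k}$ as the continuous Mal'cev $k$-completion of $G$.
   Context: A topological field is a field with a topology for which addition, multiplication, additive inversion and multiplicative inversion are continuous. An affine algebraic group over $k$ is unipotent if it has a closed embedding into the group of upper-unitriangular $m\times m$ matrices for some $m$; an affine group scheme over $k$ is pro-unipotent if all its finite-dimensional quotient group schemes are unipotent (equivalently it is an inverse limit of unipotent groups). For $U$ unipotent, $U(k)$ has the topology transported from $\mathrm{Lie}(U)\cong k^r$ (product topology) along the bijection $\exp:\mathrm{Lie}(U)\to U(k)$; for $U=\varprojlim_iU_i$ pro-unipotent, $U(k)=\varprojlim_iU_i(k)$ has the inverse limit topology. The continuous Mal'cev $k$-completion of $G$ is the pro-unipotent group over $k$, with universal continuous homomorphism from $G$ to its $k$-points, representing the functor $U\mapsto\mathrm{Hom}_{\mathrm{cont}}(G,U(k))$ on pro-unipotent groups over $k$. $\mathbf{URep}_{k,\mathrm{cont}}(G)$ is the category of finite-dimensional $k$-vector spaces $V$ with a continuous homomorphism $G\to\mathrm{GL}(V)$ (topology from $\mathrm{End}(V)\cong k^{m^2}$, $m=\dim_kV$) that is unipotent, i.e. $V$ has a $G$-stable flag with trivial action on successive quotients; morphisms are $G$-equivariant $k$-linear maps. Let $\omega$ be the forgetful functor to finite-dimensional $k$-vector spaces. $U_{G,k}$ is the affine group scheme over $k$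 representing the functor $\underline{\mathrm{Aut}}^{\otimes}(\omega)$, which sends a $k$-algebra $R$ to the set of families $(\lambda_X)_X$ of $R$-linear automorphisms of $\omega(X)\otimes_kR$, natural in $X$, with $\lambda_{X_1\otimes X_2}=\lambda_{X_1}\otimes\lambda_{X_2}$ and $\lambda_{\mathbf{1}}=\mathrm{id}_R$. It is pro-unipotent. The canonical homomorphism $G\to U_{G,k}(k)$ sends $g$ to the tensor automorphism given by the action of $g$ on every representation; it is continuous. *)

(* Defs.v *)
From HB Require Import structures.
From mathcomp Require Import all_boot all_order all_algebra.
From mathcomp Require Import all_classical all_reals all_analysis.

Set Implicit Arguments.
Unset Strict Implicit.
Unset Printing Implicit Defensive.

Import GRing.Theory VectorInternalTheory.

Local Open Scope classical_set_scope.
Local Open Scope ring_scope.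

(** * Topological groups and topological fields *)

HB.mixin Record isTopologicalGroup G of Topological G & Group G := {
  mulg_continuous : continuous (fun p : G * G => (p.1 * p.2)%g);
  invg_continuous : continuous (fun x : G => (x^-1)%g)
}.

#[short(type="topologicalGroupType")]
HB.structure Definition TopologicalGroup :=
  {G of Topological G & Group G & isTopologicalGroup G}.

HB.mixin Record isTopologicalField K of Topological K & GRing.Field K := {
  mulf_continuous : continuous (fun p : K * K => p.1 * p.2);
  (* [0^-1 = 0] in the library, so inversion is restricted to nonzero elements *)
  invf_continuous : {within [set x : K | x != 0], continuous (@GRing.inv K)}
}.

#[short(type="topologicalFieldType")]
HB.structure Definition TopologicalField :=
  {K of TopologicalZmodule K & GRing.Field K & isTopologicalField K}.

(** * Affine group schemes, as commutative Hopf algebras *)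

(* A finite sequence [:: (a1, b1); ...; (an, bn)] stands for the tensor
   a1 (x) b1 + ... + an (x) bn of A (x)_k B.  Two sequences denote the same
   tensor iff all bilinear maps agree on them. *)
Definition contract (k : fieldType) (A B Z : lmodType k) (b : A -> B -> Z)
  (t : seq (A * B)) : Z := \sum_(p <- t) b p.1 p.2.

Definition tensor_eq (k : fieldType) (A B : lmodType k) (s t : seq (A * B)) :=
  forall (Z : lmodType k) (b : {bilinear A -> B -> Z}),
    contract b s = contract b t.

Definition trilinear (k : fieldType) (A B C Z : lmodType k)
    (t : A -> B -> C -> Z) :=
  [/\ forall b c, linear (fun a => t a b c),
      forall a c, linear (fun b => t a b c) &
      forall a b, linear (fun c => t a b c)].

(* [coord_ring] is the coordinate ring; the comultiplication returns a
   representative of the tensor. *)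
Record affineGroup (k : fieldType) := AffineGroup {
  coord_ring :> comAlgType k;
  comul : coord_ring -> seq (coord_ring * coord_ring);
  counit : {lrmorphism coord_ring -> k^o};
  antipode : {lrmorphism coord_ring -> coord_ring};
  comul_linear : forall (c : k) (a b : coord_ring), tensor_eq (comul (c *: a + b))
    ([seq (c *: p.1, p.2) | p <- comul a] ++ comul b);
  comul_mul : forall a b : coord_ring, tensor_eq (comul (a * b))
    [seq (p.1 * q.1, p.2 * q.2) | p <- comul a, q <- comul b];
  comul_one : tensor_eq (comul 1) [:: (1, 1)];
  coassoc : forall (Z : lmodType k) (t : coord_ring -> coord_ring -> coord_ring -> Z),
    trilinear t -> forall a : coord_ring,
    \sum_(p <- comul a) \sum_(q <- comul p.1) t q.1 q.2 p.2 =
    \sum_(p <- comul a) \sum_(q <- comul p.2) t p.1 q.1 q.2;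
  counitl : forall a : coord_ring, \sum_(p <- comul a) (counit p.1 : k) *: p.2 = a;
  counitr : forall a : coord_ring, \sum_(p <- comul a) (counit p.2 : k) *: p.1 = a;
  antipodel : forall a : coord_ring,
    \sum_(p <- comul a) antipode p.1 * p.2 = (counit a : k)%:A;
  antipoder : forall a : coord_ring,
    \sum_(p <- comul a) p.1 * antipode p.2 = (counit a : k)%:A
}.

(** ** Points *)

Definition points (k : fieldType) (U : affineGroup k) (R : comAlgType k) :=
  {lrmorphism U -> R}.

Definition convolution (k : fieldType) (U : affineGroup k) (R : comAlgType k)
  (f g : U -> R) (a : U) : R := \sum_(p <- comul a) f p.1 * g p.2.

Section PointMul.
Variables (k : fieldType) (U : affineGroup k) (R : comAlgType k).
Variables (x y : points U R).

Let m (a b : U) : R := x a * y b.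

Let m_bilinear : bilinear_for *:%R *:%R m.
Proof.
split=> [b|a] c u v; rewrite /m linearP.
  by rewrite mulrDl -scalerAl.
by rewrite mulrDr -scalerAr.
Qed.

HB.instance Definition _ :=
  bilinear_isBilinear.Build k U U R *:%R *:%R m m_bilinear.

Let convE a : convolution x y a = contract m (comul a).
Proof. by []. Qed.

Let conv_linear : linear (convolution x y).
Proof.
move=> c a b; rewrite !convE (comul_linear c a b m) /contract big_cat /=.
rewrite big_map scaler_sumr; congr (_ + _); apply: eq_bigr => p _ /=.
by rewrite /m linearZ /= scalerAl.
Qed.

Let conv_monoid : monoid_morphism (convolution x y).
Proof.
split=> [|a b].
  by rewrite convE (comul_one m) /contract big_seq1 /= /m !rmorph1 mulr1.
rewrite !convE (comul_mul a b m) /contract big_allpairs_dep /= mulr_suml.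
apply: eq_bigr => p _; rewrite mulr_sumr; apply: eq_bigr => q _.
by rewrite /m /= !rmorphM mulrACA.
Qed.

Definition point_mul_fun : U -> R := convolution x y.
HB.instance Definition _ :=
  GRing.isLinear.Build k U R *:%R point_mul_fun conv_linear.
HB.instance Definition _ :=
  GRing.isMonoidMorphism.Build U R point_mul_fun conv_monoid.

(* the group law of U(R) *)
Definition point_mul : points U R := point_mul_fun.
End PointMul.

(* the map U(R) -> U(S) induced by R -> S *)
Definition point_map (k : fieldType) (U : affineGroup k) (R S : comAlgType k)
  (phi : {lrmorphism R -> S}) (x : points U R) : points U S := phi \o x.

(** ** Homomorphisms *)

(* [f] is the comorphism O(V) -> O(U) of a homomorphism U -> V. *)
Definition group_comorphism (k : fieldType) (U V : affineGroup k)
    (f : {lrmorphism V -> U}) :=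
  forall a : V, tensor_eq (comul (f a)) [seq (f p.1, f p.2) | p <- comul a].

(* the map U(R) -> V(R) induced by a homomorphism U -> V *)
Definition hom_points (k : fieldType) (U V : affineGroup k) (R : comAlgType k)
  (f : {lrmorphism V -> U}) (x : points U R) : points V R := x \o f.

(* V is a quotient group scheme of U iff O(V) embeds in O(U). *)
Definition quotient_comorphism (k : fieldType) (U V : affineGroup k)
    (f : {lrmorphism V -> U}) :=
  group_comorphism f /\ injective f.

(** ** Unipotent and pro-unipotent groups *)

Definition alg_generated (k : fieldType) (A : comAlgType k) (X : set A) :=
  forall S : {pred A}, subalg_closed S -> (forall a, X a -> a \in S) ->
    forall a, a \in S.

Definition algebraic (k : fieldType) (U : affineGroup k) :=
  exists s : seq U, alg_generated [set` s].

(* By the Yoneda lemma a homomorphism from U to the group scheme of upper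
   unitriangular m x m matrices is an upper unitriangular matrix M over O(U)
   with comul (M i j) = \sum_l M i l (x) M l j.  Its comorphism sends the
   coordinate functions x_ij, i < j, to the M i j; it is surjective, i.e. the
   homomorphism is a closed embedding, iff the entries of M generate O(U). *)
Definition unipotent (k : fieldType) (U : affineGroup k) :=
  exists (m : nat) (M : 'M[U]_m),
    [/\ forall i, M i i = 1,
        forall i j : 'I_m, (j < i)%N -> M i j = 0,
        forall i j,
          tensor_eq (comul (M i j)) [seq (M i l, M l j) | l <- enum 'I_m] &
        alg_generated [set a | exists i j, a = M i j]].

(* A finite-dimensional quotient is understood as an algebraic one. *)
Definition pro_unipotent (k : fieldType) (U : affineGroup k) :=
  forall (V : affineGroup k) (f : {lrmorphism V -> U}),
    quotient_comorphism f -> algebraic V -> unipotent V.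

(** ** Lie algebra and exponential *)

(* Tangent vectors at the identity are the derivations O(U) -> k, where k is an
   O(U)-module via the counit. *)
Definition in_lie (k : fieldType) (U : affineGroup k) (D : U -> k) :=
  linear (D : U -> k^o) /\
  forall a b : U, D (a * b) = (counit U a : k) * D b + D a * (counit U b : k).

Definition lie_comb (k : fieldType) (U : affineGroup k) (r : nat)
  (D : 'I_r -> U -> k) (c : 'rV[k]_r) (a : U) : k := \sum_i c 0 i * D i a.

(* [D] is a basis of Lie(U), so that [lie_comb D] is an isomorphism
   k^r -> Lie(U). *)
Definition lie_basis (k : fieldType) (U : affineGroup k) (r : nat)
    (D : 'I_r -> U -> k) :=
  [/\ forall i, in_lie (D i),
      forall E, in_lie E -> exists c, E =1 lie_comb D c &
      forall c, lie_comb D c =1 (fun=> 0) -> c = 0].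

Fixpoint conv_pow (k : fieldType) (U : affineGroup k) (D : U -> k) (n : nat)
    : U -> k :=
  if n is n'.+1 then convolution (D : U -> k^o) (conv_pow D n' : U -> k^o)
  else (counit U : U -> k^o).

(* x = exp(D), the sum of the D^n / n! in the convolution algebra O(U)^*; for
   U unipotent the series is finite on every element of O(U). *)
Definition is_exp (k : fieldType) (U : affineGroup k) (D : U -> k)
    (x : points U k^o) :=
  forall a : U, exists N, forall n, (N <= n)%N ->
    x a = \sum_(i < n) (i`!%:R)^-1 * conv_pow D i a :> k.

(** ** The topology on k-points *)

(* The open subsets of U(k), U unipotent: those whose preimage under
   k^r ~ Lie(U) -> U(k) is open in the product topology. *)
Definition unipotent_open (k : topologicalFieldType) (U : affineGroup k)
    (W : set (points U k^o)) :=
  exists (r : nat) (D : 'I_r -> U -> k), lie_basis D /\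
    open [set c : 'rV[k]_r | exists2 x, W x & is_exp (lie_comb D c) x].

Definition kpoints (k : topologicalFieldType) (U : affineGroup k) :=
  points U k^o.

Section KPointsTopology.
Variables (k : topologicalFieldType) (U : affineGroup k).

HB.instance Definition _ := gen_eqMixin (kpoints U).
HB.instance Definition _ := gen_choiceMixin (kpoints U).

(* The inverse limit topology: the coarsest one for which the maps to the
   k-points of the unipotent quotients of U are continuous. *)
Definition kpoints_subbase : set (set (kpoints U)) :=
  [set W | exists (V : affineGroup k) (f : {lrmorphism V -> U}),
    [/\ quotient_comorphism f, unipotent V &
        exists2 W', unipotent_open W' & W = hom_points f @^-1` W']].

HB.instance Definition _ := @isSubBaseTopological.Build (kpoints U)
  (set (kpoints U)) kpoints_subbase id.
End KPointsTopology.

(** * The continuous Mal'cev completion *)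

Definition continuous_hom (G : topologicalGroupType) (k : topologicalFieldType)
    (U : affineGroup k) (phi : G -> kpoints U) :=
  (forall g h, phi (g * h)%g =1 point_mul (phi g) (phi h)) /\ continuous phi.

(* c : G -> U(k) is a continuous homomorphism and, for all pro-unipotent V,
   composition with c is a bijection from the homomorphisms U -> V to the
   continuous homomorphisms G -> V(k). *)
Record malcev_completion (G : topologicalGroupType) (k : topologicalFieldType)
    (U : affineGroup k) (c : G -> kpoints U) : Prop := MalcevCompletion {
  malcev_pro_unipotent : pro_unipotent U;
  malcev_hom : continuous_hom c;
  malcev_comp : forall (V : affineGroup k) (f : {lrmorphism V -> U}),
    pro_unipotent V -> group_comorphism f ->
    continuous_hom (fun g => hom_points f (c g) : kpoints V);
  malcev_univ : forall (V : affineGroup k) (phi : G -> kpoints V),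
    pro_unipotent V -> continuous_hom phi ->
    exists f : {lrmorphism V -> U},
      [/\ group_comorphism f,
          forall g, hom_points f (c g) =1 phi g &
          forall f' : {lrmorphism V -> U}, group_comorphism f' ->
            (forall g, hom_points f' (c g) =1 phi g) -> f' =1 f]
}.

(** * Continuous unipotent representations *)

Definition unipotent_action (G : groupType) (k : fieldType) (V : vectType k)
    (rho : G -> 'End(V)) :=
  exists (n : nat) (F : nat -> {vspace V}),
    [/\ F 0%N = 0%VS, F n = fullv,
        forall i, (F i <= F i.+1)%VS,
        forall g i, (rho g @: F i <= F i)%VS &
        forall g i v, v \in F i.+1 -> rho g v - v \in F i].

Record urep (G : topologicalGroupType) (k : topologicalFieldType) := URep {
  urep_space :> vectType k;
  urep_act : G -> 'End(urep_space);
  urep_act1 : urep_act 1%g = \1%VF;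
  urep_actM : forall g h, urep_act (g * h)%g = (urep_act g \o urep_act h)%VF;
  urep_act_continuous : continuous (fun g => f2mx (urep_act g));
  urep_act_unipotent : unipotent_action urep_act
}.

Definition equivariant (G : topologicalGroupType) (k : topologicalFieldType)
    (X Y : urep G k) (f : 'Hom(X, Y)) :=
  forall g v, f (urep_act X g v) = urep_act Y g (f v).

Section TensorRep.
Variables (G : topologicalGroupType) (k : topologicalFieldType).
Implicit Types V W : vectType k.

(* The tensor product of V and W is the space of (dim V) x (dim W) matrices. *)
Definition tens V W (v : V) (w : W) : 'M[k]_(dim V, dim W) :=
  (v2r v)^T *m v2r w.

Definition tens_end_fun V W (f : 'End(V)) (g : 'End(W))
    (M : 'M[k]_(dim V, dim W)) : 'M[k]_(dim V, dim W) :=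
  (f2mx f)^T *m M *m f2mx g.

Definition tens_end V W (f : 'End(V)) (g : 'End(W)) :
  'End('M[k]_(dim V, dim W)) := linfun (tens_end_fun f g).

Lemma tens_end_fun_linear V W (f : 'End(V)) (g : 'End(W)) :
  linear (tens_end_fun f g).
Proof.
by move=> c A B; rewrite /tens_end_fun mulmxDr mulmxDl -scalemxAr -scalemxAl.
Qed.

HB.instance Definition _ V W (f : 'End(V)) (g : 'End(W)) :=
  GRing.isLinear.Build k 'M[k]_(dim V, dim W) 'M[k]_(dim V, dim W) *:%R
    (tens_end_fun f g) (tens_end_fun_linear f g).

Lemma v2r_lfun V W (f : 'Hom(V, W)) v : v2r (f v) = v2r v *m f2mx f.
Proof. by rewrite unlock /= r2vK. Qed.

Lemma tens_endE V W (f : 'End(V)) (g : 'End(W)) v w :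
  tens_end f g (tens v w) = tens (f v) (g w).
Proof.
by rewrite lfunE /= /tens_end_fun /tens !v2r_lfun trmx_mul !mulmxA.
Qed.

Lemma f2mx_inj V W : injective (@f2mx k V W).
Proof. by case=> A [B] /= ->. Qed.

Lemma f2mx_id V : f2mx (\1%VF : 'End(V)) = 1%:M.
Proof.
apply/row_matrixP => i; rewrite !rowE mulmx1.
by rewrite -[delta_mx 0 i in LHS]r2vK -v2r_lfun id_lfunE r2vK.
Qed.

Lemma f2mx_comp V (f g : 'End(V)) : f2mx (f \o g)%VF = f2mx g *m f2mx f.
Proof.
apply/row_matrixP => i; rewrite !rowE mulmxA.
by rewrite -[delta_mx 0 i]r2vK -!v2r_lfun comp_lfunE.
Qed.

Lemma tens_end1 V W : tens_end (\1%VF : 'End(V)) (\1%VF : 'End(W)) = \1%VF.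
Proof.
apply/lfunP => M; rewrite lfunE /= id_lfunE /tens_end_fun !f2mx_id.
by rewrite trmx1 mul1mx mulmx1.
Qed.

Lemma tens_endM V W (f f' : 'End(V)) (g g' : 'End(W)) :
  tens_end (f \o f')%VF (g \o g')%VF = (tens_end f g \o tens_end f' g')%VF.
Proof.
apply/lfunP => M; rewrite comp_lfunE !lfunE /= /tens_end_fun !f2mx_comp.
by rewrite trmx_mul !mulmxA.
Qed.

Lemma continuous_mx (T : topologicalType) m n (F : T -> 'M[k]_(m, n)) :
  (forall i j, continuous (fun t => F t i j)) -> continuous F.
Proof.
move=> cF t A [P nP sPA].
have : \forall s \near t, forall ij : 'I_m * 'I_n, P ij.1 ij.2 (F s ij.1 ij.2).
  by apply: filter_forall => -[i j]; exact: (cF i j t _ (nP i j)).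
by apply: filterS => s Ps; apply: sPA => i j; exact: (Ps (i, j)).
Qed.

Lemma continuous_entry (T : topologicalType) m n (F : T -> 'M[k]_(m, n)) i j :
  continuous F -> continuous (fun t => F t i j).
Proof.
move=> cF t A nA; apply: (cF t [set M | A (M i j)]).
exists (fun i' j' => if (i' == i) && (j' == j) then A else setT).
  by move=> i' j'; case: ifP => [/andP[/eqP-> /eqP->]|_] //; exact: filterT.
by move=> M /(_ i j); rewrite !eqxx.
Qed.

Lemma continuous_add (T : topologicalType) (f g : T -> k) :
  continuous f -> continuous g -> continuous (fun t => f t + g t).
Proof.
move=> cf cg t.
apply: (@continuous_comp _ _ _ (fun t => (f t, g t)) (fun p => p.1 + p.2)).
  by apply: cvg_pair; [exact: cf|exact: cg].
exact: add_continuous.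
Qed.

Lemma continuous_mul (T : topologicalType) (f g : T -> k) :
  continuous f -> continuous g -> continuous (fun t => f t * g t).
Proof.
move=> cf cg t.
apply: (@continuous_comp _ _ _ (fun t => (f t, g t)) (fun p => p.1 * p.2)).
  by apply: cvg_pair; [exact: cf|exact: cg].
exact: mulf_continuous.
Qed.

Lemma continuous_cst (T : topologicalType) (c : k) :
  continuous (fun _ : T => c).
Proof. by move=> t; exact: cvg_cst. Qed.

Lemma continuous_sum (T : topologicalType) (I : Type) (r : seq I)
    (f : I -> T -> k) :
  (forall i, continuous (f i)) -> continuous (fun t => \sum_(i <- r) f i t).
Proof.
move=> cf; elim: r => [|i r IHr].
  under eq_fun do rewrite big_nil.
  exact: continuous_cst.
under eq_fun do rewrite big_cons.
exact: continuous_add.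
Qed.

Lemma continuous_mulmx (T : topologicalType) m n p (A : T -> 'M[k]_(m, n))
    (B : T -> 'M[k]_(n, p)) :
  continuous A -> continuous B -> continuous (fun t => A t *m B t).
Proof.
move=> cA cB; apply: continuous_mx => i j.
under eq_fun do rewrite mxE.
by apply: continuous_sum => l; apply: continuous_mul; exact: continuous_entry.
Qed.

Lemma continuous_trmx (T : topologicalType) m n (A : T -> 'M[k]_(m, n)) :
  continuous A -> continuous (fun t => (A t)^T).
Proof.
move=> cA; apply: continuous_mx => i j.
by under eq_fun do rewrite mxE; exact: continuous_entry.
Qed.

Lemma continuous_linear (T : topologicalType) m n p q
    (L : {linear 'M[k]_(m, n) -> 'M[k]_(p, q)}) (A : T -> 'M[k]_(m, n)) :
  continuous A -> continuous (fun t => L (A t)).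
Proof.
move=> cA; apply: continuous_mx => i j.
have -> : (fun t => L (A t) i j) =
    (fun t => \sum_a \sum_b A t a b * L (delta_mx a b) i j).
  apply/funext => t; rewrite {1}[A t]matrix_sum_delta linear_sum summxE.
  apply: eq_bigr => a _; rewrite linear_sum summxE.
  by apply: eq_bigr => b _; rewrite linearZ mxE.
apply: continuous_sum => a; apply: continuous_sum => b; apply: continuous_mul.
  exact: continuous_entry.
exact: continuous_cst.
Qed.

Lemma tens_end_continuous V W (rho : G -> 'End(V)) (sigma : G -> 'End(W)) :
  continuous (fun g => f2mx (rho g)) -> continuous (fun g => f2mx (sigma g)) ->
  continuous (fun g => f2mx (tens_end (rho g) (sigma g))).
Proof.
move=> cr cs; apply: continuous_mx => i j.
have E g : f2mx (tens_end (rho g) (sigma g)) i j =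
    v2r (tens_end_fun (rho g) (sigma g) (r2v (delta_mx 0 i))) 0 j.
  by rewrite -[tens_end_fun _ _ _]lfunE v2r_lfun r2vK -rowE mxE.
under eq_fun do rewrite E.
apply: continuous_entry.
apply: (continuous_linear (L := v2r)).
by apply: continuous_mulmx => //; apply: continuous_mulmx;
  [exact: continuous_trmx | move=> ?; exact: cvg_cst].
Qed.

Definition tens_space V W (A : {vspace V}) (B : {vspace W}) :
    {vspace 'M[k]_(dim V, dim W)} :=
  <<[seq tens v w | v <- vbasis A, w <- vbasis B]>>%VS.

Lemma tens_linear_l V W (w : W) : linear (fun v : V => tens v w).
Proof. by move=> c u v; rewrite /tens !linearP /= mulmxDl -scalemxAl. Qed.

Lemma tens_linear_r V W (v : V) : linear (fun w : W => tens v w).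
Proof. by move=> c u w; rewrite /tens linearP /= mulmxDr -scalemxAr. Qed.

Definition tens_l V W (w : W) (v : V) := tens v w.
HB.instance Definition _ V W (w : W) :=
  GRing.isLinear.Build k V 'M[k]_(dim V, dim W) *:%R
    (@tens_l V W w) (@tens_linear_l V W w).
HB.instance Definition _ V W (v : V) :=
  GRing.isLinear.Build k W 'M[k]_(dim V, dim W) *:%R
    (tens v) (@tens_linear_r V W v).

Lemma tens_sum V W (A : {vspace V}) (B : {vspace W}) v w :
  v \in A -> w \in B -> exists (a : 'I_(\dim A) -> k) (b : 'I_(\dim B) -> k),
  tens v w = \sum_i \sum_j a i *: (b j *: tens (vbasis A)`_i (vbasis B)`_j).
Proof.
move=> /coord_vbasis {1}-> /coord_vbasis {1}->.
exists (fun i => coord (vbasis A) i v), (fun j => coord (vbasis B) j w).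
rewrite -/(tens_l _ _) linear_sum; apply: eq_bigr => i _.
rewrite linearZ /= /tens_l linear_sum scaler_sumr.
by apply: eq_bigr => j _; rewrite linearZ.
Qed.

Lemma mem_tens_space V W (A : {vspace V}) (B : {vspace W}) v w :
  v \in A -> w \in B -> tens v w \in tens_space A B.
Proof.
move=> /tens_sum h/h[a [b ->]].
apply: memv_suml => i _; apply: memv_suml => j _; do 2![apply: memvZ].
by apply: memv_span; apply: allpairs_f; apply: mem_nth; rewrite size_tuple.
Qed.

Lemma tens_space_sub V W (A : {vspace V}) (B : {vspace W})
    (E : {vspace 'M[k]_(dim V, dim W)}) :
  (forall v w, v \in A -> w \in B -> tens v w \in E) ->
  (tens_space A B <= E)%VS.
Proof.
move=> AB; apply/span_subvP => _ /allpairsP[[v w] /= [vA wB ->]].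
by apply: AB; exact: vbasis_mem.
Qed.

Lemma tens_space_full V W :
  tens_space (fullv : {vspace V}) (fullv : {vspace W}) = fullv.
Proof.
apply/eqP; rewrite eqEsubv subvf /=; apply/subvP => M _.
rewrite [M]matrix_sum_delta; apply: memv_suml => i _; apply: memv_suml => j _.
apply: memvZ.
have -> : delta_mx i j = tens (r2v (delta_mx 0 i)) (r2v (delta_mx 0 j)).
  by rewrite /tens !r2vK trmx_delta mul_delta_mx.
by apply: mem_tens_space; exact: memvf.
Qed.

Lemma flag_mono V (F : nat -> {vspace V}) :
  (forall i, (F i <= F i.+1)%VS) -> forall i j, (i <= j)%N -> (F i <= F j)%VS.
Proof.
move=> F_mono i j /subnKC <-; elim: (j - i)%N => [|d IHd].
  by rewrite addn0 subvv.
by rewrite addnS; exact: subv_trans IHd (F_mono _).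
Qed.

Lemma tens_end_unipotent V W (rho : G -> 'End(V)) (sigma : G -> 'End(W)) :
  unipotent_action rho -> unipotent_action sigma ->
  unipotent_action (fun g => tens_end (rho g) (sigma g)).
Proof.
move=> [p [A [A0 Ap A_mono A_stab A_uni]]] [q [B [B0 Bq B_mono B_stab B_uni]]].
pose T i j := tens_space (A i) (B j).
pose F n := (\sum_(i < n.+2) T i (n.+1 - i)%N)%VS.
have T_F i j n : (i + j <= n.+1)%N -> (T i j <= F n)%VS.
  move=> ijn; have lt_i : (i < n.+2)%N by rewrite ltnS (leq_trans _ ijn) ?leq_addr.
  apply: subv_trans (sumv_sup (Ordinal lt_i) _ (subvv _)) => //=.
  apply: tens_space_sub => v w vA wB; apply: mem_tens_space => //.
  by apply: subvP wB; apply: flag_mono => //; rewrite leq_subRL // -ltnS.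
have T0r i : T i 0%N = 0%VS.
  apply/eqP; rewrite -subv0; apply: tens_space_sub => v w _.
  by rewrite B0 memv0 => /eqP->; rewrite linear0 mem0v.
have T0l j : T 0%N j = 0%VS.
  apply/eqP; rewrite -subv0; apply: tens_space_sub => v w.
  by rewrite A0 memv0 => /eqP->; rewrite -/(tens_l _ _) linear0 mem0v.
have F_mono n : (F n <= F n.+1)%VS.
  apply/subv_sumP => i _; apply: T_F; rewrite subnKC ?leqnSn //.
  by rewrite -ltnS ltn_ord.
have F_uni g n M : M \in F n.+1 -> tens_end (rho g) (sigma g) M - M \in F n.
  move=> /memv_sumP[N N_T ->].
  rewrite linear_sum -sumrB; apply: memv_suml => i _.
  have := N_T i isT; have : (i <= n.+2)%N by rewrite -ltnS ltn_ord.
  move: (N i) (nat_of_ord i) => {M N N_T i} M i le_i.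
  move: (subnKC le_i); move: (n.+2 - i)%N => [|j] Ej.
    by rewrite T0r memv0 => /eqP->; rewrite linear0 subr0 mem0v.
  have {}Ej : (i + j)%N = n.+1 by apply: succn_inj; rewrite -addnS.
  pose L := (tens_end (rho g) (sigma g) - \1)%VF.
  have LE N : L N = tens_end (rho g) (sigma g) N - N.
    by rewrite add_lfunE opp_lfunE id_lfunE.
  rewrite -LE memv_preim; apply: subvP; apply: tens_space_sub => v w vA wB.
  rewrite -memv_preim LE tens_endE.
  have -> : tens (rho g v) (sigma g w) - tens v w =
      tens (rho g v - v) (sigma g w) + tens v (sigma g w - w).
    rewrite linearB /= -!/(tens_l _ _) linearB /= /tens_l.
    by rewrite addrA subrK.
  apply: memvD.
    case: i vA Ej {le_i} => [|i] vA Ej.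
      move: vA; rewrite A0 memv0 => /eqP->.
      by rewrite linear0 subr0 -/(tens_l _ _) linear0 mem0v.
    apply: (subvP (T_F i j.+1 n _)); first by rewrite addnS -addSn Ej.
    apply: mem_tens_space; first exact: A_uni.
    by apply: (subvP (B_stab g j.+1)); exact: memv_img.
  apply: (subvP (T_F i j n _)); first by rewrite Ej.
  by apply: mem_tens_space => //; exact: B_uni.
have F0 : F 0%N = 0%VS.
  by rewrite /F big_ord_recl big_ord_recl big_ord0 /= subnn T0r T0l !add0v.
exists (p + q)%N, F; split=> //.
- apply/eqP; rewrite eqEsubv subvf /= -tens_space_full -Ap -Bq.
  by apply: (T_F p q); exact: leqnSn.
- move=> g n; apply/subvP => _ /memv_imgP[M FM ->].
  case: n FM => [|n] FM.
    by move: FM; rewrite F0 memv0 => /eqP->; rewrite linear0 mem0v.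
  rewrite -[tens_end _ _ M](subrK M); apply: memvD => //.
  by apply: (subvP (F_mono n)); exact: F_uni.
Qed.

Definition urep_tens (X Y : urep G k) : urep G k.
Proof.
exists 'M[k]_(dim X, dim Y) (fun g => tens_end (urep_act X g) (urep_act Y g)).
- by rewrite !urep_act1 tens_end1.
- by move=> g h; rewrite !urep_actM tens_endM.
- by apply: tens_end_continuous; exact: urep_act_continuous.
- by apply: tens_end_unipotent; exact: urep_act_unipotent.
Defined.

Definition urep_unit : urep G k.
Proof.
exists k^o (fun _ => \1%VF) => //.
- by move=> *; apply/lfunP => v; rewrite comp_lfunE !id_lfunE.
- by move=> ?; exact: cvg_cst.
- exists 1%N, (fun i => if i is 0%N then 0%VS else fullv); split=> //.
  + by move=> [|i]; rewrite subvf.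
  + by move=> g i; apply/subvP => _ /memv_imgP[v vF ->]; rewrite id_lfunE.
  + by move=> g i v _; rewrite id_lfunE subrr mem0v.
Defined.
End TensorRep.

(** * Tensor automorphisms of the forgetful functor *)

Section TensorAutomorphisms.
Variables (G : topologicalGroupType) (k : topologicalFieldType).

(* V (x)_k R is the space R^(dim V) of row vectors, via the coordinates
   [v2r : V -> k^(dim V)]. *)
Definition base_vec (V : vectType k) (R : comAlgType k) (v : V) :
  'rV[R]_(dim V) := map_mx (in_alg R) (v2r v).

(* f (x) R; it maps [base_vec R v] to [base_vec R (f v)]. *)
Definition base_lfun (V W : vectType k) (R : comAlgType k) (f : 'Hom(V, W))
  (x : 'rV[R]_(dim V)) : 'rV[R]_(dim W) := x *m map_mx (in_alg R) (f2mx f).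

(* The R-bilinear map (V (x) R) x (W (x) R) -> (V (x) W) (x) R which sends
   (v (x) 1, w (x) 1) to (v (x) w) (x) 1. *)
Definition base_tens (V W : vectType k) (R : comAlgType k)
    (x : 'rV[R]_(dim V)) (y : 'rV[R]_(dim W)) :
    'rV[R]_(dim 'M[k]_(dim V, dim W)) :=
  \sum_i \sum_j (x 0 i * y 0 j) *:
    base_vec R (tens (r2v (delta_mx 0 i) : V) (r2v (delta_mx 0 j) : W)).

Definition endo_family (R : comAlgType k) :=
  forall X : urep G k, {linear 'rV[R]_(dim X) -> 'rV[R]_(dim X)}.

Record tensor_aut (R : comAlgType k) (lam : endo_family R) : Prop := TensorAut {
  tensor_aut_bij : forall X, bijective (lam X);
  tensor_aut_nat : forall (X Y : urep G k) (f : 'Hom(X, Y)), equivariant f ->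
    forall x, lam Y (base_lfun f x) = base_lfun f (lam X x);
  tensor_aut_tens : forall (X Y : urep G k) x y,
    lam (urep_tens X Y) (base_tens x y) = base_tens (lam X x) (lam Y y);
  tensor_aut_unit : lam (urep_unit G k) =1 id
}.

(* [theta] is an isomorphism of group-valued functors from the functor of
   points of U to R |-> Aut^(x)(omega)(R).  In [theta_nat], the base change of
   an automorphism along R -> S is characterised by its values on the image of
   V (x) R, which spans V (x) S. *)
Record represents_aut (U : affineGroup k)
    (theta : forall R : comAlgType k, points U R -> endo_family R) : Prop :=
  RepresentsAut {
  theta_aut : forall R (x : points U R), tensor_aut (theta R x);
  theta_mul : forall R (x y : points U R) X,
    theta R (point_mul x y) X =1 theta R x X \o theta R y X;
  theta_nat : forall (R S : comAlgType k) (phi : {lrmorphism R -> S})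
      (x : points U R) X v,
    theta S (point_map phi x) X (map_mx phi v) = map_mx phi (theta R x X v);
  theta_inj : forall R (x y : points U R),
    (forall X, theta R x X =1 theta R y X) -> x =1 y;
  theta_surj : forall R (lam : endo_family R), tensor_aut lam ->
    exists x : points U R, forall X, theta R x X =1 lam X
}.

(* c : G -> U(k) sends g to the tensor automorphism given by the action of g on
   every representation. *)
Definition canonical_hom (U : affineGroup k)
    (theta : forall R : comAlgType k, points U R -> endo_family R)
    (c : G -> kpoints U) :=
  forall g X, theta k^o (c g) X =1 base_lfun (urep_act X g).

End TensorAutomorphisms.

(* Main.v *)
(* Evaluating the universal automorphism over R = O(U) shows that O(U) is spanned
   by the matrix coefficients coef v xi of the unipotent representations X of G,
   and the point c g sends coef v xi to xi (g v).  If xi (g v) does not depend on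
   g then xi is equivariant on the subrepresentation spanned by the orbit of v,
   so coef v xi is constant; hence an element of O(U) is determined by its
   values at the points c g, and O(U) is identified with the algebra of matrix
   coefficient functions on G.

   Homomorphisms U -> V are therefore determined by their values on G.  A
   continuous homomorphism phi : G -> V(k), V pro-unipotent, pulls coordinate
   functions of the unipotent quotients of V back to matrix coefficients of
   unitriangular representations of G, which defines the comorphism O(V) -> O(U).
   U is pro-unipotent because the matrix coefficients are functions of finite
   degree on G (killed by iterated differences), and a matrix representation
   whose entries have finite degree is unitriangularizable.

   For the topology one needs that a map into V(k) is continuous iff all its
   coordinates are.  For unipotent V, the coordinates of log x are polynomials
   in the entries of x and conversely: log x is the derivative at t = 0 of the
   polynomial t |-> x^t interpolating the powers of x.  In general one uses that
   every element of O(V) lies in a finitely generated Hopf subalgebra. *)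

Require Import Defs.
From HB Require Import structures.
From mathcomp Require Import all_boot all_order all_algebra.
From mathcomp Require Import all_classical all_reals all_analysis.

Set Implicit Arguments.
Unset Strict Implicit.
Unset Printing Implicit Defensive.

Import GRing.Theory VectorInternalTheory.

Local Open Scope classical_set_scope.
Local Open Scope ring_scope.

(** Tensors are sequences up to bilinear test maps, so there is no tensor space in which to invoke
    injectivity. Equality of tensors is tested on separating families of functionals, or transported
    along a linear retraction; both rest on complements given by Zorn's lemma. Finite degree
    replaces flags because it is a property of single functions: a comodule of a quotient of U
    restricts to a representation of G that is not presented inside the given category, but its
    entries lie in O(U) and so have finite degree. Pro-unipotence speaks of quotients of finite type
    only. The Hopf subalgebra enclosing an element is made stable under the antipode by adjoining
    the inverse of a comodule matrix. That the coefficients generate O(U) requires a tensor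
    automorphism over the subalgebra they generate. Its inverse must be defined there too, and comes
    from the finite geometric series of a unipotent matrix. Characteristic zero enters by dividing
    by factorials and by determining a polynomial from its values at the natural numbers. *)

Lemma linear_combination (R : pzRingType) (A B : lmodType R) (f : A -> B)
    (I : Type) (r : seq I) (c : I -> R) (F : I -> A) :
  linear f -> f (\sum_(i <- r) c i *: F i) = \sum_(i <- r) c i *: f (F i).
Proof.
move=> fl; elim: r => [|i r IHr]; last by rewrite !big_cons fl IHr.
have := fl 1 0 0; rewrite !big_nil !scale1r addr0 => /eqP.
by rewrite -subr_eq0 opprD addNKr oppr_eq0 => /eqP.
Qed.

(** * Tensors, complements and separating functionals *)

Section LinearAlgebra.
Variable k : fieldType.
Implicit Types A B C Z : lmodType k.

Definition linear_pack A B (f : A -> B) (f_lin : linear f) :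
  {linear A -> B} := HB.pack f (GRing.isLinear.Build k A B *:%R f f_lin).

Definition separately_linear A B Z (b : A -> B -> Z) :=
  (forall y, linear (b^~ y)) /\ (forall x, linear (b x)).

Lemma tensor_eq_sum A B Z (s t : seq (A * B)) (b : A -> B -> Z) :
    tensor_eq s t -> separately_linear b ->
  \sum_(p <- s) b p.1 p.2 = \sum_(p <- t) b p.1 p.2.
Proof.
move=> st [bl br].
pose b' : {bilinear A -> B -> Z} := HB.pack b
  (bilinear_isBilinear.Build k A B Z *:%R *:%R b (bl, br)).
exact: (st Z b').
Qed.

Lemma tensor_eq_of_sum A B (s t : seq (A * B)) :
  (forall Z (b : A -> B -> Z), separately_linear b ->
    \sum_(p <- s) b p.1 p.2 = \sum_(p <- t) b p.1 p.2) -> tensor_eq s t.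
Proof.
move=> st Z b; apply: st; split=> [y|x] c u v; first exact: linearPl.
exact: linearPr.
Qed.

Definition subspace A (H : set A) :=
  H 0 /\ forall c x y, H x -> H y -> H (c *: x + y).

Lemma subspaceD A (H : set A) x y : subspace H -> H x -> H y -> H (x + y).
Proof. by move=> [_ HH] Hx Hy; rewrite -[x]scale1r; apply: HH. Qed.

Lemma subspaceZ A (H : set A) c x : subspace H -> H x -> H (c *: x).
Proof. by move=> [H0 HH] Hx; rewrite -[_ *: _]addr0; apply: HH. Qed.

Lemma subspaceB A (H : set A) x y : subspace H -> H x -> H y -> H (x - y).
Proof.
by move=> sH Hx Hy; rewrite addrC -scaleN1r; apply: sH.2.
Qed.

(** Zorn's lemma extends [K0] to a subspace K maximal among those that meet [H] trivially.
    Maximality forces H + K to be everything, and [p] is the projection onto [H] along K. *)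
Lemma complement_projection A (H K0 : set A) :
    subspace H -> subspace K0 -> (forall x, H x -> K0 x -> x = 0) ->
  exists p : {linear A -> A},
    [/\ forall x, H (p x), forall x, H x -> p x = x &
        forall x, K0 x -> p x = 0].
Proof.
move=> sH sK0 HK0.
(* The condition is put on the union of [K0] and [X], so that it also holds for the empty union
   coming from the empty chain. *)
pose P (X : set A) :=
  subspace (K0 `|` X) /\ forall x, H x -> (K0 `|` X) x -> x = 0.
have [F FP tF|X [[sK HK] maxX]] := @Zorn_bigcup _ P.
  split; first split; first by left; exact: sK0.1.
    move=> c x y [Kx|[X FX Xx]] [Ky|[Y FY Yy]].
    - by left; apply: sK0.2.
    - have [|Yz] := (FP _ FY).1.2 c x y (or_introl Kx) (or_intror Yy).
        by left.
      by right; exists Y.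
    - have [|Xz] := (FP _ FX).1.2 c x y (or_intror Xx) (or_introl Ky).
        by left.
      by right; exists X.
    - have [XY|YX] := tF _ _ FX FY.
        have [|Yz] := (FP _ FY).1.2 c x y (or_intror (XY _ Xx)) (or_intror Yy).
          by left.
        by right; exists Y.
      have [|Xz] := (FP _ FX).1.2 c x y (or_intror Xx) (or_intror (YX _ Yy)).
        by left.
      by right; exists X.
  move=> x Hx [Kx|[X FX Xx]]; first exact: HK0.
  by apply: (FP _ FX).2 => //; right.
set K := K0 `|` X in sK HK.
have HKtot v : exists h, H h /\ K (v - h).
  apply: contrapT => nHK.
  (* If [v] is outside H + K, then K + k v contradicts maximality: an element of [H] in it with
     nonzero coefficient at [v] would put [v] in H + K. *)
  pose Y := [set x | exists c y, K y /\ x = c *: v + y].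
  have KY : K `<=` Y by move=> x Kx; exists 0, x; rewrite scale0r add0r.
  have sY : subspace Y.
    split; first by apply: KY; exact: sK.1.
    move=> c _ _ [d [y [Ky ->]]] [d' [y' [Ky' ->]]].
    exists (c * d + d'), (c *: y + y'); split; first exact: sK.2.
    by rewrite scalerDr scalerA scalerDl addrACA.
  have Yv : Y v by exists 1, 0; split; [exact: sK.1|rewrite scale1r addr0].
  have YE : K0 `|` Y = Y.
    apply/seteqP; split=> x; last by right.
    by case=> // Kx; apply: KY; left.
  apply: (maxX Y).
    split; first by move=> x Xx; apply: KY; right.
    move=> /(_ _ Yv) Xv; apply: nHK; exists 0; split; first exact: sH.1.
    by rewrite subr0; right.
  split; rewrite YE // => x Hx [c [y [Ky xE]]].
  have [c0|c0] := eqVneq c 0.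
    by apply: HK => //; rewrite xE c0 scale0r add0r.
  exfalso; apply: nHK; exists (c^-1 *: x); split; first exact: subspaceZ.
  rewrite xE scalerDr scalerA mulVf // scale1r opprD addNKr.
  by rewrite -scaleNr; apply: subspaceZ.
pose p v := sval (cid (HKtot v)).
have pP v : H (p v) /\ K (v - p v) by rewrite /p; case: cid.
have p_uniq v h : H h -> K (v - h) -> p v = h.
  move=> Hh Kh; apply/eqP; rewrite -subr_eq0; apply/eqP; apply: HK.
    by apply: subspaceB => //; exact: (pP v).1.
  have -> : p v - h = (v - h) - (v - p v) by rewrite opprB [RHS]addrC subrKA.
  by apply: subspaceB => //; exact: (pP v).2.
have p_lin : linear p.
  move=> c u v; apply: p_uniq; first by apply: sH.2; apply: (pP _).1.
  rewrite opprD addrACA -scalerBr; apply: sK.2; exact: (pP _).2.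
exists (linear_pack p_lin); split=> [x|x Hx|x Kx] /=.
- exact: (pP x).1.
- by apply: p_uniq => //; rewrite subrr; exact: sK.1.
- by apply: p_uniq; [exact: sH.1|rewrite subr0; left].
Qed.

(** The functional is the coefficient of [a] in the projection onto the line of [a] along a
    complement containing [K]. *)
Lemma separating_functional A (K : set A) a : subspace K -> ~ K a ->
  exists phi : {linear A -> k^o}, phi a = 1 /\ forall x, K x -> phi x = 0.
Proof.
move=> sK Ka; pose H := [set x | exists c : k, x = c *: a].
have a0 : a != 0 by apply/eqP => a0; apply: Ka; rewrite a0; exact: sK.1.
have sH : subspace H.
  split; first by exists 0; rewrite scale0r.
  by move=> c _ _ [d ->] [e ->]; exists (c * d + e); rewrite scalerDl scalerA.
have [_ [c ->] Kx|p [Hp pid p0]] := complement_projection sH sK.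
  have [->|c0] := eqVneq c 0; first by rewrite scale0r.
  by exfalso; apply: Ka; rewrite -[a]scale1r -(mulVf c0) -scalerA; apply: subspaceZ.
pose q x := sval (cid (Hp x)); have qP x : p x = q x *: a by rewrite /q; case: cid.
have q_uniq x c : p x = c *: a -> q x = c.
  rewrite qP => /eqP; rewrite -subr_eq0 -scalerBl scaler_eq0 (negPf a0) orbF.
  by rewrite subr_eq0 => /eqP.
have q_lin : linear (q : A -> k^o).
  by move=> c x y; apply: q_uniq; rewrite linearP !qP scalerDl scalerA.
exists (linear_pack q_lin); split=> /= [|x Kx]; apply: q_uniq.
  by rewrite scale1r pid //; exists 1; rewrite scale1r.
by rewrite p0 // scale0r.
Qed.

Definition separating A (I : Type) (phi : I -> {linear A -> k^o}) :=
  forall a, (forall i, phi i a = 0) -> a = 0.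

(* If [psi j b <> 0] for the first term [a (x) b], the relation
   [\sum_p psi j p.2 *: p.1 = 0] expresses [a] by the remaining left factors, so
   the tensor can be rewritten with one term less. *)
Lemma tensor_eq0_separating A B (I J : Type) (phi : I -> {linear A -> k^o})
    (psi : J -> {linear B -> k^o}) (s : seq (A * B)) :
    separating phi -> separating psi ->
    (forall i j, \sum_(p <- s) (phi i p.1 : k) * psi j p.2 = 0) ->
  tensor_eq s [::].
Proof.
move=> sphi spsi.
move: {2}(size s) (leqnn (size s)) => n; elim: n s => [|n IHn] [|[a b] s] //=.
rewrite ltnS => le_sn s0.
have sa j : (psi j b : k) *: a + \sum_(p <- s) (psi j p.2 : k) *: p.1 = 0.
  apply: sphi => i; rewrite linearD linearZ linear_sum /= -[RHS](s0 i j).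
  rewrite big_cons /=; congr (_ + _); first by rewrite /GRing.scale /= mulrC.
  by apply: eq_bigr => p _; rewrite linearZ /= /GRing.scale /= mulrC.
have [b0|] := pselect (forall j, psi j b = 0).
  have {}b0 : b = 0 by apply: spsi.
  have : tensor_eq s [::].
    apply: IHn => // i j; rewrite -[RHS](s0 i j) big_cons b0 /= linear0.
    by rewrite mulr0 add0r.
  move=> st; apply: tensor_eq_of_sum => Z f fl; rewrite big_cons /= b0.
  rewrite (tensor_eq_sum st fl).
  by have /= -> := linear0 (linear_pack (fl.2 a)); rewrite add0r.
move=> /existsNP[j /eqP bj0].
pose c (p : A * B) : k := - ((psi j b)^-1 * psi j p.2).
have aE : a = \sum_(p <- s) c p *: p.1.
  apply/eqP; rewrite -subr_eq0; apply/eqP.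
  have -> : a - \sum_(p <- s) c p *: p.1 = (psi j b)^-1 *:
      ((psi j b : k) *: a + \sum_(p <- s) (psi j p.2 : k) *: p.1).
    rewrite scalerDr scalerA mulVf // scale1r; congr (_ + _).
    rewrite scaler_sumr -sumrN; apply: eq_bigr => p _.
    by rewrite scalerA -scaleNr opprK.
  by rewrite sa scaler0.
pose s' := [seq (p.1, p.2 + c p *: b) | p <- s].
have sE Z (f : A -> B -> Z) : separately_linear f ->
    \sum_(p <- (a, b) :: s) f p.1 p.2 = \sum_(p <- s') f p.1 p.2.
  move=> fl; rewrite big_cons big_map /= {1}aE.
  have /= -> := linear_sum (linear_pack (fl.1 b)).
  rewrite -big_split; apply: eq_bigr => p _ /=.
  have /= -> := linearZ_LR (linear_pack (fl.1 b)).
  have /= -> := linearD (linear_pack (fl.2 p.1)).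
  by have /= -> := linearZ_LR (linear_pack (fl.2 p.1)); rewrite addrC.
have : tensor_eq s' [::].
  apply: IHn; first by rewrite size_map.
  move=> i j'; rewrite -[RHS](s0 i j').
  rewrite -(sE k^o (fun x y => (phi i x : k) * psi j' y)) //.
  split=> [y|x] d u v /=; rewrite linearP /= /GRing.scale /=.
    by rewrite mulrDl mulrA.
  by rewrite mulrDr mulrCA.
by move=> st; apply: tensor_eq_of_sum => Z f fl; rewrite sE // (tensor_eq_sum st fl).
Qed.

(** Negating the second factors of [t] reduces this to a vanishing tensor. Applied to the points of
    U coming from G, it embeds O(U) (x) O(U) into the functions on G x G. *)
Lemma tensor_eq_separating A B (I J : Type) (phi : I -> {linear A -> k^o})
    (psi : J -> {linear B -> k^o}) (s t : seq (A * B)) :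
    separating phi -> separating psi ->
    (forall i j, \sum_(p <- s) (phi i p.1 : k) * psi j p.2 =
                 \sum_(p <- t) (phi i p.1 : k) * psi j p.2) ->
  tensor_eq s t.
Proof.
move=> sphi spsi st; pose nt := [seq (p.1, - p.2) | p <- t].
have ntE Z (f : A -> B -> Z) : separately_linear f ->
    \sum_(p <- nt) f p.1 p.2 = - \sum_(p <- t) f p.1 p.2.
  move=> fl; rewrite big_map -sumrN; apply: eq_bigr => p _ /=.
  exact: (linearN (linear_pack (fl.2 p.1))).
have st0 : tensor_eq (s ++ nt) [::].
  apply: tensor_eq0_separating sphi spsi _ => i j.
  rewrite big_cat /= (ntE k^o (fun x y => (phi i x : k) * psi j y)).
    by rewrite st subrr.
  split=> [y|x] d u v /=; rewrite linearP /= /GRing.scale /=.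
    by rewrite mulrDl mulrA.
  by rewrite mulrDr mulrCA.
apply: tensor_eq_of_sum => Z f fl; apply/eqP; rewrite -subr_eq0 -ntE //.
by rewrite -big_cat (tensor_eq_sum st0 fl) big_nil.
Qed.

End LinearAlgebra.

Section VectorSpaces.
Variable k : fieldType.

(** A space of maximal dimension inside [H] exhausts it, since otherwise a missing vector could be
    adjoined. *)
Lemma subspace_vspace (V : vectType k) (H : set V) : subspace H ->
  exists W : {vspace V}, forall v, v \in W <-> H v.
Proof.
move=> sH.
pose P d := `[< exists W : {vspace V}, (forall v, v \in W -> H v) /\ \dim W = d >].
have exP : exists d, P d.
  exists 0%N; apply/asboolP; exists 0%VS; split; last exact: dimv0.
  by move=> v; rewrite memv0 => /eqP->; exact: sH.1.
have ubP d : P d -> (d <= \dim {:V})%N.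
  by move=> /asboolP[W [_ <-]]; apply: dimvS; exact: subvf.
case: (ex_maxnP exP ubP) => _ /asboolP[W [WH <-]] maxW.
exists W => v; split; first exact: WH.
move=> Hv; apply: contraT => vW.
have : (\dim (W + <[v]>)%VS <= \dim W)%N.
  apply: maxW; apply/asboolP; exists (W + <[v]>)%VS; split=> // u.
  move=> /memv_addP[w wW [_ /vlineP[c ->] ->]].
  by apply: subspaceD => //; [exact: WH|exact: subspaceZ].
move=> le_dim; have : (W == W + <[v]>)%VS by rewrite eqEdim addvSl.
move=> /eqP E; move: vW; rewrite {1}E => /negP[].
by apply: (subvP (addvSr W _)); exact: memv_line.
Qed.

End VectorSpaces.

Definition upper_unitriangular (R : nzRingType) d (A : 'M[R]_d) :=
  (forall i, A i i = 1) /\ forall i j : 'I_d, (j < i)%N -> A i j = 0.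

Lemma upper_unitriangular_block (R : nzRingType) m n (A : 'M[R]_m)
    (B : 'M[R]_(m, n)) (C : 'M[R]_n) :
  upper_unitriangular A -> upper_unitriangular C ->
  upper_unitriangular (block_mx A B 0 C).
Proof.
move=> [A1 A0] [C1 C0]; split=> [i|i j].
  by case: (split_ordP i) => a ->; rewrite ?block_mxEul ?block_mxEdr.
case: (split_ordP i) => a ->; case: (split_ordP j) => b -> /=.
- by rewrite block_mxEul; exact: A0.
- by rewrite ltnNge (leq_trans (ltnW (ltn_ord a))) ?leq_addr.
- by rewrite block_mxEdl mxE.
- by rewrite block_mxEdr ltn_add2l; exact: C0.
Qed.

(** * Functions of finite degree and unipotent representations *)

Section PolynomialFunctions.
Variables (G : groupType) (k : fieldType).
Implicit Types f : G -> k.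

(* Fréchet's definition: n right differences kill f. *)
Fixpoint deg_lt (n : nat) f : Prop :=
  if n is n'.+1 then forall g, deg_lt n' (fun h => f (h * g)%g - f h)
  else forall g, f g = 0.

Lemma eq_deg_lt n f f' : f =1 f' -> deg_lt n f -> deg_lt n f'.
Proof. by move=> /funext->. Qed.

Lemma deg_lt0 n : deg_lt n (fun=> 0).
Proof. by elim: n => //= n IHn g; apply: eq_deg_lt IHn => h; rewrite subrr. Qed.

Lemma deg_ltS n f : deg_lt n f -> deg_lt n.+1 f.
Proof.
elim: n f => [|n IHn] f /= f_deg g; first by move=> h; rewrite !f_deg subr0.
exact: IHn.
Qed.

Lemma deg_lt_le m n f : (m <= n)%N -> deg_lt m f -> deg_lt n f.
Proof.
by move=> /subnK <- fm; elim: (n - m)%N => // d IHd; rewrite addSn; exact: deg_ltS.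
Qed.

Lemma deg_ltD n f f' : deg_lt n f -> deg_lt n f' -> deg_lt n (fun g => f g + f' g).
Proof.
elim: n f f' => [|n IHn] f f' /= df df' g; first by rewrite df df' addr0.
by apply: eq_deg_lt (IHn _ _ (df g) (df' g)) => h; rewrite opprD addrACA.
Qed.

Lemma deg_ltZ n c f : deg_lt n f -> deg_lt n (fun g => c * f g).
Proof.
elim: n f => [|n IHn] f /= df g; first by rewrite df mulr0.
by apply: eq_deg_lt (IHn _ (df g)) => h; rewrite mulrBr.
Qed.

Lemma deg_lt_sum (I : Type) (r : seq I) (F : I -> G -> k) n :
  (forall i, deg_lt n (F i)) -> deg_lt n (fun g => \sum_(i <- r) F i g).
Proof.
move=> dF; elim: r => [|i r IHr].
  by apply: eq_deg_lt (deg_lt0 n) => g; rewrite big_nil.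
by apply: eq_deg_lt (deg_ltD (dF i) IHr) => g; rewrite big_cons.
Qed.

Lemma deg_lt_uniform (I : finType) (F : I -> G -> k) :
  (forall i, exists n, deg_lt n (F i)) -> exists n, forall i, deg_lt n (F i).
Proof.
move=> /choice[n nP]; exists (\max_i n i)%N => i.
by apply: deg_lt_le (nP i); exact: leq_bigmax.
Qed.

(** The difference by g of the coefficient of v is the coefficient of [rho g v - v], which lies one
    step lower in the flag. *)
Lemma unipotent_deg_lt (V : vectType k) (rho : G -> 'End(V)) :
    (forall g h, rho (g * h)%g = (rho g \o rho h)%VF) -> unipotent_action rho ->
  exists n, forall (xi : 'Hom(V, k^o)) v, deg_lt n (fun g => xi (rho g v)).
Proof.
move=> rhoM [n [F [F0 Fn _ _ F_uni]]].
suff H i (xi : 'Hom(V, k^o)) v : v \in F i -> deg_lt i (fun g => xi (rho g v)).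
  by exists n => xi v; apply: H; rewrite Fn memvf.
elim: i v => [|i IHi] v vF /=.
  by move: vF; rewrite F0 memv0 => /eqP-> g; rewrite !linear0.
move=> g; apply: eq_deg_lt (IHi _ (F_uni g i v vF)) => h.
by rewrite !linearB /= rhoM comp_lfunE.
Qed.

(** The flag is intrinsic: step i consists of the vectors all of whose coefficients have degree
    below i. Triviality on successive quotients is the definition of degree, and stability under G
    follows from it. *)
Lemma deg_lt_unipotent (V : vectType k) (rho : G -> 'End(V)) n :
    rho 1%g = \1%VF -> (forall g h, rho (g * h)%g = (rho g \o rho h)%VF) ->
    (forall (xi : 'Hom(V, k^o)) v, deg_lt n (fun g => xi (rho g v))) ->
  unipotent_action rho.
Proof.
move=> rho1 rhoM dn.
pose H i := [set v | forall xi : 'Hom(V, k^o), deg_lt i (fun g => xi (rho g v))].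
have sH i : subspace (H i).
  split=> [xi|c u v Hu Hv xi].
    by apply: eq_deg_lt (deg_lt0 _) => g; rewrite !linear0.
  by apply: eq_deg_lt (deg_ltD (deg_ltZ c (Hu xi)) (Hv xi)) => g; rewrite !linearP.
have [F FP] := choice (fun i => subspace_vspace (sH i)).
have F_mono i : (F i <= F i.+1)%VS.
  by apply/subvP => v /FP Hv; apply/FP => xi; apply: deg_ltS.
have F_uni g i v : v \in F i.+1 -> rho g v - v \in F i.
  move=> /FP Hv; apply/FP => xi; apply: eq_deg_lt (Hv xi g) => h.
  by rewrite !linearB /= rhoM comp_lfunE.
have F0 : F 0%N = 0%VS.
  apply/eqP; rewrite -subv0; apply/subvP => v /FP Hv.
  rewrite memv0; apply/eqP/(can_inj v2rK)/rowP => i.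
  pose coord_i u : k^o := v2r u 0 i.
  have cl : linear coord_i by move=> c u w; rewrite /coord_i linearP !mxE.
  have := Hv (linfun (linear_pack cl)) 1%g.
  by rewrite rho1 id_lfunE lfunE /= /coord_i => ->; rewrite linear0 mxE.
exists n, F; split=> //.
- by apply/eqP; rewrite eqEsubv subvf /=; apply/subvP => v _; apply/FP => xi.
- move=> g i; apply/subvP => _ /memv_imgP[v vF ->].
  case: i vF => [|i] vF.
    by move: vF; rewrite F0 memv0 => /eqP->; rewrite linear0 mem0v.
  rewrite -[rho g v](subrK v); apply: memvD => //.
  by apply: (subvP (F_mono i)); exact: F_uni.
Qed.

(* A nonzero vector whose orbit map has minimal degree is fixed: otherwise
   [rho g *m w - w] would have smaller degree. *)
Lemma deg_lt_fixed_col d (rho : G -> 'M[k]_d.+1) :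
    rho 1%g = 1%:M -> (forall g h, rho (g * h)%g = rho g *m rho h) ->
    (forall i j, exists n, deg_lt n (fun g => rho g i j)) ->
  exists2 w : 'cV[k]_d.+1, w != 0 & forall g, rho g *m w = w.
Proof.
move=> rho1 rhoM drho.
pose P n := `[< exists2 w : 'cV[k]_d.+1, w != 0 &
  forall i, deg_lt n (fun g => (rho g *m w) i 0) >].
have exP : exists n, P n.
  have [n nP] := deg_lt_uniform (fun i => drho i ord0).
  exists n; apply/asboolP; exists (delta_mx ord0 ord0).
    apply/eqP => /matrixP/(_ ord0 ord0); rewrite !mxE !eqxx /=.
    by move/eqP; rewrite oner_eq0.
  by move=> i; apply: eq_deg_lt (nP i) => g; rewrite -colE mxE.
case: (ex_minnP exP) => n /asboolP[w w0 dw] minn.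
exists w => // g; case: n dw minn => [|n] dw minn.
  by case/eqP: w0; apply/colP => i; rewrite -[w]mul1mx -rho1 dw mxE.
apply: contrapT => /eqP gw.
have : P n.
  apply/asboolP; exists (rho g *m w - w); first by rewrite subr_eq0.
  move=> i; apply: eq_deg_lt (dw i g) => h.
  by rewrite mulmxBr mulmxA -rhoM !mxE.
by move/minn; rewrite ltnn.
Qed.

(** A fixed vector is completed to a basis. The lower right block is again a representation, whose
    entries are fixed combinations of those of [rho] and so have finite degree. *)
Lemma deg_lt_unitriangularizable d (rho : G -> 'M[k]_d) :
    rho 1%g = 1%:M -> (forall g h, rho (g * h)%g = rho g *m rho h) ->
    (forall i j, exists n, deg_lt n (fun g => rho g i j)) ->
  exists2 Q, Q \in unitmx & forall g, upper_unitriangular (invmx Q *m rho g *m Q).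
Proof.
elim: d rho => [|d IHd] rho rho1 rhoM drho.
  by exists 1%:M; [exact: unitmx1|move=> g; split=> -[]].
have [w w0 rw] := deg_lt_fixed_col rho1 rhoM drho.
pose U : 'rV[k]_d.+1 := delta_mx 0 0.
(* The constant-row matrix only supplies [w^T] as first row. [complete_unitmx] gives an invertible
   matrix with that first row, and its transpose has first column [w]. *)
have [g0 g0u Ug] : {g | g \in unitmx & U *m (\matrix_(i < d.+1) w^T) = U *m g}.
  apply: complete_unitmx; rewrite -rowE rowK mxrank_delta; apply/eqP.
  by rewrite eqn_leq (rank_leq_row w^T) lt0n mxrank_eq0 trmx_eq0.
pose Q0 := g0^T; have Q0u : Q0 \in unitmx by rewrite unitmx_tr.
have Q0w : Q0 *m trmx U = w.
  by rewrite -trmx_mul -Ug -rowE rowK trmxK.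
pose A g : 'M[k]_(1 + d) := invmx Q0 *m rho g *m Q0.
have A0 g : A g *m trmx U = trmx U by rewrite /A -!mulmxA Q0w rw -Q0w mulKmx.
have AM g h : A (g * h)%g = A g *m A h.
  by rewrite /A rhoM !mulmxA mulmxK.
have A1 : A 1%g = 1%:M by rewrite /A rho1 mulmx1 mulVmx.
pose rho' g := drsubmx (A g).
have AE g : A g = block_mx 1%:M (ursubmx (A g)) 0 (rho' g).
  rewrite -[LHS]submxK; congr block_mx.
    apply/matrixP => i j; rewrite !ord1 !mxE.
    have /matrixP/(_ (lshift d ord0) 0) := A0 g.
    by rewrite trmx_delta -colE !mxE !lshift0.
  apply/matrixP => i j; rewrite !ord1 !mxE.
  have /matrixP/(_ (rshift 1 i) 0) := A0 g.
  by rewrite trmx_delta -colE !mxE !lshift0 => ->; case: eqP.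
have rho'1 : rho' 1%g = 1%:M.
  by rewrite /rho' A1 -[1%:M]submxK scalar_mx_block !block_mxKdr.
have rho'M g h : rho' (g * h)%g = rho' g *m rho' h.
  by rewrite {1}/rho' AM (AE g) (AE h) mulmx_block !block_mxKdr mul0mx add0r.
have [|Q' Q'u Q'P] := IHd rho' rho'1 rho'M.
  move=> i j.
  have : forall ab : 'I_d.+1 * 'I_d.+1, exists n, deg_lt n (fun g => rho g ab.1 ab.2).
    by move=> ab; exact: drho.
  move/deg_lt_uniform => [n nP]; exists n.
  have dn : deg_lt n (fun g => \sum_b \sum_a
      (invmx Q0 (rshift 1 i) a * Q0 b (rshift 1 j)) * rho g a b).
    by apply: deg_lt_sum => b; apply: deg_lt_sum => a; apply: deg_ltZ; exact: (nP (a, b)).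
  apply: eq_deg_lt dn => g; rewrite /rho' drsubmxEsub mxE /A mxE.
  apply: eq_bigr => b _; rewrite [(_ *m _) _ _]mxE mulr_suml; apply: eq_bigr => a _.
  by rewrite mulrAC.
pose B : 'M[k]_(1 + d) := block_mx 1%:M 0 0 Q'.
have Bu : B \in unitmx.
  by rewrite unitmxE det_ublock det1 mul1r -unitmxE.
have BiE : invmx B = block_mx 1%:M 0 0 (invmx Q').
  have BB : B *m block_mx 1%:M 0 0 (invmx Q') = 1%:M.
    rewrite mulmx_block !mulmx0 !mul0mx !mul1mx !addr0 !add0r mulmxV //.
    by rewrite -scalar_mx_block.
  by rewrite -[RHS](mulKmx Bu) BB mulmx1.
exists (Q0 *m B); first by rewrite unitmx_mul Q0u.
move=> g; have -> : invmx (Q0 *m B) *m rho g *m (Q0 *m B) =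
    block_mx 1%:M (ursubmx (A g) *m Q') 0 (invmx Q' *m rho' g *m Q').
  have -> : invmx (Q0 *m B) = invmx B *m invmx Q0.
    apply: (can_inj (mulKmx (_ : Q0 *m B \in unitmx))); rewrite ?unitmx_mul ?Q0u //.
    by rewrite mulmxV ?unitmx_mul ?Q0u // -mulmxA (mulmxA B) mulmxV // mul1mx mulmxV.
  have -> : invmx B *m invmx Q0 *m rho g *m (Q0 *m B) = invmx B *m A g *m B.
    by rewrite /A !mulmxA.
  rewrite BiE (AE g) /B !mulmx_block !mulmx0 !mul0mx !mul1mx !addr0 !add0r ?mulmx1.
  by rewrite block_mxKur.
apply: (@upper_unitriangular_block _ 1 d); last exact: Q'P.
split=> [i|i j]; first by rewrite ord1 mxE.
by rewrite !ord1 ltnn.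
Qed.

End PolynomialFunctions.

(** * Hopf algebras *)

Section Hopf.
Variables (k : fieldType) (U : affineGroup k).
Implicit Types (Z : lmodType k) (a : U).

Lemma linear_sum_fun (A Z : lmodType k) (I : Type) (r : seq I)
  (F : I -> A -> Z) : (forall i, linear (F i)) ->
  linear (fun x => \sum_(i <- r) F i x).
Proof.
move=> lF c x y; rewrite scaler_sumr -big_split; apply: eq_bigr => i _.
exact: lF.
Qed.

Lemma comul_sum_linear Z (b : U -> U -> Z) : separately_linear b ->
  linear (fun a => \sum_(p <- comul a) b p.1 p.2).
Proof.
move=> bl c x y; rewrite (tensor_eq_sum (comul_linear c x y) bl) big_cat big_map.
rewrite /= scaler_sumr; congr (_ + _); apply: eq_bigr => p _.
exact: (linearZ_LR (linear_pack (bl.1 p.2))).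
Qed.

Lemma comulM_sum Z (b : U -> U -> Z) (x y : U) : separately_linear b ->
  \sum_(p <- comul (x * y)) b p.1 p.2 =
  \sum_(p <- comul x) \sum_(q <- comul y) b (p.1 * q.1) (p.2 * q.2).
Proof.
by move=> bl; rewrite (tensor_eq_sum (comul_mul x y) bl) big_allpairs_dep.
Qed.

Lemma comul1_sum Z (b : U -> U -> Z) : separately_linear b ->
  \sum_(p <- comul (1 : U)) b p.1 p.2 = b 1 1.
Proof. by move=> bl; rewrite (tensor_eq_sum (@comul_one k U) bl) big_seq1. Qed.

Lemma separately_linear_mul (A B : lmodType k) (R : comAlgType k)
    (f : A -> R) (g : B -> R) :
  linear f -> linear g -> separately_linear (fun x y => f x * g y).
Proof.
move=> lf lg; split=> [y|x] c u v.
  by rewrite lf mulrDl scalerAl.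
by rewrite lg mulrDr scalerAr.
Qed.

Lemma separately_linear_scale (A B Z : lmodType k) (f : A -> k^o) (g : B -> Z) :
  linear f -> linear g -> separately_linear (fun x y => (f x : k) *: g y).
Proof.
move=> lf lg; split=> [y|x] c u v.
  by rewrite lf scalerDl -scalerA.
by rewrite lg scalerDr !scalerA mulrC.
Qed.

Lemma separately_linear_flip (A B Z : lmodType k) (f : A -> B -> Z) :
  separately_linear f -> separately_linear (fun x y => f y x).
Proof. by case=> fl fr; split. Qed.

(** Such an [N] is a homomorphism from U to the monoid of d x d matrices. Together with
    [counit_matrix] it is the matrix of a finite-dimensional comodule. *)
Definition mult_matrix d (N : 'M[U]_d) := forall Z (b : U -> U -> Z),
  separately_linear b -> forall i j,
  \sum_(p <- comul (N i j)) b p.1 p.2 = \sum_l b (N i l) (N l j).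

Lemma mult_matrixP d (N : 'M[U]_d) :
  mult_matrix N <-> forall i j,
    tensor_eq (comul (N i j)) [seq (N i l, N l j) | l <- enum 'I_d].
Proof.
split=> [Nm i j|Nt Z b bl i j].
  by apply: tensor_eq_of_sum => Z b bl; rewrite Nm // big_map big_enum.
by rewrite (tensor_eq_sum (Nt i j) bl) big_map big_enum.
Qed.

Definition counit_matrix d (N : 'M[U]_d) :=
  forall i j, (counit U (N i j) : k) = (i == j)%:R.

Lemma point_mul_matrix (R : comAlgType k) (x y : points U R) d (N : 'M[U]_d) :
  mult_matrix N -> map_mx (point_mul x y) N = map_mx x N *m map_mx y N.
Proof.
move=> Nm; apply/matrixP => i j; rewrite !mxE.
rewrite [LHS](Nm _ (fun p q => x p * y q)); last first.
  by apply: separately_linear_mul => c u v; rewrite linearP.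
by apply: eq_bigr => l _; rewrite !mxE.
Qed.

(** Coassociativity is given for the chosen sequence [comul a]; here it is transferred to any other
    representative, in particular one of minimal length. *)
Lemma coassoc_representative a n (u v : 'I_n -> U) Z (t : U -> U -> U -> Z) :
    (forall Z (b : U -> U -> Z), separately_linear b ->
      \sum_(p <- comul a) b p.1 p.2 = \sum_i b (u i) (v i)) ->
    trilinear t ->
  \sum_i \sum_(q <- comul (u i)) t q.1 q.2 (v i) =
  \sum_i \sum_(q <- comul (v i)) t (u i) q.1 q.2.
Proof.
move=> aE tl; have := coassoc tl a; case: tl => t1 t2 t3.
rewrite (aE _ (fun x y => \sum_(q <- comul x) t q.1 q.2 y)); last first.
  split=> [y|x].
    apply: (comul_sum_linear (b := fun p q => t p q y)).
    by split=> ?; [exact: t1|exact: t2].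
  by apply: linear_sum_fun => q; exact: t3.
rewrite (aE _ (fun x y => \sum_(q <- comul y) t x q.1 q.2)) //.
split=> [y|x]; last first.
  by apply: (comul_sum_linear (b := t x)); split=> ?; [exact: t2|exact: t3].
by apply: linear_sum_fun => q; exact: t1.
Qed.

Lemma shorten_tensor (A B : lmodType k) n (u : 'I_n.+1 -> A) (v : 'I_n.+1 -> B)
    i (c : 'I_n -> k) Z (b : A -> B -> Z) :
    separately_linear b -> u i = \sum_j c j *: u (lift i j) ->
  \sum_l b (u l) (v l) = \sum_j b (u (lift i j)) (v (lift i j) + c j *: v i).
Proof.
move=> [bl br] uE; rewrite (bigD1_ord i) //= uE.
have /= -> := linear_sum (linear_pack (bl (v i))).
rewrite -big_split; apply: eq_bigr => j _ /=.
have /= -> := linearZ_LR (linear_pack (bl (v i))).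
have /= -> := linearD (linear_pack (br (u (lift i j)))).
by have /= -> := linearZ_LR (linear_pack (br (u (lift i j)))); rewrite addrC.
Qed.

Lemma dual_functionals (A : lmodType k) m (u : 'I_m.+1 -> A) :
    (forall i (c : 'I_m -> k), u i <> \sum_j c j *: u (lift i j)) ->
  exists alpha : 'I_m.+1 -> {linear A -> k^o},
    forall i j, alpha i (u j) = (i == j)%:R.
Proof.
move=> H; suff /choice[alpha alphaP] : forall i, exists alpha : {linear A -> k^o},
    forall j, alpha (u j) = (i == j)%:R by exists alpha.
move=> i; pose K := [set x | exists c : 'I_m -> k, x = \sum_j c j *: u (lift i j)].
have sK : subspace K.
  split; first by exists (fun=> 0); rewrite big1 // => j _; rewrite scale0r.
  move=> c _ _ [d ->] [e ->]; exists (fun j => c * d j + e j).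
  rewrite scaler_sumr -big_split; apply: eq_bigr => j _.
  by rewrite scalerDl scalerA.
have [|phi [phi1 phi0]] := separating_functional (a := u i) sK.
  by move=> [c]; exact: H.
exists phi => j; case: (unliftP i j) => [l|] ->; last by rewrite eqxx.
rewrite (negPf (neq_lift i l)); apply: phi0.
exists (fun j => (j == l)%:R); rewrite (bigD1 l) //= eqxx scale1r big1 ?addr0 //.
by move=> j' /negPf->; rewrite scale0r.
Qed.

(** In a representative of minimal length both families of factors are independent, since a
    dependency on either side would absorb one term into the others. Independence provides the dual
    functionals. *)
Lemma minimal_tensor a : exists n (u v : 'I_n -> U),
  [/\ forall Z (b : U -> U -> Z), separately_linear b ->
        \sum_(p <- comul a) b p.1 p.2 = \sum_i b (u i) (v i),
      exists alpha : 'I_n -> {linear U -> k^o},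
        forall i j, alpha i (u j) = (i == j)%:R &
      exists beta : 'I_n -> {linear U -> k^o},
        forall i j, beta i (v j) = (i == j)%:R].
Proof.
pose rep n (u v : 'I_n -> U) := forall Z (b : U -> U -> Z),
  separately_linear b -> \sum_(p <- comul a) b p.1 p.2 = \sum_i b (u i) (v i).
pose P n := `[< exists u v, @rep n u v >].
have exP : exists n, P n.
  exists (size (comul a)); apply/asboolP.
  pose t i := tnth (in_tuple (comul a)) i.
  by exists (fun i => (t i).1), (fun i => (t i).2) => Z b bl; rewrite big_tnth.
case: (ex_minnP exP) => -[|n] /asboolP[u [v uvP]] minn.
  by exists 0%N, u, v; split=> //; exists (fun=> \0) => -[].
exists n.+1, u, v; split=> //; apply: dual_functionals => i c E.
  have : P n; last by move/minn; rewrite ltnn.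
  apply/asboolP; exists (fun j => u (lift i j)), (fun j => v (lift i j) + c j *: v i).
  by move=> Z b bl; rewrite (uvP Z b bl); exact: shorten_tensor.
have : P n; last by move/minn; rewrite ltnn.
apply/asboolP; exists (fun j => u (lift i j) + c j *: u i), (fun j => v (lift i j)).
move=> Z b bl; rewrite (uvP Z b bl).
exact: (shorten_tensor u (separately_linear_flip bl) E).
Qed.

(* With [comul a = \sum_i u i (x) v i] of minimal length, [alpha] dual to [u] and
   [beta] dual to [v], coassociativity gives [comul (v i) = \sum_j N i j (x) v j]
   for [N i j = (alpha i (x) id) (comul (u j))]; applying [beta] to the last
   factor of the iterated coproduct of [v i] shows that [N] is multiplicative. *)
Lemma locally_finite a : exists n (N : 'M[U]_n) (C : 'M[k]_n),
  [/\ mult_matrix N, counit_matrix N & a = \sum_i \sum_j C i j *: N i j].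
Proof.
have [n [u [v [aE [alpha alphaP] [beta betaP]]]]] := minimal_tensor a.
pose N : 'M[U]_n := \matrix_(i, j) \sum_(p <- comul (u j)) (alpha i p.1 : k) *: p.2.
have lU : linear (counit U) by move=> c x y; rewrite linearP.
have delta_sum (I : finType) Z (F : I -> Z) i :
    \sum_j ((i == j)%:R : k) *: F j = F i.
  rewrite (bigD1 i) //= eqxx scale1r big1 ?addr0 // => j.
  by rewrite eq_sym => /negPf->; rewrite scale0r.
have vE Z (b : U -> U -> Z) i : separately_linear b ->
    \sum_(p <- comul (v i)) b p.1 p.2 = \sum_j b (N i j) (v j).
  move=> bl; pose t x y z := (alpha i x : k) *: b y z.
  have tl : trilinear t.
    split=> [y z|x z|x y] c p q; rewrite /t.
    - by rewrite linearP /= scalerDl scalerA.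
    - by rewrite bl.1 scalerDr !scalerA mulrC.
    - by rewrite bl.2 scalerDr !scalerA mulrC.
  have /esym := coassoc_representative aE tl.
  rewrite /t; under eq_bigr do rewrite -scaler_sumr alphaP.
  rewrite delta_sum => ->; apply: eq_bigr => j _; rewrite mxE.
  have /= -> := linear_sum (linear_pack (bl.1 (v j))); apply: eq_bigr => p _.
  by have /= -> := linearZ_LR (linear_pack (bl.1 (v j))).
(* The two counit laws give [a] as the sum of the counit(u i) v i, and each v i as the sum over j of
   the counit(v j) N i j; hence these coefficients. *)
exists n, N, (\matrix_(i, j) ((counit U (u i) : k) * counit U (v j))); split.
- move=> Z b bl i j; pose t x y z := (beta j z : k) *: b x y.
  have tl : trilinear t.
    split=> [y z|x z|x y] c p q; rewrite /t.
    - by rewrite bl.1 scalerDr !scalerA mulrC.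
    - by rewrite bl.2 scalerDr !scalerA mulrC.
    - by rewrite linearP /= scalerDl scalerA.
  have := coassoc_representative (a := v i) (u := N i) (v := v) _ tl.
  rewrite /t => /(_ (fun Z b => vE Z b i)).
  under eq_bigr do rewrite -scaler_sumr betaP.
  rewrite delta_sum => ->; apply: eq_bigr => l _.
  rewrite (vE Z (fun x y => (beta j y : k) *: b (N i l) x)).
    by under eq_bigr do rewrite betaP; rewrite delta_sum.
  apply: separately_linear_flip; apply: separately_linear_scale.
    by move=> c x y; rewrite linearP.
  exact: bl.2.
- move=> i j; rewrite mxE linear_sum.
  rewrite -alphaP -{2}(counitr (u j)) linear_sum.
  by apply: eq_bigr => p _; rewrite !linearZ /= /GRing.scale /= mulrC.
- rewrite -(counitl a) (aE _ (fun x y => (counit U x : k) *: y)); last first.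
    exact: (separately_linear_scale (f := counit U) (g := id) lU).
  apply: eq_bigr => i _; rewrite -{1}(counitr (v i)).
  rewrite (vE _ (fun x y => (counit U y : k) *: x)); last first.
    apply: separately_linear_flip.
    exact: (separately_linear_scale (f := counit U) (g := id) lU).
  by rewrite scaler_sumr; apply: eq_bigr => j _; rewrite scalerA [in RHS]mxE.
Qed.

End Hopf.

(** * The antipode of a comodule matrix *)

Section AntipodeMatrix.
Variables (k : fieldType) (U : affineGroup k).
Implicit Types (Z : lmodType k).

Definition antipode_matrix d (N : 'M[U]_d) := map_mx (antipode U) N.

Variables (d : nat) (N : 'M[U]_d).
Hypotheses (Nm : mult_matrix N) (N1 : counit_matrix N).

Local Notation T := (antipode_matrix N).

Let scalarE i j : (counit U (N i j) : k)%:A = (i == j)%:R :> U.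
Proof. by rewrite N1 scaler_nat. Qed.

Lemma antipode_matrix_mull : T *m N = 1%:M.
Proof.
apply/matrixP => i j; rewrite !mxE -scalarE -antipodel.
rewrite (Nm (b := fun x y => antipode U x * y)) ?[RHS]big_mkcond //=.
  by apply: eq_bigr => l _; rewrite mxE.
by apply: separately_linear_mul => // c x y; rewrite linearP.
Qed.

Lemma antipode_matrix_mulr : N *m T = 1%:M.
Proof.
apply/matrixP => i j; rewrite !mxE -scalarE -antipoder.
rewrite (Nm (b := fun x y => x * antipode U y)) ?[RHS]big_mkcond //=.
  by apply: eq_bigr => l _; rewrite mxE.
by apply: separately_linear_mul => // c x y; rewrite linearP.
Qed.

(** The antipode is a ring morphism, so applied to T N = 1 it makes the antipode of [T] a left
    inverse of [T], whose inverse is [N]. Thus the algebra generated by the entries of [N] and [T]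
    is stable under the antipode. *)
Lemma antipode_matrixK : antipode_matrix T = N.
Proof.
have TT : antipode_matrix T *m T = 1%:M.
  by rewrite /antipode_matrix -map_mxM -/(antipode_matrix N) antipode_matrix_mull map_mx1.
by rewrite -[LHS]mulmx1 -antipode_matrix_mull mulmxA TT mul1mx.
Qed.

Lemma separately_linear_mull Z (b : U -> U -> Z) (x y : U) :
  separately_linear b -> separately_linear (fun u v => b (x * u) (y * v)).
Proof.
move=> [bl br]; split=> [u|u] c v w /=; rewrite mulrDr -scalerAr.
  exact: bl.
exact: br.
Qed.

Lemma separately_linear_mulr Z (b : U -> U -> Z) (x y : U) :
  separately_linear b -> separately_linear (fun u v => b (u * x) (v * y)).
Proof.
move=> [bl br]; split=> [u|u] c v w /=; rewrite mulrDl -scalerAl.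
  exact: bl.
exact: br.
Qed.

(** This is the coproduct of N T = 1, with the coproduct of [N] expanded and that of [T] left
    unknown. *)
Let comul_NT Z (b : U -> U -> Z) i k' : separately_linear b ->
  \sum_j \sum_l \sum_(q <- comul (T j k')) b (N i l * q.1) (N l j * q.2) =
  ((i == k')%:R : k) *: b 1 1.
Proof.
move=> bl.
transitivity (\sum_(p <- comul ((N *m T) i k')) b p.1 p.2).
  rewrite mxE; have /= -> := linear_sum (linear_pack (comul_sum_linear bl)).
  apply: eq_bigr => j _; rewrite comulM_sum //.
  rewrite (Nm (b := fun x y => \sum_(q <- comul (T j k')) b (x * q.1) (y * q.2))) //.
  split=> u; apply: linear_sum_fun => q.
    exact: (separately_linear_mulr q.1 q.2 bl).1.
  exact: (separately_linear_mulr q.1 q.2 bl).2.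
rewrite antipode_matrix_mulr mxE; case: (i == k').
  by rewrite comul1_sum // scale1r.
rewrite scale0r; exact: (linear0 (linear_pack (comul_sum_linear bl))).
Qed.

Let scale_delta (I : finType) Z (F : I -> Z) i :
  \sum_j ((j == i)%:R : k) *: F j = F i.
Proof.
rewrite (bigD1 i) //= eqxx scale1r big1 ?addr0 // => j.
by move=> /negPf->; rewrite scale0r.
Qed.

Let sum_TN a l : \sum_i T a i * N i l = (a == l)%:R.
Proof. by have /matrixP/(_ a l) := antipode_matrix_mull; rewrite !mxE. Qed.

(** Multiplying the first tensor factor by [T a i] and summing over i cancels the [N] standing
    there. *)
Let comul_NT1 Z (b : U -> U -> Z) a k' : separately_linear b ->
  \sum_j \sum_(q <- comul (T j k')) b q.1 (N a j * q.2) = b (T a k') 1.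
Proof.
move=> bl.
have bl' i : separately_linear (fun x y => b (T a i * x) y).
  split=> u c v w /=; last exact: bl.2.
  by rewrite mulrDr -scalerAr; exact: bl.1.
transitivity (\sum_i \sum_j \sum_l \sum_(q <- comul (T j k'))
    b (T a i * (N i l * q.1)) (N l j * q.2)); last first.
  under eq_bigr => i _ do rewrite (comul_NT i k' (bl' i)) mulr1.
  exact: (scale_delta (fun i => b (T a i) 1)).
rewrite exchange_big; apply: eq_bigr => j _.
transitivity (\sum_l ((l == a)%:R : k) *:
    \sum_(q <- comul (T j k')) b q.1 (N l j * q.2)).
  by rewrite (scale_delta (fun l => \sum_(q <- comul (T j k')) b q.1 (N l j * q.2))).
rewrite exchange_big; apply: eq_bigr => l _.
rewrite exchange_big scaler_sumr; apply: eq_bigr => q _ /=.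
have /= <- := linear_sum (linear_pack (bl.1 (N l j * q.2))).
under eq_bigr do rewrite mulrA.
rewrite -mulr_suml sum_TN mulr_natl eq_sym; case: (a == l).
  by rewrite scale1r.
by rewrite scale0r; apply/esym/(linear0 (linear_pack (bl.1 (N l j * q.2)))).
Qed.

(* [comul T] is the inverse of [comul N = (N (x) 1) (1 (x) N)] over the tensor
   square; the two factors are cancelled one at a time. *)
Lemma antipode_matrix_comul Z (b : U -> U -> Z) i j : separately_linear b ->
  \sum_(p <- comul (T i j)) b p.1 p.2 = \sum_l b (T l j) (T i l).
Proof.
move=> bl.
have bl' a : separately_linear (fun x y => b x (T i a * y)).
  split=> u c v w /=; first exact: bl.1.
  by rewrite mulrDr -scalerAr; exact: bl.2.
transitivity (\sum_a \sum_l \sum_(q <- comul (T l j)) b q.1 (T i a * (N a l * q.2))).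
  rewrite exchange_big -(scale_delta (fun l => \sum_(q <- comul (T l j)) b q.1 q.2)).
  apply: eq_bigr => l _; rewrite exchange_big scaler_sumr; apply: eq_bigr => q _.
  have /= <- := linear_sum (linear_pack (bl.2 q.1)).
  under eq_bigr do rewrite mulrA.
  rewrite -mulr_suml sum_TN mulr_natl eq_sym; case: (i == l).
    by rewrite scale1r.
  by rewrite scale0r; apply/esym/(linear0 (linear_pack (bl.2 q.1))).
by apply: eq_bigr => a _; rewrite (comul_NT1 a j (bl' a)) mulr1.
Qed.
End AntipodeMatrix.

(** * The subalgebra generated by a set *)

Section GeneratedSubalgebra.
Variables (k : fieldType) (A : comAlgType k) (X : set A).

Definition generated_pred : {pred A} := [pred a | `[< forall S : {pred A},
  subalg_closed S -> (forall x, X x -> x \in S) -> a \in S >]].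

Lemma generated_predP a : reflect (forall S : {pred A}, subalg_closed S ->
  (forall x, X x -> x \in S) -> a \in S) (a \in generated_pred).
Proof. by rewrite inE; exact: asboolP. Qed.

Lemma generated_pred_closed : subalg_closed generated_pred.
Proof.
split.
- by apply/generated_predP => S [].
- move=> c u v /generated_predP Su /generated_predP Sv.
  by apply/generated_predP => S Sc SX; apply: (let: And3 _ H _ := Sc in H); auto.
- move=> u v /generated_predP Su /generated_predP Sv.
  by apply/generated_predP => S Sc SX; apply: (let: And3 _ _ H := Sc in H); auto.
Qed.

HB.instance Definition _ :=
  GRing.isSubalgClosed.Build k A generated_pred generated_pred_closed.

Lemma generated_sub x : X x -> x \in generated_pred.
Proof. by move=> Xx; apply/generated_predP => S _; exact. Qed.

Record generated :=
  Generated { generated_val : A; _ : generated_val \in generated_pred }.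

HB.instance Definition _ := [isSub for generated_val].
HB.instance Definition _ := [Choice of generated by <:].
HB.instance Definition _ := [SubChoice_isSubComNzRing of generated by <:].
HB.instance Definition _ := [SubZmodule_isSubLmodule of generated by <:].
HB.instance Definition _ := [SubNzRing_SubLmodule_isSubLalgebra of generated by <:].
HB.instance Definition _ := [SubLalgebra_isSubAlgebra of generated by <:].

Lemma generated_val_linear : linear generated_val.
Proof. by move=> c u v; rewrite -[generated_val]/(\val : generated -> A) linearP. Qed.

Lemma generated_val_monoid_morphism : monoid_morphism generated_val.
Proof.
split=> [|u v]; rewrite -[generated_val]/(\val : generated -> A).
  by rewrite rmorph1.
by rewrite rmorphM.
Qed.

HB.instance Definition _ := GRing.isLinear.Build k generated A *:%R
  generated_val generated_val_linear.
HB.instance Definition _ := GRing.isMonoidMorphism.Build generated A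
  generated_val generated_val_monoid_morphism.

Lemma generated_val_inj : injective generated_val.
Proof. exact: val_inj. Qed.

(** The image in [A] of a subalgebra [S] of the generated algebra is a subalgebra containing [X],
    hence contains every generated element; injectivity of the inclusion brings membership back to
    [S]. *)
Lemma generated_incl_gen : alg_generated [set u | X (generated_val u)].
Proof.
move=> S [S1 SZ SM] SX u.
pose S' := [pred a : A | `[< exists2 u, generated_val u = a & u \in S >]].
have S'P a : reflect (exists2 u, generated_val u = a & u \in S) (a \in S').
  by rewrite inE; exact: asboolP.
have S'c : subalg_closed S'.
  split=> [|c _ _ /S'P[v <- Sv] /S'P[w <- Sw]|_ _ /S'P[v <- Sv] /S'P[w <- Sw]];
    apply/S'P.
  - by exists 1 => //; rewrite rmorph1.
  - by exists (c *: v + w); [rewrite linearP|exact: SZ].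
  - by exists (v * w); [rewrite rmorphM|exact: SM].
case: u => a aX.
have /S'P[v va Sv] : a \in S'.
  move/generated_predP: aX; apply=> // x Xx; apply/S'P.
  by exists (Generated (generated_sub Xx)) => //; exact: SX.
suff <- : v = Generated aX by [].
by apply: generated_val_inj.
Qed.

Definition generated_incl : {lrmorphism generated -> A} := generated_val.

Lemma generated_retraction : exists r : {linear A -> generated},
  forall u, r (generated_val u) = u.
Proof.
have sH : subspace [set` generated_pred].
  by split=> [|c x y xH yH]; [exact: rpred0|rewrite /= rpredD ?rpredZ].
have s0 : subspace [set (0 : A)].
  by split=> // c x y -> ->; rewrite scaler0 addr0.
have [x _ //|p [Hp pid _]] := complement_projection sH s0.
have r_lin : linear (fun x => Generated (Hp x)).
  move=> c x y; apply: generated_val_inj.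
  by rewrite [RHS]linearP; exact: linearP.
exists (linear_pack r_lin) => u; apply: generated_val_inj => /=.
by apply: pid; case: u.
Qed.
End GeneratedSubalgebra.

(** * Hopf subalgebras *)

Section SubHopf.
Variables (k : fieldType) (U : affineGroup k) (X : set U).

Local Notation B := (generated X).
Local Notation v := (@generated_val k U X).
Let vv (p : B * B) : U * U := (v p.1, v p.2).

(** Antipode and coproduct are multiplicative, so stability of the whole subalgebra follows from
    stability on generators. The coproduct condition is an equality of tensors over U;
    [subHopf_tensor_eq] descends such equalities to the subalgebra. *)
Definition Hopf_generators := forall x, X x ->
  antipode U x \in generated_pred X /\
  exists s : seq (B * B), tensor_eq (comul x) [seq (v p.1, v p.2) | p <- s].

Hypothesis XH : Hopf_generators.

Lemma generated_antipode (b : B) : antipode U (v b) \in generated_pred X.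
Proof.
pose S := [pred a : U | antipode U a \in generated_pred X].
have SE a : (a \in S) = (antipode U a \in generated_pred X) by [].
have Sc : subalg_closed S.
  split=> [|c x y|x y]; rewrite !SE.
  - by rewrite rmorph1 rpred1.
  - by move=> Sx Sy; rewrite linearP rpredD ?rpredZ.
  - by move=> Sx Sy; rewrite rmorphM rpredM.
case: b => a aX /=; move/generated_predP: aX => /(_ S Sc); rewrite SE.
by apply=> x /XH[].
Qed.

Lemma generated_comul (b : B) :
  exists s : seq (B * B), tensor_eq (comul (v b)) [seq vv p | p <- s].
Proof.
pose S := [pred a : U |
  `[< exists s : seq (B * B), tensor_eq (comul a) (map vv s) >]].
have SP a : reflect (exists s, tensor_eq (comul a) (map vv s)) (a \in S).
  by rewrite inE; exact: asboolP.
have Sc : subalg_closed S.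
  split=> [|c x y /SP[s xs] /SP[t yt]|x y /SP[s xs] /SP[t yt]]; apply/SP.
  - exists [:: (1, 1)]; apply: tensor_eq_of_sum => Z f fl.
    by rewrite comul1_sum // big_seq1.
  - exists ([seq (c *: p.1, p.2) | p <- s] ++ t).
    apply: tensor_eq_of_sum => Z f fl.
    have /= -> := linearP (linear_pack (comul_sum_linear fl)).
    rewrite (tensor_eq_sum xs fl) (tensor_eq_sum yt fl) map_cat big_cat -map_comp.
    rewrite !big_map scaler_sumr; congr (_ + _); apply: eq_bigr => p _ /=.
    by have /= -> := linearZ_LR (linear_pack (fl.1 (v p.2))).
  - exists [seq (p.1 * q.1, p.2 * q.2) | p <- s, q <- t].
    apply: tensor_eq_of_sum => Z f fl; rewrite comulM_sum //.
    have fl' : separately_linear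
        (fun a b => \sum_(q <- comul y) f (a * q.1) (b * q.2)).
      split=> u; apply: linear_sum_fun => q.
        exact: (separately_linear_mulr q.1 q.2 fl).1.
      exact: (separately_linear_mulr q.1 q.2 fl).2.
    rewrite (tensor_eq_sum xs fl') !big_map big_allpairs_dep.
    apply: eq_bigr => p _ /=.
    rewrite (tensor_eq_sum yt (separately_linear_mull (v p.1) (v p.2) fl)) big_map.
    by [].
case: b => a aX /=; move/generated_predP: aX => /(_ S Sc) aS.
apply/SP/aS => x /XH[_ [s xs]].
by apply/SP; exists s.
Qed.

Definition subHopf_comul b := sval (cid (generated_comul b)).

Lemma subHopf_comul_sum (Z : lmodType k) (f : U -> U -> Z) b :
  separately_linear f ->
  \sum_(p <- subHopf_comul b) f (v p.1) (v p.2) = \sum_(p <- comul (v b)) f p.1 p.2.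
Proof.
move=> fl; rewrite /subHopf_comul; case: cid => s /= st.
by rewrite (tensor_eq_sum st fl) big_map.
Qed.

Definition subHopf_antipode b := Generated (generated_antipode b).

Lemma subHopf_antipode_linear : linear subHopf_antipode.
Proof. by move=> c x y; apply: generated_val_inj; rewrite linearP /= !linearP. Qed.

Lemma subHopf_antipode_monoid_morphism : monoid_morphism subHopf_antipode.
Proof.
split=> [|x y]; apply: generated_val_inj.
  by rewrite rmorph1 /= !rmorph1.
by rewrite rmorphM /= !rmorphM.
Qed.

HB.instance Definition _ := GRing.isLinear.Build k B B *:%R
  subHopf_antipode subHopf_antipode_linear.
HB.instance Definition _ := GRing.isMonoidMorphism.Build B B
  subHopf_antipode subHopf_antipode_monoid_morphism.

(* A linear retraction of U onto B makes B (x) B -> U (x) U injective. *)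
Lemma subHopf_tensor_eq (s t : seq (B * B)) :
  (forall (Z : lmodType k) (f : U -> U -> Z), separately_linear f ->
   \sum_(p <- s) f (v p.1) (v p.2) = \sum_(p <- t) f (v p.1) (v p.2)) ->
  tensor_eq s t.
Proof.
have [r rv] := generated_retraction X.
move=> st; apply: tensor_eq_of_sum => Z f fl.
have E u : \sum_(p <- u) f p.1 p.2 = \sum_(p <- u) f (r (v p.1)) (r (v p.2)).
  by apply: eq_bigr => p _; rewrite !rv.
rewrite !E; apply: (st Z (fun x y => f (r x) (r y))).
split=> y c u w; rewrite linearP; first exact: fl.1.
exact: fl.2.
Qed.

Definition subHopf_counit : {lrmorphism B -> k^o} := counit U \o v.

Lemma subHopf_comul_linear (c : k) (a b : B) :
  tensor_eq (subHopf_comul (c *: a + b))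
    ([seq (c *: p.1, p.2) | p <- subHopf_comul a] ++ subHopf_comul b).
Proof.
apply: subHopf_tensor_eq => Z f fl; rewrite big_cat big_map /=.
rewrite !subHopf_comul_sum // linearP.
have /= -> := linearP (linear_pack (comul_sum_linear fl)); congr (_ + _).
rewrite -subHopf_comul_sum // scaler_sumr; apply: eq_bigr => p _.
by have /= <- := linearZ_LR (linear_pack (fl.1 (v p.2))).
Qed.

Lemma subHopf_comul_mul (a b : B) : tensor_eq (subHopf_comul (a * b))
  [seq (p.1 * q.1, p.2 * q.2) | p <- subHopf_comul a, q <- subHopf_comul b].
Proof.
apply: subHopf_tensor_eq => Z f fl; rewrite subHopf_comul_sum // rmorphM.
rewrite comulM_sum // big_allpairs_dep /=.
have fl' : separately_linear
    (fun x y => \sum_(q <- comul (v b)) f (x * q.1) (y * q.2)).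
  split=> u; apply: linear_sum_fun => q.
    exact: (separately_linear_mulr q.1 q.2 fl).1.
  exact: (separately_linear_mulr q.1 q.2 fl).2.
rewrite -(subHopf_comul_sum _ fl'); apply: eq_bigr => p _ /=.
by rewrite -(subHopf_comul_sum _ (separately_linear_mull (v p.1) (v p.2) fl)).
Qed.

Lemma subHopf_comul_one : tensor_eq (subHopf_comul 1) [:: (1, 1)].
Proof.
apply: subHopf_tensor_eq => Z f fl.
by rewrite subHopf_comul_sum // big_seq1 [v 1]rmorph1 comul1_sum.
Qed.

Lemma subHopf_coassoc (Z : lmodType k) (t : B -> B -> B -> Z) :
    trilinear t -> forall a : B,
  \sum_(p <- subHopf_comul a) \sum_(q <- subHopf_comul p.1) t q.1 q.2 p.2 =
  \sum_(p <- subHopf_comul a) \sum_(q <- subHopf_comul p.2) t p.1 q.1 q.2.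
Proof.
move=> [t1 t2 t3] a; have [r rv] := generated_retraction X.
pose t' x y z := t (r x) (r y) (r z).
have t'1 y z : linear (fun x => t' x y z) by move=> c x x'; rewrite /t' linearP t1.
have t'2 x z : linear (fun y => t' x y z) by move=> c y y'; rewrite /t' linearP t2.
have t'3 x y : linear (fun z => t' x y z) by move=> c z z'; rewrite /t' linearP t3.
have bl12 z : separately_linear (fun x y => t' x y z) by split=> ?.
have bl23 x : separately_linear (fun y z => t' x y z) by split=> ?.
have blL : separately_linear (fun x y => \sum_(q <- comul x) t' q.1 q.2 y).
  by split=> y; [exact: (comul_sum_linear (bl12 y))|apply: linear_sum_fun].
have blR : separately_linear (fun x y => \sum_(q <- comul y) t' x q.1 q.2).
  by split=> y; [apply: linear_sum_fun|exact: (comul_sum_linear (bl23 y))].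
transitivity (\sum_(p <- comul (v a)) \sum_(q <- comul p.1) t' q.1 q.2 p.2).
  rewrite -(subHopf_comul_sum _ blL); apply: eq_bigr => p _.
  rewrite -(subHopf_comul_sum _ (bl12 (v p.2))); apply: eq_bigr => q _.
  by rewrite /t' !rv.
rewrite coassoc // -(subHopf_comul_sum _ blR); apply: eq_bigr => p _.
rewrite -(subHopf_comul_sum _ (bl23 (v p.1))); apply: eq_bigr => q _.
by rewrite /t' !rv.
Qed.

Lemma subHopf_counitl a :
  \sum_(p <- subHopf_comul a) (subHopf_counit p.1 : k) *: p.2 = a.
Proof.
apply: generated_val_inj; rewrite linear_sum -[RHS]counitl.
rewrite -(subHopf_comul_sum (f := fun x y => (counit U x : k) *: y)).
  by apply: eq_bigr => p _; rewrite linearZ.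
apply: (separately_linear_scale (f := counit U) (g := id)) => // c x y.
by rewrite linearP.
Qed.

Lemma subHopf_counitr a :
  \sum_(p <- subHopf_comul a) (subHopf_counit p.2 : k) *: p.1 = a.
Proof.
apply: generated_val_inj; rewrite linear_sum -[RHS]counitr.
rewrite -(subHopf_comul_sum (f := fun x y => (counit U y : k) *: x)).
  by apply: eq_bigr => p _; rewrite linearZ.
apply: separately_linear_flip.
apply: (separately_linear_scale (f := counit U) (g := id)) => // c x y.
by rewrite linearP.
Qed.

Lemma subHopf_antipodel a :
  \sum_(p <- subHopf_comul a) subHopf_antipode p.1 * p.2 = (subHopf_counit a : k)%:A.
Proof.
apply: generated_val_inj; rewrite linear_sum.
transitivity ((counit U (v a) : k)%:A : U); last by [].
rewrite -antipodel.
rewrite -(subHopf_comul_sum (f := fun x y => antipode U x * y)).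
  by apply: eq_bigr => p _; rewrite rmorphM.
by apply: separately_linear_mul => // c x y; rewrite linearP.
Qed.

Lemma subHopf_antipoder a :
  \sum_(p <- subHopf_comul a) p.1 * subHopf_antipode p.2 = (subHopf_counit a : k)%:A.
Proof.
apply: generated_val_inj; rewrite linear_sum.
transitivity ((counit U (v a) : k)%:A : U); last by [].
rewrite -antipoder.
rewrite -(subHopf_comul_sum (f := fun x y => x * antipode U y)).
  by apply: eq_bigr => p _; rewrite rmorphM.
by apply: separately_linear_mul => // c x y; rewrite linearP.
Qed.

Definition subHopf : affineGroup k :=
  @AffineGroup k B subHopf_comul subHopf_counit subHopf_antipode
    subHopf_comul_linear subHopf_comul_mul subHopf_comul_one subHopf_coassoc
    subHopf_counitl subHopf_counitr subHopf_antipodel subHopf_antipoder.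

Lemma subHopf_quotient :
  quotient_comorphism (generated_incl X : {lrmorphism subHopf -> U}).
Proof.
split; last exact: generated_val_inj.
move=> a; apply: tensor_eq_of_sum => Z f fl; rewrite big_map.
by rewrite -[LHS]subHopf_comul_sum.
Qed.
End SubHopf.

(** The entries of a comodule matrix whose span contains [a], together with those of its antipode
    matrix, generate a Hopf subalgebra of finite type, to which pro-unipotence applies. *)
Lemma pro_unipotent_exhaust (k : fieldType) (V : affineGroup k) (a : V) :
  pro_unipotent V -> exists (W : affineGroup k) (f : {lrmorphism W -> V}) (b : W),
    [/\ quotient_comorphism f, unipotent W & a = f b].
Proof.
move=> proV; have [d [N [C [Nm N1 aE]]]] := locally_finite a.
pose T := antipode_matrix N.
pose X := [set x | (exists i j, x = N i j) \/ exists i j, x = T i j].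
have NX i j : N i j \in generated_pred X by apply: generated_sub; left; exists i, j.
have TX i j : T i j \in generated_pred X by apply: generated_sub; right; exists i, j.
have XH : Hopf_generators X.
  move=> _ [|] [i [j ->]]; split.
  - by have := TX i j; rewrite mxE.
  - exists [seq (Generated (NX i l), Generated (NX l j)) | l <- enum 'I_d].
    by rewrite -map_comp /=; exact: (mult_matrixP N).1.
  - have := NX i j; rewrite -{1}(antipode_matrixK Nm N1) mxE; exact.
  - exists [seq (Generated (TX l j), Generated (TX i l)) | l <- enum 'I_d].
    apply: tensor_eq_of_sum => Z f fl.
    by rewrite antipode_matrix_comul // -map_comp /= big_map big_enum.
have W_alg : algebraic (subHopf XH).
  exists ([seq Generated (NX i j) | i <- enum 'I_d, j <- enum 'I_d] ++
          [seq Generated (TX i j) | i <- enum 'I_d, j <- enum 'I_d]).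
  move=> S Sc SX; apply: (generated_incl_gen Sc) => -[x Hx] /= [] [i [j xE]].
    apply: SX; rewrite /= mem_cat; apply/orP; left; apply/allpairsP.
    by exists (i, j); split; rewrite ?mem_enum //; apply: generated_val_inj.
  apply: SX; rewrite /= mem_cat; apply/orP; right; apply/allpairsP.
  by exists (i, j); split; rewrite ?mem_enum //; apply: generated_val_inj.
have aX : a \in generated_pred X.
  by rewrite aE; do 2!apply: rpred_sum => ? _; apply: rpredZ; exact: NX.
exists (subHopf XH), (generated_incl X : {lrmorphism subHopf XH -> V}), (Generated aX).
split=> //; first exact: subHopf_quotient.
exact: (proV _ _ (subHopf_quotient XH)).
Qed.

(** * Logarithm and exponential *)

Section PointPowers.
Variable k : fieldType.

Definition lrmorphism_pack (A B : comAlgType k) (f : A -> B)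
    (f_lin : linear f) (f_mon : monoid_morphism f) : {lrmorphism A -> B} :=
  HB.pack f (GRing.isLinear.Build k A B *:%R f f_lin)
    (GRing.isMonoidMorphism.Build A B f f_mon).

Lemma lrmorphism_eq (A B : comAlgType k) (f g : {lrmorphism A -> B}) :
  f =1 g -> f = g.
Proof.
case: f g => [f [[fa] [fs] [fm]]] [g [[ga] [gs] [gm]]] /= /funext fg.
case: _ / fg in ga gs gm *.
by congr (GRing.LRMorphism.Pack (GRing.LRMorphism.Class _ _ _)); congr (_ _);
  exact: Prop_irrelevance.
Qed.

Lemma alg_generated_ind (A : comAlgType k) (X : set A) (Q : A -> Prop) :
    alg_generated X -> Q 1 -> (forall c a b, Q a -> Q b -> Q (c *: a + b)) ->
    (forall a b, Q a -> Q b -> Q (a * b)) -> (forall a, X a -> Q a) ->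
  forall a, Q a.
Proof.
move=> Xgen Q1 QZ QM QX a; apply/asboolP.
apply: (Xgen [pred a | `[< Q a >]]) => [|b /QX Qb]; last exact/asboolP.
split=> [|c u v /asboolP Qu /asboolP Qv|u v /asboolP Qu /asboolP Qv].
- exact/asboolP.
- by apply/asboolP; exact: QZ.
- by apply/asboolP; exact: QM.
Qed.

Lemma idempotent_unitmx d (A : 'M[k]_d) : A \in unitmx -> A *m A = A -> A = 1%:M.
Proof. by move=> Au AA; rewrite -[LHS](mulKmx Au) AA mulVmx. Qed.

Lemma upper_unitriangular_unitmx d (A : 'M[k]_d) :
  upper_unitriangular A -> A \in unitmx.
Proof.
move=> [A1 A0]; rewrite -unitmx_tr unitmxE det_trig.
  by rewrite big1 ?unitr1 // => i _; rewrite mxE A1.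
by apply/is_trig_mxP => i j ij; rewrite mxE A0.
Qed.

Lemma strictly_upper_nilpotent d (A : 'M[k]_d) n :
    (forall i j : 'I_d, (j <= i)%N -> A i j = 0) ->
  forall i j : 'I_d, (j < i + n)%N -> (A ^+ n) i j = 0.
Proof.
move=> A0; elim: n => [|n IHn] i j.
  by rewrite addn0 expr0 mxE => ji; case: eqP => // E; rewrite E ltnn in ji.
rewrite exprSr => ji; rewrite mxE big1 // => l _.
have [lin|iln] := ltnP l (i + n); first by rewrite IHn // mul0r.
rewrite A0 ?mulr0 //; apply: leq_trans iln.
by rewrite -ltnS -addnS.
Qed.

Lemma strictly_upper_expr0 d (A : 'M[k]_d) n :
  (forall i j : 'I_d, (j <= i)%N -> A i j = 0) -> (d <= n)%N -> A ^+ n = 0.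
Proof.
move=> A0 dn; apply/matrixP => i j; rewrite mxE strictly_upper_nilpotent //.
by rewrite (leq_trans (ltn_ord j)) // (leq_trans dn) // leq_addl.
Qed.

Variable V : affineGroup k.
Implicit Types x : points V k^o.

(** The image of [M] under the counit is idempotent by the counit law and invertible by
    unitriangularity, hence the identity. *)
Lemma counit_matrix_unitriangular d (M : 'M[V]_d) :
  mult_matrix M -> upper_unitriangular M -> counit_matrix M.
Proof.
move=> Mm [M1 M0]; pose E : 'M[k]_d := map_mx (counit V) M.
suff E1 : E = 1%:M.
  by move=> i j; have /matrixP/(_ i j) := E1; rewrite !mxE.
apply: idempotent_unitmx.
  apply: upper_unitriangular_unitmx; split=> [i|i j ij]; rewrite mxE.
    by rewrite M1 rmorph1.
  by rewrite M0 // linear0.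
apply/matrixP => i j; rewrite !mxE -[in RHS](counitl (M i j)).
rewrite (Mm _ (fun p q => (counit V p : k) *: q)); last first.
  apply: (separately_linear_scale (f := counit V) (g := id)) => // c u v.
  by rewrite linearP.
by rewrite linear_sum; apply: eq_bigr => l _; rewrite linearZ !mxE.
Qed.

Fixpoint point_pow x n : points V k^o :=
  if n is n'.+1 then point_mul x (point_pow x n') else counit V.

Lemma point_powS x n a : point_pow x n.+1 a =
  \sum_(p <- comul a) x p.1 * point_pow x n p.2.
Proof. by []. Qed.

Lemma point_powD x m n a : point_pow x (m + n) a =
  \sum_(p <- comul a) point_pow x m p.1 * point_pow x n p.2.
Proof.
elim: m a => [|m IHm] a.
  by rewrite -{1}(counitl a) linear_sum; apply: eq_bigr => p _; rewrite linearZ.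
rewrite addSn point_powS; under eq_bigr do rewrite IHm mulr_sumr.
have tl : trilinear (fun a b c => (x a * point_pow x m b * point_pow x n c : k^o)).
  split=> [b c|b c|b c] e u v; rewrite linearP /= /GRing.scale /=.
  - by rewrite !mulrDl !mulrA.
  - by rewrite mulrDr mulrDl [x b * _]mulrCA !mulrA.
  - by rewrite mulrDr mulrCA.
transitivity (\sum_(p <- comul a) \sum_(q <- comul p.2)
    x p.1 * point_pow x m q.1 * point_pow x n q.2).
  by apply: eq_bigr => p _; apply: eq_bigr => q _; rewrite mulrA.
rewrite -(coassoc tl); apply: eq_bigr => p _.
by rewrite point_powS mulr_suml.
Qed.

Lemma point_pow_matrix x d (M : 'M[V]_d) n : mult_matrix M -> counit_matrix M ->
  map_mx (point_pow x n) M = (map_mx x M : 'M[k]_d) ^+ n.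
Proof.
move=> Mm M1; elim: n => [|n IHn].
  by apply/matrixP => i j; rewrite expr0 !mxE M1.
by rewrite exprS -IHn [LHS]point_mul_matrix.
Qed.

End PointPowers.

(** * The logarithm on a unipotent group *)

Section Logarithm.
Variables (k : fieldType) (char0 : [pchar k] =i pred0).

Fixpoint binomial_poly l : {poly k} :=
  if l is l'.+1 then l'.+1%:R^-1 *: (('X - l'%:R%:P) * binomial_poly l') else 1.

Lemma natr_neq0 n : (n.+1%:R : k) != 0.
Proof. by rewrite ((pcharf0P k).1 char0). Qed.

Lemma fact_natr_neq0 n : (n`!%:R : k) != 0.
Proof. by rewrite ((pcharf0P k).1 char0) -lt0n fact_gt0. Qed.

Lemma binomial_polyE l n : (binomial_poly l).[n%:R] = 'C(n, l)%:R.
Proof.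
elim: l => [|l IHl] /=; first by rewrite hornerC bin0.
rewrite hornerZ hornerM hornerD hornerN hornerX hornerC IHl.
apply: (canLR (mulKf (natr_neq0 l))); rewrite -natrM mul_bin_left natrM.
have [ln|nl] := leqP l n; first by rewrite natrB.
by rewrite bin_small // !mulr0.
Qed.

(** In characteristic zero the natural numbers are pairwise distinct in k, so a nonzero difference
    would have too many roots. *)
Lemma poly_eq_nat (P Q : {poly k}) : (forall n, P.[n%:R] = Q.[n%:R]) -> P = Q.
Proof.
move=> PQ; apply/eqP; rewrite -subr_eq0; apply: contraT => R0.
have := max_poly_roots R0 (rs := [seq n%:R | n <- iota 0 (size (P - Q))]).
rewrite size_map size_iota ltnn => -> //.
  by apply/allP => _ /mapP[n _ ->]; rewrite /root !hornerE PQ subrr.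
rewrite map_inj_uniq ?iota_uniq // => m n /eqP.
wlog mn : m n / (m <= n)%N.
  by move=> H; case: (leqP m n) => [|/ltnW] /H // {}H E; rewrite H // eq_sym.
rewrite eq_sym -subr_eq0 -natrB // ((pcharf0P k).1 char0) subn_eq0 => nm.
by apply/eqP; rewrite eqn_leq mn.
Qed.

Variables (V : affineGroup k) (d : nat) (M : 'M[V]_d).
Hypotheses (Mu : upper_unitriangular M) (Mm : mult_matrix M).
Hypothesis Mgen : alg_generated [set a | exists i j, a = M i j].

Let M1 : counit_matrix M := counit_matrix_unitriangular Mm Mu.

Variable x : points V k^o.

Definition log_matrix_nil : 'M[k]_d := map_mx x M - 1%:M.

Lemma log_matrix_nilE (i j : 'I_d) : (j <= i)%N -> log_matrix_nil i j = 0.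
Proof.
case: Mu => Md M0; rewrite !mxE leq_eqVlt => /orP[/eqP/val_inj->|ji].
  by rewrite Md rmorph1 eqxx subrr.
rewrite M0 // linear0; case: eqP ji => [->|_ _]; first by rewrite ltnn.
by rewrite subr0.
Qed.

Lemma point_pow_binomial n i j : point_pow x n (M i j) =
  \sum_(l < d) (log_matrix_nil ^+ l) i j * 'C(n, l)%:R.
Proof.
have /matrixP/(_ i j) := point_pow_matrix x n Mm M1; rewrite mxE => ->.
have -> : map_mx x M = log_matrix_nil + 1 by rewrite subrK.
rewrite exprD1n summxE.
(* This range contains both truncations: terms with l > n vanish by the binomial coefficient, those
   with l >= d by nilpotency. *)
transitivity (\sum_(l < d + n.+1) (log_matrix_nil ^+ l) i j * 'C(n, l)%:R).
  rewrite addnC big_split_ord /= [X in _ + X]big1 ?addr0.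
    by apply: eq_bigr => l _; rewrite mulmxnE mulr_natr.
  by move=> l _; rewrite bin_small ?mulr0 // ltnS leq_addr.
rewrite big_split_ord /= [X in _ + X]big1 ?addr0 // => l _.
rewrite strictly_upper_expr0 ?mxE ?mul0r ?leq_addr //; exact: log_matrix_nilE.
Qed.

(** Powers of [x] are algebra morphisms, so the elements admitting an interpolation form a
    subalgebra. For an entry of [M] the binomial expansion of a unipotent matrix is a polynomial in
    the exponent. *)
Lemma interpolation_exists (a : V) :
  exists P : {poly k}, forall n, P.[n%:R] = point_pow x n a.
Proof.
move: a; apply: (alg_generated_ind Mgen).
- by exists 1 => n; rewrite hornerC rmorph1.
- move=> c a b [P PP] [Q QP]; exists (c *: P + Q) => n.
  by rewrite hornerD hornerZ PP QP linearP.
- by move=> a b [P PP] [Q QP]; exists (P * Q) => n; rewrite hornerM PP QP rmorphM.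
- move=> _ [i [j ->]].
  exists (\sum_(l < d) (log_matrix_nil ^+ l) i j *: binomial_poly l) => n.
  rewrite horner_sum point_pow_binomial; apply: eq_bigr => l _.
  by rewrite hornerZ binomial_polyE.
Qed.

(* [interpolation a] is the polynomial function t |-> x^t (a). *)
Definition interpolation a := sval (cid (interpolation_exists a)).

Lemma interpolationE a n : (interpolation a).[n%:R] = point_pow x n a.
Proof. by rewrite /interpolation; case: cid. Qed.

Lemma interpolation_eq a P : (forall n, P.[n%:R] = point_pow x n a) ->
  interpolation a = P.
Proof. by move=> PP; apply: poly_eq_nat => n; rewrite interpolationE PP. Qed.

(* [x = exp D] gives [x^t = exp (t D)], whose derivative at [t = 0] is [D]. *)
Definition log_point a : k := (interpolation a)^`().[0].

Lemma interpolation0 a : (interpolation a).[0] = counit V a.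
Proof. by have := interpolationE a 0. Qed.

Lemma log_point_lie : in_lie log_point.
Proof.
split=> [c a b|a b]; rewrite /log_point.
  rewrite (@interpolation_eq _ (c *: interpolation a + interpolation b)).
    by rewrite derivD derivZ hornerD hornerZ.
  by move=> n; rewrite hornerD hornerZ !interpolationE linearP.
rewrite (@interpolation_eq _ (interpolation a * interpolation b)).
  by rewrite derivM hornerD !hornerM !interpolation0 addrC.
by move=> n; rewrite hornerM !interpolationE rmorphM.
Qed.

(** The equation of a one-parameter group: differentiate x^(s+n) = x^s x^n at s = 0, for every
    natural number n. *)
Lemma interpolation_deriv a :
  (interpolation a)^`() = \sum_(p <- comul a) log_point p.1 *: interpolation p.2.
Proof.
apply: poly_eq_nat => n.
have E : interpolation a \Po ('X + n%:R%:P) =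
    \sum_(p <- comul a) (interpolation p.2).[n%:R] *: interpolation p.1.
  apply: poly_eq_nat => m; rewrite horner_comp hornerD hornerX hornerC.
  rewrite -natrD interpolationE point_powD horner_sum.
  by apply: eq_bigr => p _; rewrite hornerZ !interpolationE mulrC.
have := congr1 (fun P : {poly k} => P^`().[0]) E.
rewrite deriv_comp derivD derivX derivC addr0 mulr1 horner_comp hornerD hornerX.
rewrite hornerC add0r => ->; rewrite raddf_sum !horner_sum.
by apply: eq_bigr => p _; rewrite /= derivZ !hornerZ mulrC.
Qed.

Lemma conv_pow_log a i : conv_pow log_point i a = (interpolation a)^`(i).[0].
Proof.
elim: i a => [|i IHi] a; first by rewrite interpolation0.
rewrite derivSn interpolation_deriv [LHS]/= /convolution.
rewrite raddf_sum horner_sum; apply: eq_bigr => p _.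
by rewrite /= derivnZ hornerZ IHi.
Qed.

(** This is the Taylor expansion at 0 of the polynomial t |-> x^t (a), evaluated at t = 1; by
    [conv_pow_log] its derivatives at 0 are the convolution powers of the logarithm. *)
Lemma is_exp_log : is_exp log_point x.
Proof.
move=> a; exists (size (interpolation a)) => n le_n.
have -> : x a = (interpolation a).[1].
  rewrite -[1]/(1%:R) interpolationE point_powS.
  rewrite -{1}(counitr a) linear_sum; apply: eq_bigr => p _.
  by rewrite linearZ /= /GRing.scale /= mulrC.
rewrite (horner_coef_wide _ le_n); apply: eq_bigr => i _.
rewrite expr1n mulr1 conv_pow_log horner_coef0 coef_derivn addn0 ffactnn.
by rewrite -[X in _ * X]mulr_natr mulrC mulfK ?fact_natr_neq0.
Qed.

(** The derivative of the l-th binomial polynomial at 0 is (-1)^(l-1)/l for l > 0, so this is the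
    usual logarithm series. It makes the logarithm visibly continuous in the entries of [x]. *)
Lemma log_point_matrix i j : log_point (M i j) =
  \sum_(l < d) (log_matrix_nil ^+ l) i j * (binomial_poly l)^`().[0].
Proof.
rewrite /log_point.
rewrite (@interpolation_eq _
  (\sum_(l < d) (log_matrix_nil ^+ l) i j *: binomial_poly l)).
  rewrite raddf_sum horner_sum; apply: eq_bigr => l _.
  by rewrite /= derivZ hornerZ.
move=> n; rewrite horner_sum point_pow_binomial; apply: eq_bigr => l _.
by rewrite hornerZ binomial_polyE.
Qed.

End Logarithm.

(** * The exponential on a unipotent group *)

Section Exponential.
Variables (k : fieldType) (char0 : [pchar k] =i pred0).
Variables (V : affineGroup k) (d : nat) (M : 'M[V]_d).
Hypotheses (Mu : upper_unitriangular M) (Mm : mult_matrix M).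
Hypothesis Mgen : alg_generated [set a | exists i j, a = M i j].

Let M1 : counit_matrix M := counit_matrix_unitriangular Mm Mu.

Implicit Types D : V -> k.

Lemma in_lie1 D : in_lie D -> D 1 = 0.
Proof.
move=> [_ /(_ 1 1)]; rewrite mulr1 !rmorph1 mul1r mulr1 => /eqP.
by rewrite -subr_eq0 opprD addNKr oppr_eq0 => /eqP.
Qed.

Lemma in_lie_eq0 D : in_lie D -> (forall i j, D (M i j) = 0) -> D =1 fun=> 0.
Proof.
move=> DL D0; apply: (alg_generated_ind Mgen).
- exact: in_lie1.
- by move=> c a b Da Db; rewrite DL.1 Da Db scaler0 addr0.
- by move=> a b Da Db; rewrite DL.2 Da Db mulr0 mul0r addr0.
- by move=> _ [i [j ->]].
Qed.

Lemma conv_pow_linear D n : linear (D : V -> k^o) -> linear (conv_pow D n : V -> k^o).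
Proof.
move=> Dl; elim: n => [|n IHn]; first by move=> c a b; rewrite /= linearP.
exact: (comul_sum_linear (separately_linear_mul Dl IHn)).
Qed.

Definition exp_term D n a : k := (n`!%:R)^-1 * conv_pow D n a.

Lemma exp_term_linear D n : linear (D : V -> k^o) -> linear (exp_term D n : V -> k^o).
Proof.
move=> Dl c a b; rewrite /exp_term (conv_pow_linear n Dl) mulrDr.
by rewrite /GRing.scale /= mulrCA.
Qed.

Lemma exp_termS D n a : n.+1%:R * exp_term D n.+1 a =
  \sum_(p <- comul a) D p.1 * exp_term D n p.2.
Proof.
rewrite /exp_term factS natrM invfM mulrA mulrA mulfV ?natr_neq0 // mul1r.
rewrite /= /convolution mulr_sumr; apply: eq_bigr => p _.
by rewrite mulrCA.
Qed.

Lemma exp_term0 D a : exp_term D 0 a = counit V a.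
Proof. by rewrite /exp_term fact0 invr1 mul1r. Qed.

(** Leibniz rule for divided powers. In the induction, n+1 times the left side splits by the
    derivation property into two sums, whose weights n+1-i and i add up to n+1. *)
Lemma exp_termM D n a b : in_lie D -> exp_term D n (a * b) =
  \sum_(i < n.+1) exp_term D i a * exp_term D (n - i) b.
Proof.
move=> [Dl DM]; elim: n a b => [|n IHn] a b.
  by rewrite big_ord1 subn0 !exp_term0 rmorphM.
have el m : linear (exp_term D m : V -> k^o) by exact: exp_term_linear.
apply: (mulfI (natr_neq0 char0 n)); rewrite exp_termS.
rewrite (comulM_sum (b := fun x y => (D x * exp_term D n y : k^o))); last first.
  exact: (separately_linear_mul Dl (el n)).
have cl i : linear (exp_term D i : V -> k^o) by exact: exp_term_linear.
transitivity (\sum_(i < n.+1) \sum_(p <- comul a) \sum_(q <- comul b)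
   ((counit V p.1 * exp_term D i p.2) * (D q.1 * exp_term D (n - i) q.2) +
    (D p.1 * exp_term D i p.2) * (counit V q.1 * exp_term D (n - i) q.2) : k)).
  rewrite [RHS]exchange_big; apply: eq_bigr => p _.
  rewrite [RHS]exchange_big; apply: eq_bigr => q _.
  rewrite DM IHn mulr_sumr; apply: eq_bigr => i _.
  by rewrite mulrDl; congr (_ + _); exact: mulrACA.
have counitE i x :
    \sum_(p <- comul x) (counit V p.1 : k) * exp_term D i p.2 = exp_term D i x.
  rewrite -[in RHS](counitl x).
  have /= -> := linear_sum (linear_pack (el i)); apply: eq_bigr => p _.
  by have /= -> := linearZ_LR (linear_pack (el i)).
transitivity (\sum_(i < n.+1)
   (exp_term D i a * ((n - i).+1%:R * exp_term D (n - i).+1 b) +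
    (i.+1%:R * exp_term D i.+1 a) * exp_term D (n - i) b)).
  apply: eq_bigr => i _; rewrite !exp_termS -(counitE i a) -(counitE (n - i)%N b).
  rewrite !mulr_suml -big_split; apply: eq_bigr => p _.
  by rewrite !mulr_sumr -big_split.
rewrite big_split mulr_sumr /=.
(* The added terms, i = n+1 in the first sum and i = 0 in the second, have weight 0; they give both
   sums the same range. *)
transitivity (
  \sum_(i < n.+2) ((n.+1 - i)%:R * (exp_term D i a * exp_term D (n.+1 - i) b)) +
  \sum_(i < n.+2) (i%:R * (exp_term D i a * exp_term D (n.+1 - i) b))).
  congr (_ + _).
    rewrite [RHS]big_ord_recr /= subnn mul0r addr0; apply: eq_bigr => i _.
    by rewrite subSn -1?ltnS // mulrCA.
  rewrite [RHS]big_ord_recl /= mul0r add0r; apply: eq_bigr => i _.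
  by rewrite /bump /= add1n subSS mulrA.
rewrite -big_split; apply: eq_bigr => i _ /=.
by rewrite -mulrDl -natrD subnK // -ltnS.
Qed.

Lemma conv_pow_matrix D n : in_lie D ->
  map_mx (conv_pow D n) M = (map_mx D M : 'M[k]_d) ^+ n.
Proof.
move=> [Dl _]; elim: n => [|n IHn].
  by apply/matrixP => i j; rewrite expr0 !mxE; exact: M1.
rewrite exprS -IHn; apply/matrixP => i j; rewrite !mxE /= /convolution.
rewrite (Mm (b := fun x y => (D x * conv_pow D n y : k^o))).
  by apply: eq_bigr => l _; rewrite !mxE.
by apply: separately_linear_mul => //; exact: conv_pow_linear.
Qed.

(** The bound is uniform in [D], so that the exponential at [a] is one fixed finite sum, polynomial
    in the coordinates of [D]. Entries of [M] have bound [d] by nilpotency, and bounds add under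
    products. *)
Lemma exp_term_eventually0 (a : V) : exists N, forall D, in_lie D ->
  forall n, (N <= n)%N -> exp_term D n a = 0.
Proof.
move: a; apply: (alg_generated_ind Mgen).
- exists 1%N => D DL [//|n] _.
  rewrite /exp_term /= /convolution.
  rewrite (comul1_sum (b := fun x y => (D x * conv_pow D n y : k^o))).
    by rewrite in_lie1 // mul0r mulr0.
  by apply: separately_linear_mul; [exact: DL.1|apply: conv_pow_linear; exact: DL.1].
- move=> c a b [Na aP] [Nb bP]; exists (maxn Na Nb) => D DL n.
  rewrite geq_max => /andP[Nan Nbn].
  by rewrite (exp_term_linear n DL.1) aP // bP // scaler0 addr0.
- move=> a b [Na aP] [Nb bP]; exists (Na + Nb)%N => D DL n Nn.
  rewrite exp_termM // big1 // => i _.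
  have [Nai|iNa] := leqP Na i; first by rewrite aP // mul0r.
  rewrite bP ?mulr0 // leq_subRL; last by rewrite -ltnS.
  by apply: leq_trans Nn; rewrite leq_add2r ltnW.
- move=> _ [i [j ->]]; exists d => D DL n dn.
  have /matrixP/(_ i j) := conv_pow_matrix n DL; rewrite mxE /exp_term => ->.
  rewrite strictly_upper_expr0 ?mxE ?mulr0 // => i' j'; rewrite mxE leq_eqVlt.
  case/orP => [/eqP/val_inj->|ji]; first by rewrite Mu.1 in_lie1.
  by rewrite Mu.2 //; exact: (linear0 (linear_pack DL.1)).
Qed.

Definition exp_bound a := sval (cid (exp_term_eventually0 a)).

Lemma exp_boundP D a n : in_lie D -> (exp_bound a <= n)%N -> exp_term D n a = 0.
Proof. by rewrite /exp_bound; case: cid => N /= NP DL; exact: NP. Qed.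

Definition exp_fun D a : k := \sum_(i < exp_bound a) exp_term D i a.

Lemma exp_funE D a n : in_lie D -> (exp_bound a <= n)%N ->
  exp_fun D a = \sum_(i < n) exp_term D i a.
Proof.
move=> DL /subnKC <-; rewrite big_split_ord /= [X in _ + X]big1 ?addr0 // => i _.
by rewrite exp_boundP // leq_addr.
Qed.

Lemma exp_fun_linear D : in_lie D -> linear (exp_fun D : V -> k^o).
Proof.
move=> DL c a b; set n := (exp_bound a + exp_bound b + exp_bound (c *: a + b))%N.
rewrite !(exp_funE (n := n) DL);
  try by rewrite /n -?addnA ?leq_addr // addnCA leq_addr.
  rewrite scaler_sumr -big_split; apply: eq_bigr => i _.
  exact: (exp_term_linear i DL.1).
by rewrite /n leq_addl.
Qed.

(** The exponential is the value at 1 of the generating polynomial of the [exp_term]s, and the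
    Leibniz rule says that these polynomials multiply. *)
Lemma exp_fun_monoid_morphism D : in_lie D -> monoid_morphism (exp_fun D : V -> k^o).
Proof.
move=> DL; pose E a := \poly_(i < exp_bound a) exp_term D i a.
have EE a i : (E a)`_i = exp_term D i a.
  by rewrite coef_poly; case: ltnP => // /(exp_boundP DL)->.
have E1 a (P : {poly k}) : (forall i, P`_i = exp_term D i a) -> exp_fun D a = P.[1].
  move=> PE; have le1 := leq_addr (size P) (exp_bound a).
  have le2 := leq_addl (exp_bound a) (size P).
  rewrite (exp_funE DL le1) (horner_coef_wide _ le2).
  by apply: eq_bigr => i _; rewrite expr1n mulr1 PE.
split=> [|a b].
  rewrite (@E1 _ 1) ?hornerC // => i; rewrite coef1; case: i => [|i] /=.
    by rewrite exp_term0; exact/esym/(rmorph1 (counit V)).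
  rewrite /exp_term /= /convolution.
  rewrite (comul1_sum (b := fun x y => (D x * conv_pow D i y : k^o))).
    by rewrite in_lie1 // mul0r mulr0.
  by apply: separately_linear_mul; [exact: DL.1|apply: conv_pow_linear; exact: DL.1].
rewrite (@E1 _ (E a * E b)).
  by rewrite hornerM -(E1 _ _ (EE a)) -(E1 _ _ (EE b)).
move=> i.
by rewrite coefM exp_termM //; apply: eq_bigr => j _; rewrite !EE.
Qed.

Definition exp_point D (DL : in_lie D) : points V k^o :=
  lrmorphism_pack (exp_fun_linear DL) (exp_fun_monoid_morphism DL).

Lemma is_exp_exp_point D (DL : in_lie D) : is_exp D (exp_point DL).
Proof. by move=> a; exists (exp_bound a) => n; exact: exp_funE. Qed.

Lemma is_exp_uniq D (x y : points V k^o) : is_exp D x -> is_exp D y -> x = y.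
Proof.
move=> Dx Dy; apply: lrmorphism_eq => a.
have [m mP] := Dx a; have [n nP] := Dy a.
by rewrite (mP (maxn m n)) ?leq_maxl // (nP (maxn m n)) ?leq_maxr.
Qed.

Lemma lie_comb_lie r (D : 'I_r -> V -> k) (c : 'rV[k]_r) :
  (forall i, in_lie (D i)) -> in_lie (lie_comb D c).
Proof.
move=> DL; split=> [e a b|a b]; rewrite /lie_comb.
  rewrite scaler_sumr -big_split; apply: eq_bigr => i _.
  by rewrite (DL i).1 mulrDr /GRing.scale /= mulrCA.
rewrite mulr_sumr mulr_suml -big_split; apply: eq_bigr => i _ /=.
by rewrite (DL i).2 mulrDr mulrCA; congr (_ + _); rewrite mulrA.
Qed.

(** A derivation is determined by its values on the entries of [M], which identifies the Lie algebra
    with a subspace of the d x d matrices. *)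
Lemma lie_basis_exists : exists r (D : 'I_r -> V -> k), lie_basis D.
Proof.
pose H := [set T : 'M[k]_d | exists2 D, in_lie D & T = map_mx D M].
have sH : subspace H.
  split.
    exists (fun=> 0); last by apply/matrixP => i j; rewrite !mxE.
    by split=> [c a b|a b]; rewrite ?scaler0 ?mulr0 ?mul0r addr0.
  move=> c _ _ [D DL ->] [E EL ->]; exists (fun a => c * D a + E a).
    split=> [e a b|a b].
      rewrite DL.1 EL.1 mulrDr scalerDr addrACA; congr (_ + _ + _).
      by rewrite /GRing.scale /= mulrCA.
    rewrite DL.2 EL.2 !mulrDr mulrDl addrACA; congr (_ + _ + (_ + _)).
      by rewrite mulrCA.
    by rewrite mulrA.
  by apply/matrixP => i j; rewrite !mxE.
have [W WP] := subspace_vspace sH.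
have /choice[D DP] : forall i : 'I_(\dim W), exists D,
    in_lie D /\ (vbasis W)`_i = map_mx D M.
  move=> i; have /WP[D DL DE] : (vbasis W)`_i \in W.
    by apply: vbasis_mem; apply: mem_nth; rewrite size_tuple.
  by exists D.
have combE c : map_mx (lie_comb D c) M = \sum_i c 0 i *: (vbasis W)`_i.
  apply/matrixP => a b; rewrite !mxE summxE; apply: eq_bigr => i _.
  by rewrite (DP i).2 !mxE.
exists (\dim W), D; split=> [i|E EL|c c0].
- exact: (DP i).1.
- have EW : map_mx E M \in W by apply/WP; exists E.
  exists (\row_i coord (vbasis W) i (map_mx E M)) => a.
  set c := \row_i _; apply/eqP; rewrite -subr_eq0.
  have DL := lie_comb_lie c (fun i => (DP i).1).
  have FL : in_lie (fun a => E a - lie_comb D c a).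
    split=> [e u v|u v].
      by rewrite EL.1 DL.1 scalerBr opprD addrACA.
    rewrite EL.2 DL.2 mulrBr mulrBl opprD addrACA; congr (_ + _).
  rewrite (in_lie_eq0 FL) // => i j.
  have := combE c; under eq_bigr do rewrite mxE.
  rewrite -coord_vbasis // => /matrixP/(_ i j); rewrite !mxE => ->.
  by rewrite subrr.
- have /freeP : free (vbasis W) by case/andP: (vbasisP W).
  move=> /(_ (fun i => c 0 i)) fr; apply/rowP => i; rewrite mxE; apply: fr.
  by rewrite -combE; apply/matrixP => a b; rewrite !mxE c0.
Qed.

End Exponential.

(** * The topology on k-points *)

Section KPoints.
Variable k : topologicalFieldType.
Implicit Types V : affineGroup k.

Lemma kpoints_subbase_open V W : kpoints_subbase W -> open (W : set (kpoints V)).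
Proof.
move=> sW; exists [set W]; last first.
  by rewrite predeqE => x; split=> [[_ ->]|] //; exists W.
by move=> _ ->; exact: (finI_from1 id).
Qed.

Lemma continuous_kpoints_subbase (T : topologicalType) V (x : T -> kpoints V) :
    (forall W : set (kpoints V), kpoints_subbase W -> open (x @^-1` W)) ->
  continuous x.
Proof.
move=> xW t A; rewrite nbhsE.
move=> [_ [[B sB <-] [C BC Ct] sUBA]].
apply: filterS sUBA _; apply: (@filterS _ _ _ C).
  by move=> ? ?; exists C.
have /sB [D sD IDeC] := BC; rewrite -IDeC; apply: filter_bigI => E DE.
have /sD := DE; rewrite inE => sE; apply: open_nbhs_nbhs; split; first exact: xW.
by move: Ct; rewrite -IDeC => /(_ _ DE).
Qed.

Lemma unipotentP V : unipotent V -> exists d (M : 'M[V]_d),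
  [/\ upper_unitriangular M, mult_matrix M &
      alg_generated [set a | exists i j, a = M i j]].
Proof.
by move=> [d [M [M1 M0 /mult_matrixP Mm Mg]]]; exists d, M.
Qed.

(** The basis in [unipotent_open] is arbitrary. Its coordinates of log x are obtained from the
    entries of log x by a constant matrix, hence are polynomial in the entries of x. *)
Lemma unipotent_open_preimage (char0 : [pchar k] =i pred0) (T : topologicalType) V
    (x : T -> points V k^o) W :
    unipotent V -> (forall a, continuous (fun t => x t a : k)) ->
  unipotent_open W -> open (x @^-1` W).
Proof.
move=> /unipotentP[d [M [Mu Mm Mg]]] xc [r [D [[DL Dspan Dfree] openW]]].
pose Tm : 'M[k]_(r, d * d) := \matrix_i mxvec (map_mx (D i) M).
have TmE (c : 'rV[k]_r) : c *m Tm = mxvec (map_mx (lie_comb D c) M).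
  rewrite mulmx_sum_row; apply: (can_inj vec_mxK); rewrite mxvecK linear_sum.
  apply/matrixP => i j; rewrite summxE mxE /lie_comb; apply: eq_bigr => l _.
  by rewrite rowK linearZ /= mxvecK !mxE.
have Tfree : row_free Tm.
  apply: inj_row_free => c; rewrite TmE => c0; apply: Dfree.
  apply: (in_lie_eq0 Mg); first exact: lie_comb_lie.
  move=> i j; have /matrixP/(_ i j) : map_mx (lie_comb D c) M = 0.
    by rewrite -[LHS]mxvecK c0 linear0.
  by rewrite !mxE.
pose L t := log_point char0 Mu Mm Mg (x t).
pose c t := mxvec (map_mx (L t) M) *m pinvmx Tm.
(* [Dspan] yields coordinates with no control in [t]; freeness of the rows of [Tm] identifies them
   with the explicit [c t]. *)
have cE t : L t = lie_comb D (c t).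
  have [e eE] := Dspan _ (log_point_lie char0 Mu Mm Mg (x t)).
  apply/funext => a; rewrite /c.
  have -> : map_mx (L t) M = map_mx (lie_comb D e) M.
    by apply/matrixP => i j; rewrite !mxE; exact: eE.
  by rewrite -TmE mulmxKp //; exact: eE.
have c_cont : continuous c.
  have nil_cont : continuous (fun t => log_matrix_nil M (x t)).
    apply: continuous_mx => i j.
    have -> : (fun t => log_matrix_nil M (x t) i j) =
        (fun t => (x t (M i j) : k) + - (1%:M : 'M[k]_d) i j).
      by apply/funext => t; rewrite !mxE.
    by apply: continuous_add; [exact: xc|exact: continuous_cst].
  have pow_cont l : continuous (fun t => log_matrix_nil M (x t) ^+ l).
    elim: l => [|l IHl].
      by under eq_fun do rewrite expr0; move=> t; exact: cvg_cst.
    by under eq_fun do rewrite exprS; exact: continuous_mulmx.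
  apply: continuous_mulmx; last by move=> t; exact: cvg_cst.
  apply: (continuous_linear (L := mxvec)); apply: continuous_mx => i j.
  have -> : (fun t => map_mx (L t) M i j) = (fun t => \sum_(l < d)
      (log_matrix_nil M (x t) ^+ l) i j * ((binomial_poly k l)^`()).[0]).
    by apply/funext => t; rewrite mxE; exact: log_point_matrix.
  apply: continuous_sum => l; apply: continuous_mul; last exact: continuous_cst.
  exact: continuous_entry.
have -> : x @^-1` W = c @^-1` [set c | exists2 y, W y & is_exp (lie_comb D c) y].
  apply/seteqP; split=> t /=.
    by move=> Wt; exists (x t) => //; rewrite -cE; exact: is_exp_log.
  move=> [y Wy]; rewrite -cE => ye.
  by rewrite (is_exp_uniq (is_exp_log char0 Mu Mm Mg (x t)) ye).
by apply: open_comp => // t _; exact: c_cont.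
Qed.

Lemma unipotent_open_coordinate (char0 : [pchar k] =i pred0) V (a : V) (O : set k) :
  unipotent V -> open O -> unipotent_open [set x : points V k^o | O (x a)].
Proof.
move=> /unipotentP[d [M [Mu Mm Mg]]] openO.
have [r [D Db]] := lie_basis_exists Mg; exists r, D; split=> //.
have [DL _ _] := Db; have DcL c := lie_comb_lie c DL.
pose e (c : 'rV[k]_r) : k := exp_fun char0 Mu Mm Mg (lie_comb D c) a.
have coord_cont i : continuous (fun c : 'rV[k]_r => c 0 i).
  by apply: (continuous_entry (F := id)) => c; exact: cvg_id.
have D_cont b : continuous (fun c => lie_comb D c b).
  apply: continuous_sum => i; apply: continuous_mul; last exact: continuous_cst.
  exact: coord_cont.
have pow_cont n b : continuous (fun c => conv_pow (lie_comb D c) n b : k).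
  elim: n b => [|n IHn] b; first exact: continuous_cst.
  by apply: continuous_sum => p; apply: continuous_mul.
have e_cont : continuous e.
  apply: continuous_sum => i; apply: continuous_mul => //; exact: continuous_cst.
have -> : [set c | exists2 x : points V k^o, O (x a) & is_exp (lie_comb D c) x] =
    e @^-1` O.
  apply/seteqP; split=> c /=.
    move=> [x Ox /is_exp_uniq/(_ (is_exp_exp_point char0 Mu Mm Mg (DcL c))) xE].
    by rewrite xE in Ox.
  move=> Oe; exists (exp_point char0 Mu Mm Mg (DcL c)) => //.
  exact: is_exp_exp_point.
by apply: open_comp => // t _; exact: e_cont.
Qed.

Lemma continuous_kpoints (char0 : [pchar k] =i pred0) (T : topologicalType) V
    (x : T -> kpoints V) :
  (forall a, continuous (fun t => x t a : k)) -> continuous x.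
Proof.
move=> xc; apply: continuous_kpoints_subbase => _ [Q [f [_ Qu [W' Wo ->]]]].
apply: (unipotent_open_preimage char0 (x := fun t => hom_points f (x t)) Qu) Wo.
by move=> a; exact: xc.
Qed.

(** Pro-unipotence of V makes [a] a coordinate of a unipotent quotient, on which the condition that
    it lie in an open set is subbasic. *)
Lemma kpoints_coordinate_continuous (char0 : [pchar k] =i pred0)
    (T : topologicalType) V (x : T -> kpoints V) :
  pro_unipotent V -> continuous x -> forall a, continuous (fun t => x t a : k).
Proof.
move=> proV xc a; have [Q [f [b [fq Qu ->]]]] := pro_unipotent_exhaust a proV.
apply/continuousP => O openO.
pose W := [set y : points Q k^o | O (y b)].
have -> : (fun t => x t (f b) : k) @^-1` O = x @^-1` (hom_points f @^-1` W) by [].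
apply: open_comp => [t _|]; first exact: xc.
apply: kpoints_subbase_open; exists Q, f; split=> //.
by exists W => //; exact: unipotent_open_coordinate.
Qed.

End KPoints.

(** * Unipotent representations *)

Section Representations.
Variables (G : topologicalGroupType) (k : topologicalFieldType).
Implicit Types (V W : vectType k) (X Y : urep G k).

Definition basis_vec V i : V := r2v (delta_mx 0 i).
Arguments basis_vec V i : clear implicits.

Lemma v2r_sum V (v : V) : v = \sum_i v2r v 0 i *: basis_vec V i.
Proof.
apply: (can_inj v2rK); rewrite linear_sum {1}[v2r v]row_sum_delta.
by apply: eq_bigr => i _; rewrite linearZ /= r2vK.
Qed.

Lemma f2mxE V W (f : 'Hom(V, W)) i j : f2mx f i j = v2r (f (basis_vec V i)) 0 j.
Proof. by rewrite v2r_lfun r2vK -rowE mxE. Qed.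

Lemma f2mx_compHom V1 V2 V3 (f : 'Hom(V2, V3)) (g : 'Hom(V1, V2)) :
  f2mx (f \o g)%VF = f2mx g *m f2mx f.
Proof.
apply/row_matrixP => i; rewrite !rowE mulmxA.
by rewrite -[delta_mx 0 i]r2vK -!v2r_lfun comp_lfunE.
Qed.

Lemma coordinate_linear V i : linear (fun v : V => (v2r v 0 i : k^o)).
Proof. by move=> c u v; rewrite linearP !mxE. Qed.

Definition coordinate V i : 'Hom(V, k^o) := linfun (linear_pack (@coordinate_linear V i)).
Arguments coordinate : clear implicits.

Lemma coordinateE V i (v : V) : coordinate V i v = v2r v 0 i.
Proof. by rewrite lfunE. Qed.

Lemma coordinate_basis V i j : coordinate V i (basis_vec V j) = (j == i)%:R.
Proof. by rewrite coordinateE r2vK mxE eqxx eq_sym. Qed.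

Definition continuous_coefs V (rho : G -> 'End(V)) :=
  forall (xi : 'Hom(V, k^o)) v, continuous (fun g => xi (rho g v) : k).

Lemma continuous_coefsP V (rho : G -> 'End(V)) :
  continuous_coefs rho <-> continuous (fun g => f2mx (rho g)).
Proof.
split=> rc.
  apply: continuous_mx => i j.
  under eq_fun do rewrite f2mxE -coordinateE.
  exact: rc.
move=> xi v.
have -> : (fun g => xi (rho g v) : k) =
    (fun g => \sum_j (v2r v *m f2mx (rho g)) 0 j * xi (basis_vec V j)).
  apply/funext => g; rewrite {1}[rho g v]v2r_sum linear_sum.
  by apply: eq_bigr => j _; rewrite linearZ /= v2r_lfun.
apply: continuous_sum => j; apply: continuous_mul; last exact: continuous_cst.
apply: continuous_entry; apply: continuous_mulmx => //.
by move=> t; exact: cvg_cst.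
Qed.

(** Continuity and unipotence are both required of matrix coefficients only, so subrepresentations
    and sums inherit them from coefficients already known. *)
Definition urep_of V (rho : G -> 'End(V)) (rho1 : rho 1%g = \1%VF)
    (rhoM : forall g h, rho (g * h)%g = (rho g \o rho h)%VF)
    (rho_cont : continuous_coefs rho) n
    (rho_deg : forall (xi : 'Hom(V, k^o)) v, deg_lt n (fun g => xi (rho g v) : k)) :
  urep G k := URep rho1 rhoM ((continuous_coefsP rho).1 rho_cont)
    (deg_lt_unipotent rho1 rhoM rho_deg).

Lemma urep_continuous X : continuous_coefs (urep_act X).
Proof. exact/continuous_coefsP/urep_act_continuous. Qed.

Lemma urep_deg X : exists n, forall (xi : 'Hom(X, k^o)) v,
  deg_lt n (fun g => xi (urep_act X g v) : k).
Proof. apply: unipotent_deg_lt; [exact: urep_actM|exact: urep_act_unipotent]. Qed.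

(** The span of the orbit is taken as the intersection of all subspaces containing it, which makes
    the last clause its induction principle. *)
Lemma urep_cyclic X (v : X) : exists (Y : urep G k) (i : 'Hom(Y, X)) (y : Y),
  [/\ equivariant i, i y = v & forall K : set X, subspace K ->
      (forall g, K (urep_act X g v)) -> forall z, K (i z)].
Proof.
pose H := [set u | forall K : set X, subspace K ->
  (forall g, K (urep_act X g v)) -> K u].
have sH : subspace H.
  split=> [K sK _|c u w Hu Hw K sK Kv]; first exact: sK.1.
  by apply: sK.2; [exact: Hu|exact: Hw].
have [W WP] := subspace_vspace sH.
have Wact g u : u \in W -> urep_act X g u \in W.
  move=> /WP Hu; apply/WP => K sK Kv.
  apply: (Hu [set w | K (urep_act X g w)]) => [|h] /=.
    split=> [|c w w' Kw Kw'] /=; first by rewrite linear0; exact: sK.1.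
    by rewrite linearP; exact: sK.2.
  by have := Kv (g * h)%g; rewrite urep_actM comp_lfunE.
have vW : v \in W.
  by apply/WP => K sK /(_ 1%g); rewrite urep_act1 id_lfunE.
pose iota : 'Hom(subvs_of W, X) := linfun vsval.
pose rho g : 'End(subvs_of W) := (linfun (vsproj W) \o (urep_act X g \o iota))%VF.
have rhoE g z : vsval (rho g z) = urep_act X g (vsval z).
  rewrite comp_lfunE [X in vsval X]lfunE /= vsprojK //; first by rewrite comp_lfunE lfunE.
  by rewrite comp_lfunE lfunE /=; apply: Wact; exact: subvsP.
have rho1 : rho 1%g = \1%VF.
  by apply/lfunP => z; apply: val_inj; rewrite /= rhoE urep_act1 !id_lfunE.
have rhoM g h : rho (g * h)%g = (rho g \o rho h)%VF.
  by apply/lfunP => z; apply: val_inj; rewrite /= comp_lfunE !rhoE urep_actM comp_lfunE.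
have coefE (xi : 'Hom(subvs_of W, k^o)) z g :
    xi (rho g z) = (xi \o linfun (vsproj W))%VF (urep_act X g (vsval z)).
  by rewrite !comp_lfunE [iota z]lfunE.
have rho_cont : continuous_coefs rho.
  move=> xi z; under eq_fun do rewrite coefE; exact: urep_continuous.
have [n dn] := urep_deg X.
have rho_deg (xi : 'Hom(subvs_of W, k^o)) z : deg_lt n (fun g => xi (rho g z) : k).
  by apply: eq_deg_lt (dn _ _) => g; rewrite coefE.
exists (urep_of rho1 rhoM rho_cont rho_deg), iota, (vsproj W v); split.
- by move=> g z; rewrite [iota _]lfunE [iota z]lfunE; exact: rhoE.
- by rewrite lfunE /= vsprojK.
- move=> K sK Kv z; rewrite lfunE /=.
  by have /WP := subvsP z; apply.
Qed.

Lemma urep_sum X Y : exists (Z : urep G k) (p : 'Hom(Z, X)) (q : 'Hom(Z, Y)),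
  [/\ equivariant p, equivariant q & forall x y, exists2 z, p z = x & q z = y].
Proof.
pose S : vectType k := (X * Y)%type.
pose fst_lin : {linear S -> X} :=
  linear_pack (fun c (u v : S) => erefl : (c *: u + v).1 = c *: u.1 + v.1).
pose snd_lin : {linear S -> Y} :=
  linear_pack (fun c (u v : S) => erefl : (c *: u + v).2 = c *: u.2 + v.2).
have inl_l : linear (fun x : X => (x, 0) : S).
  by move=> c u v; apply: injective_projections => //=; rewrite scaler0 addr0.
have inr_l : linear (fun y : Y => (0, y) : S).
  by move=> c u v; apply: injective_projections => //=; rewrite scaler0 addr0.
pose p : 'Hom(S, X) := linfun fst_lin; pose q : 'Hom(S, Y) := linfun snd_lin.
pose a : 'Hom(X, S) := linfun (linear_pack inl_l).
pose b : 'Hom(Y, S) := linfun (linear_pack inr_l).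
pose rho g : 'End(S) := ((a \o (urep_act X g \o p)) + (b \o (urep_act Y g \o q)))%VF.
have rhoE g z : rho g z = (urep_act X g z.1, urep_act Y g z.2) :> S.
  rewrite add_lfunE !comp_lfunE !lfunE /=.
  by apply: injective_projections; rewrite /= ?addr0 ?add0r.
have rho1 : rho 1%g = \1%VF.
  by apply/lfunP => -[x y]; rewrite rhoE !urep_act1 !id_lfunE.
have rhoM g h : rho (g * h)%g = (rho g \o rho h)%VF.
  by apply/lfunP => -[x y]; rewrite comp_lfunE !rhoE /= !urep_actM !comp_lfunE.
have coefE (xi : 'Hom(S, k^o)) z g : xi (rho g z) =
    ((xi \o a)%VF (urep_act X g z.1) + (xi \o b)%VF (urep_act Y g z.2) : k).
  by rewrite add_lfunE linearD !comp_lfunE !lfunE.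
have rho_cont : continuous_coefs rho.
  move=> xi z; under eq_fun do rewrite coefE.
  by apply: continuous_add; exact: urep_continuous.
have [m dm] := urep_deg X; have [n dn] := urep_deg Y.
have rho_deg (xi : 'Hom(S, k^o)) z : deg_lt (m + n) (fun g => xi (rho g z) : k).
  apply: eq_deg_lt (deg_ltD (deg_lt_le (leq_addr n m) (dm (xi \o a)%VF z.1))
    (deg_lt_le (leq_addl m n) (dn (xi \o b)%VF z.2))) => g.
  by rewrite coefE.
exists (urep_of rho1 rhoM rho_cont rho_deg), p, q; split.
- by move=> g z; rewrite [p _]lfunE [p z]lfunE /= rhoE.
- by move=> g z; rewrite [q _]lfunE [q z]lfunE /= rhoE.
- by move=> x y; exists ((x, y) : S); rewrite lfunE.
Qed.

(** Column j of [rho] has degree at most j: the difference by h of [rho g i j] is a combination of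
    the [rho g i l] with l < j. *)
Lemma unitriangular_urep d (rho : G -> 'M[k]_d) :
    (forall g, upper_unitriangular (rho g)) ->
    (forall g h, rho (g * h)%g = rho g *m rho h) ->
    (forall i j, continuous (fun g => rho g i j)) ->
  forall i j, exists (X : urep G k) (xi : 'Hom(X, k^o)) v,
    forall g, xi (urep_act X g v) = rho g i j.
Proof.
move=> rhoU rhoM rho_cont i0 j0.
have rho1 : rho 1%g = 1%:M.
  apply: idempotent_unitmx; first exact: upper_unitriangular_unitmx.
  by rewrite -rhoM mulg1.
pose S : vectType k := 'cV[k]_d.
have act_l g : linear (fun v : S => (rho g *m v : S)).
  by move=> c u v; rewrite mulmxDr -scalemxAr.
pose act g : 'End(S) := linfun (linear_pack (act_l g)).
have actE g v : act g v = rho g *m v by rewrite lfunE.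
have act1 : act 1%g = \1%VF by apply/lfunP => v; rewrite actE rho1 mul1mx id_lfunE.
have actM g h : act (g * h)%g = (act g \o act h)%VF.
  by apply/lfunP => v; rewrite comp_lfunE !actE rhoM mulmxA.
have coefE (xi : 'Hom(S, k^o)) v g :
    xi (act g v) = \sum_i \sum_j (v j 0 * xi (delta_mx i 0)) * rho g i j :> k.
  rewrite actE [_ *m _]matrix_sum_delta linear_sum; apply: eq_bigr => i _.
  rewrite big_ord1 linearZ /= mxE /GRing.scale /= mulr_suml.
  by apply: eq_bigr => j _; rewrite [RHS]mulrC mulrA ord1.
have act_cont : continuous_coefs act.
  move=> xi v; under eq_fun do rewrite coefE.
  apply: continuous_sum => i; apply: continuous_sum => j.
  by apply: continuous_mul => //; exact: continuous_cst.
have rho_deg n : forall (i j : 'I_d), (j < n)%N -> deg_lt n (fun g => rho g i j).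
  elim: n => [|n IHn] i j; first by rewrite ltn0.
  rewrite ltnS => jn /= h.
  have : deg_lt n (fun g => \sum_(l < d | (l < j)%N) rho h l j * rho g i l).
    pose F (l : 'I_d) g := if (l < j)%N then rho h l j * rho g i l else 0.
    have dF l : deg_lt n (F l).
      rewrite /F; case: (boolP (l < j)%N) => lj; last exact: deg_lt0.
      by apply: deg_ltZ; apply: IHn; exact: leq_trans lj jn.
    by apply: eq_deg_lt (deg_lt_sum (index_enum 'I_d) dF) => g; rewrite [RHS]big_mkcond.
  apply: eq_deg_lt => g; rewrite rhoM mxE.
  rewrite [in RHS](bigID (fun l : 'I_d => (l < j)%N)) /=.
  have -> : \sum_(l < d | ~~ (l < j)%N) rho g i l * rho h l j = rho g i j.
    rewrite (bigD1 j) ?ltnn //= (rhoU h).1 mulr1 big1 ?addr0 // => l /andP[lj l_j].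
    rewrite (rhoU h).2 ?mulr0 // ltn_neqAle leqNgt lj andbT.
    by rewrite eq_sym; apply: contra l_j => /eqP/val_inj->.
  by rewrite addrK; apply: eq_bigr => l _; rewrite mulrC.
have act_deg (xi : 'Hom(S, k^o)) v : deg_lt d (fun g => xi (act g v) : k).
  have : deg_lt d (fun g => \sum_i \sum_j (v j 0 * xi (delta_mx i 0)) * rho g i j).
    by apply: deg_lt_sum => i; apply: deg_lt_sum => j; apply: deg_ltZ; exact: rho_deg.
  by apply: eq_deg_lt => g; rewrite coefE.
have ent_l : linear (fun v : S => (v i0 0 : k^o)) by move=> c u v; rewrite !mxE.
exists (urep_of act1 actM act_cont act_deg), (linfun (linear_pack ent_l)), (delta_mx j0 0).
by move=> g; rewrite lfunE /= actE -colE mxE.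
Qed.

End Representations.

Arguments basis_vec {k} V i.
Arguments coordinate {k} V i.

(** * The universal tensor automorphism *)

Section BaseChange.
Variables (k : topologicalFieldType) (R : comAlgType k).
Implicit Types V W : vectType k.

Definition form_col V (xi : 'Hom(V, k^o)) : 'cV[R]_(dim V) :=
  \col_i (xi (basis_vec V i) : k)%:A.

Lemma in_alg_sum (I : Type) (r : seq I) (F : I -> k) :
  \sum_(i <- r) (F i)%:A = (\sum_(i <- r) F i)%:A :> R.
Proof. by rewrite scaler_suml. Qed.

Lemma in_algM (a b : k) : a%:A * b%:A = (a * b)%:A :> R.
Proof. by rewrite -scalerAl mul1r scalerA. Qed.

Lemma base_vec_form V (xi : 'Hom(V, k^o)) v :
  (base_vec R v *m form_col xi) 0 0 = (xi v : k)%:A.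
Proof.
rewrite mxE {2}[v]v2r_sum linear_sum -in_alg_sum.
by apply: eq_bigr => i _; rewrite linearZ !mxE in_algM.
Qed.

Lemma base_vec_lfun V W (f : 'Hom(V, W)) v :
  base_lfun f (base_vec R v) = base_vec R (f v).
Proof. by rewrite /base_lfun /base_vec -map_mxM v2r_lfun. Qed.

Lemma form_col_lfun V W (f : 'Hom(V, W)) (xi : 'Hom(W, k^o)) :
  map_mx (in_alg R) (f2mx f) *m form_col xi = form_col (xi \o f)%VF.
Proof.
apply/colP => i; rewrite !mxE comp_lfunE.
rewrite [f _]v2r_sum linear_sum -in_alg_sum; apply: eq_bigr => j _.
by rewrite !mxE f2mxE linearZ in_algM.
Qed.

Lemma base_vec_basis V i : base_vec R (basis_vec V i) = delta_mx 0 i.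
Proof. by rewrite /base_vec r2vK map_delta_mx. Qed.

Lemma base_tens_linear_l V W (y : 'rV[R]_(dim W)) :
  linear (fun x : 'rV[R]_(dim V) => base_tens x y).
Proof.
move=> c u v; rewrite /base_tens scaler_sumr -big_split; apply: eq_bigr => i _.
rewrite scaler_sumr -big_split; apply: eq_bigr => j _ /=.
by rewrite !mxE mulrDl scalerDl scalerA mulrA.
Qed.

Lemma base_tens_linear_r V W (x : 'rV[R]_(dim V)) :
  linear (fun y : 'rV[R]_(dim W) => base_tens x y).
Proof.
move=> c u v; rewrite /base_tens scaler_sumr -big_split; apply: eq_bigr => i _.
rewrite scaler_sumr -big_split; apply: eq_bigr => j _ /=.
by rewrite !mxE mulrDr scalerDl scalerA mulrCA.
Qed.

Lemma base_vec_linear V c (u v : V) :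
  base_vec R (c *: u + v) = c%:A *: base_vec R u + base_vec R v.
Proof. by apply/rowP => i; rewrite !mxE linearP !mxE rmorphD rmorphM. Qed.

Lemma base_vec0 V : base_vec R (0 : V) = 0.
Proof. by apply/rowP => i; rewrite !mxE linear0 mxE rmorph0. Qed.

Lemma base_vec_sum V (I : Type) (r : seq I) (c : I -> k) (F : I -> V) :
  base_vec R (\sum_(i <- r) c i *: F i) = \sum_(i <- r) (c i)%:A *: base_vec R (F i).
Proof.
elim: r => [|i r IHr]; first by rewrite !big_nil base_vec0.
by rewrite !big_cons base_vec_linear IHr.
Qed.

Lemma base_tens_vec V W (v : V) (w : W) :
  base_tens (base_vec R v) (base_vec R w) = base_vec R (tens v w).
Proof.
rewrite {2}[v]v2r_sum -/(tens_l _ _) linear_sum /=.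
have E i : tens_l w (v2r v 0 i *: basis_vec V i) =
    v2r v 0 i *: \sum_j v2r w 0 j *: tens (basis_vec V i) (basis_vec W j).
  rewrite linearZ /= /tens_l {1}[w]v2r_sum linear_sum; congr (_ *: _).
  by apply: eq_bigr => j _; rewrite linearZ.
rewrite (eq_bigr _ (fun i _ => E i)) base_vec_sum; apply: eq_bigr => i _.
rewrite base_vec_sum scaler_sumr; apply: eq_bigr => j _.
by rewrite scalerA !mxE.
Qed.

Lemma base_tens_lfun V W (f : 'End(V)) (g : 'End(W)) x y :
  base_tens (base_lfun (R := R) f x) (base_lfun g y) =
  base_lfun (tens_end f g) (base_tens x y).
Proof.
have eE (Q : vectType k) (h : 'End(Q)) i :
    base_lfun h (delta_mx 0 i) = base_vec R (h (basis_vec Q i)).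
  by rewrite -base_vec_lfun base_vec_basis.
have lE (Q : vectType k) (h : 'End(Q)) : linear (base_lfun (R := R) h).
  by move=> c u v; rewrite /base_lfun mulmxDl -scalemxAl.
have bl w := @base_tens_linear_l V W w.
have br v := @base_tens_linear_r V W v.
rewrite [x]row_sum_delta (linear_combination _ _ _ (lE V f)).
rewrite (linear_combination _ _ _ (bl _)) (linear_combination _ _ _ (bl _)).
rewrite (linear_combination _ _ _ (lE _ _)); apply: eq_bigr => i _; congr (_ *: _).
rewrite [y]row_sum_delta (linear_combination _ _ _ (lE W g)).
rewrite (linear_combination _ _ _ (br _)) (linear_combination _ _ _ (br _)).
rewrite (linear_combination _ _ _ (lE _ _)); apply: eq_bigr => j _; congr (_ *: _).
by rewrite !eE -!base_vec_basis !base_tens_vec base_vec_lfun tens_endE.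
Qed.

Lemma tens_form_exists V W (xi : 'Hom(V, k^o)) (eta : 'Hom(W, k^o)) :
  exists zeta : 'Hom('M[k]_(dim V, dim W), k^o),
    forall v w, zeta (tens v w) = (xi v : k) * eta w.
Proof.
pose z (A : 'M[k]_(dim V, dim W)) : k^o :=
  \sum_i \sum_j A i j * ((xi (basis_vec V i) : k) * eta (basis_vec W j)).
have zl : linear z.
  move=> c A B; rewrite /z scaler_sumr -big_split; apply: eq_bigr => i _.
  rewrite scaler_sumr -big_split; apply: eq_bigr => j _.
  by rewrite !mxE mulrDl -mulrA.
exists (linfun (linear_pack zl)) => v w; rewrite lfunE /= /z.
rewrite {2}[v]v2r_sum {2}[w]v2r_sum !linear_sum mulr_suml; apply: eq_bigr => i _.
rewrite mulr_sumr; apply: eq_bigr => j _.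
by rewrite !linearZ /= /tens mxE big_ord1 mxE; exact: mulrACA.
Qed.

Lemma base_tens_form V W (xi : 'Hom(V, k^o)) (eta : 'Hom(W, k^o))
    (zeta : 'Hom('M[k]_(dim V, dim W), k^o))
    (x : 'rV[R]_(dim V)) (y : 'rV[R]_(dim W)) :
    (forall v w, zeta (tens v w) = (xi v : k) * eta w) ->
  (base_tens x y *m form_col zeta) 0 0 =
  (x *m form_col xi) 0 0 * (y *m form_col eta) 0 0.
Proof.
move=> zE; rewrite /base_tens mulmx_suml summxE.
rewrite [(x *m _) _ _]mxE mulr_suml; apply: eq_bigr => i _.
rewrite mulmx_suml summxE [(y *m _) _ _]mxE mulr_sumr; apply: eq_bigr => j _.
rewrite -scalemxAl mxE base_vec_form zE -in_algM !mxE.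
exact: mulrACA.
Qed.

End BaseChange.

Lemma map_base_tens (k : topologicalFieldType) (R S : comAlgType k)
    (phi : {lrmorphism R -> S}) (V W : vectType k) x y :
  map_mx phi (base_tens x y) =
  base_tens (map_mx phi x) (map_mx phi y) :> 'rV[S]_(dim 'M[k]_(dim V, dim W)).
Proof.
rewrite /base_tens raddf_sum; apply: eq_bigr => i _.
rewrite raddf_sum; apply: eq_bigr => j _ /=; apply/rowP => l.
rewrite !mxE !rmorphM; congr (_ * _); exact: rmorph_alg.
Qed.

Lemma map_base_mx (k : topologicalFieldType) (R S : comAlgType k)
    (phi : {lrmorphism R -> S}) m n (A : 'M[k]_(m, n)) :
  map_mx phi (map_mx (in_alg R) A) = map_mx (in_alg S) A.
Proof. by apply/matrixP => i j; rewrite !mxE; exact: rmorph_alg. Qed.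

(** * Matrix coefficients of the universal automorphism *)

Section Tannaka.
Variables (G : topologicalGroupType) (k : topologicalFieldType).
Variables (U : affineGroup k).
Variable theta : forall R : comAlgType k, points U R -> endo_family G R.
Hypothesis repr_U : represents_aut theta.
Implicit Types X Y : urep G k.

Definition universal_point : points U U := idfun.

Lemma univ_mx_subproof X :
  {M : 'M[U]_(dim X) | forall v, theta universal_point X v = v *m M}.
Proof. by exists (lin1_mx (theta universal_point X)) => v; rewrite mul_rV_lin1. Qed.

Definition univ_mx X := sval (univ_mx_subproof X).

Lemma univ_mxE X v : theta universal_point X v = v *m univ_mx X.
Proof. by rewrite /univ_mx; case: univ_mx_subproof. Qed.

(** Yoneda: [x] is the image of the universal point under [x] itself, so by naturality it acts
    through the specialisation of [univ_mx]. *)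
Lemma thetaE (R : comAlgType k) (x : points U R) X v :
  theta x X v = v *m map_mx x (univ_mx X).
Proof.
have xE : point_map x universal_point = x by apply: lrmorphism_eq.
rewrite [v]row_sum_delta linear_sum mulmx_suml; apply: eq_bigr => i _.
rewrite linearZ -scalemxAl; congr (_ *: _).
rewrite -(map_delta_mx x) -map_mxM -univ_mxE.
by have := theta_nat repr_U x universal_point (X := X) (delta_mx 0 i); rewrite xE.
Qed.

Lemma univ_mx_unit : univ_mx (urep_unit G k) = 1%:M.
Proof.
apply/row_matrixP => i; rewrite !rowE mulmx1.
have := tensor_aut_unit (theta_aut repr_U universal_point) (delta_mx 0 i).
by rewrite univ_mxE.
Qed.

Lemma univ_mx_nat X Y (f : 'Hom(X, Y)) : equivariant f ->
  map_mx (in_alg U) (f2mx f) *m univ_mx Y = univ_mx X *m map_mx (in_alg U) (f2mx f).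
Proof.
move=> fe; apply/row_matrixP => i; rewrite !rowE !mulmxA.
have := tensor_aut_nat (theta_aut repr_U universal_point) fe (delta_mx 0 i).
by rewrite !univ_mxE.
Qed.

Lemma univ_mx_tens X Y x y :
  base_tens x y *m univ_mx (urep_tens X Y) =
  base_tens (x *m univ_mx X) (y *m univ_mx Y) :> 'rV[U]_(dim 'M[k]_(dim X, dim Y)).
Proof.
have := tensor_aut_tens (theta_aut repr_U universal_point) (X := X) (Y := Y) x y.
by rewrite !univ_mxE.
Qed.

Definition coef X (v : X) (xi : 'Hom(X, k^o)) : U :=
  (base_vec U v *m univ_mx X *m form_col U xi) 0 0.

Lemma coef_nat X Y (f : 'Hom(X, Y)) v xi : equivariant f ->
  coef (f v) xi = coef v (xi \o f)%VF.
Proof.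
move=> fe; rewrite /coef -base_vec_lfun /base_lfun -(mulmxA (base_vec U v)).
by rewrite univ_mx_nat // !mulmxA -(mulmxA _ _ (form_col _ _)) form_col_lfun.
Qed.

Lemma coef_unit (v : urep_unit G k) xi : coef v xi = (xi v : k)%:A.
Proof. by rewrite /coef univ_mx_unit mulmx1 base_vec_form. Qed.

Lemma coefM X Y (v : X) (w : Y) xi eta : exists u zeta,
  coef v xi * coef w eta = coef (u : urep_tens X Y) zeta.
Proof.
have [zeta zE] := tens_form_exists xi eta.
exists (tens v w : urep_tens X Y), zeta; rewrite /coef.
rewrite -(base_tens_form _ _ zE) -univ_mx_tens base_tens_vec.
by [].
Qed.

Lemma form_colD (V : vectType k) (xi eta : 'Hom(V, k^o)) :
  form_col U (xi + eta) = form_col U xi + form_col U eta.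
Proof. by apply/colP => i; rewrite !mxE add_lfunE scalerDl. Qed.

Lemma coefD X (v : X) xi eta : coef v (xi + eta)%R = coef v xi + coef v eta.
Proof. by rewrite /coef form_colD mulmxDr mxE. Qed.

Lemma coefZ X (v : X) xi c : coef (c *: v) xi = c *: coef v xi.
Proof.
rewrite /coef -[c *: v]addr0 base_vec_linear base_vec0 addr0.
by rewrite -!scalemxAl mxE mulr_algl.
Qed.

Lemma coef_add X Y (v : X) (w : Y) xi eta : exists (Z : urep G k) (u : Z) zeta,
  coef v xi + coef w eta = coef u zeta.
Proof.
have [Z [p [q [pe qe pq]]]] := urep_sum X Y; have [u <- <-] := pq v w.
by exists Z, u, ((xi \o p) + (eta \o q))%VF; rewrite coefD !coef_nat.
Qed.

Lemma univ_mx_coef X i j : univ_mx X i j = coef (basis_vec X i) (coordinate X j).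
Proof.
rewrite /coef base_vec_basis -rowE [RHS]mxE (bigD1 j) //= big1 ?addr0.
  by rewrite [form_col _ _ _ _]mxE coordinate_basis eqxx scale1r mulr1 mxE.
move=> l lj; rewrite [form_col _ _ _ _]mxE coordinate_basis (negPf lj).
by rewrite scale0r mulr0.
Qed.

(* On the subrepresentation spanned by the orbit of [v], [xi] is an equivariant
   map to the unit representation. *)
Lemma coef_const X (v : X) (xi : 'Hom(X, k^o)) :
  (forall g, xi (urep_act X g v) = xi v) -> coef v xi = (xi v : k)%:A.
Proof.
move=> xic; have [Y [i [y [ie iy Yind]]]] := urep_cyclic v.
have xi_inv (z : Y) h : xi (urep_act X h (i z)) = xi (i z).
  move: z h; suff H z : [set w | forall h, xi (urep_act X h w) = xi w] (i z).
    by move=> z h; exact: (H z h).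
  apply: Yind; last first.
    move=> g h /=; have := xic (h * g)%g.
    by rewrite urep_actM comp_lfunE xic => ->.
  split=> [h|c u w Hu Hw h] /=; first by rewrite linear0.
  by rewrite !linearP /= Hu Hw.
pose eta : 'Hom(Y, urep_unit G k) := (xi \o i)%VF.
have eta_eq : equivariant eta.
  by move=> g z; rewrite !comp_lfunE ie xi_inv id_lfunE.
have etaE : eta y = xi v by rewrite comp_lfunE iy.
rewrite -iy coef_nat // iy -etaE.
have := coef_nat (Y := urep_unit G k) y (\1%VF : 'End(k^o)) eta_eq.
by rewrite coef_unit id_lfunE comp_lfun1l => <-.
Qed.

Lemma coef_coordinate X Y (f : 'Hom(X, Y)) v j :
  coef v (coordinate Y j \o f)%VF =
  (base_vec U v *m univ_mx X *m map_mx (in_alg U) (f2mx f)) 0 j.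
Proof.
rewrite /coef -form_col_lfun mulmxA [LHS]mxE (bigD1 j) //= big1 ?addr0.
  by rewrite [form_col _ _ _ _]mxE coordinate_basis eqxx scale1r mulr1.
move=> l lj; rewrite [form_col _ _ _ _]mxE coordinate_basis (negPf lj).
by rewrite scale0r mulr0.
Qed.

(** The universal automorphism is unipotent for the same flag as G. For v in F i.+1 a functional
    killing F i is constant on the orbit of v, and [coef_const] extends this from G to U. *)
Lemma univ_mx_nilpotent X : exists n, (univ_mx X - 1%:M) ^+ n = 0.
Proof.
have [n [F [F0 Fn _ _ F_uni]]] := urep_act_unipotent X.
pose P i := map_mx (in_alg U) (f2mx (projv (F i))).
have P0 : P 0%N = 0.
  apply/matrixP => a j; rewrite [LHS]mxE [RHS]mxE f2mxE.
  have : projv (F 0%N) (basis_vec X a) \in F 0%N by apply: memv_proj.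
  by rewrite F0 memv0 => /eqP->; rewrite linear0 mxE rmorph0.
have Pn : P n = 1%:M.
  rewrite /P -(map_mx1 (in_alg U)); congr map_mx; rewrite -f2mx_id; congr f2mx.
  by apply/lfunP => v; rewrite id_lfunE projv_id // Fn memvf.
(* With row vectors, this says that [univ_mx X - 1] maps F i.+1 into F i after base change:
   projecting the image to F i leaves it unchanged. *)
have PP i : P i.+1 *m (univ_mx X - 1%:M) = P i.+1 *m (univ_mx X - 1%:M) *m P i.
  apply/eqP; rewrite -subr_eq0 -[X in X - _]mulmx1 -mulmxBr; apply/eqP.
  apply/row_matrixP => a; apply/rowP => j; rewrite row0 [RHS]mxE.
  set v := projv (F i.+1) (basis_vec X a).
  have vF : v \in F i.+1 by apply: memv_proj.
  pose f : 'End(X) := (\1 - projv (F i))%VF.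
  have f0 w : w \in F i -> f w = 0.
    by move=> wF; rewrite add_lfunE opp_lfunE id_lfunE projv_id // subrr.
  pose xi : 'Hom(X, k^o) := (coordinate X j \o f)%VF.
  have xiE w : xi w = coordinate X j (f w) by rewrite comp_lfunE.
  have xiv g : xi (urep_act X g v) = xi v.
    rewrite !xiE; congr (coordinate X j _); apply/eqP; rewrite -subr_eq0; apply/eqP.
    exact: (etrans (esym (linearB f _ _)) (f0 _ (F_uni g i v vF))).
  have fE : map_mx (in_alg U) (f2mx f) = 1%:M - P i.
    rewrite /P -(map_mx1 (in_alg U)) -map_mxB; congr map_mx.
    apply/row_matrixP => b; rewrite !rowE -[delta_mx 0 b]r2vK mulmxBr -!v2r_lfun.
    by rewrite add_lfunE opp_lfunE id_lfunE linearB /= mulmx1.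
  have vE : base_vec U v = row a (P i.+1).
    by rewrite /v -base_vec_lfun base_vec_basis /base_lfun -rowE.
  have := coef_const xiv; rewrite coef_coordinate fE => H.
  rewrite row_mul row_mul -vE [base_vec U v *m _]mulmxBr mulmx1 mulmxBl.
  rewrite [LHS]mxE [X in _ + X]mxE H.
  have -> : (base_vec U v *m (1%:M - P i)) 0 j = (xi v : k)%:A.
    rewrite -fE xiE coordinateE.
    have := base_vec_lfun U f v; rewrite /base_lfun => ->.
    by rewrite mxE.
  exact: subrr.
have PM i : P i *m (univ_mx X - 1%:M) ^+ i = 0.
  elim: i => [|i IHi]; first by rewrite P0 mul0mx.
  rewrite exprS [LHS](mulmxA (P i.+1) (univ_mx X - 1%:M)) PP.
  by rewrite -[LHS](mulmxA _ (P i)) IHi mulmx0.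
by exists n; have := PM n; rewrite Pn mul1mx.
Qed.

Lemma nilpotent_inverse (R : comNzRingType) d (A : 'M[R]_d) n :
  (A - 1%:M) ^+ n = 0 -> exists2 B, A *m B = 1%:M & B *m A = 1%:M.
Proof.
move=> An; pose N := 1%:M - A; pose B := \sum_(i < n) N ^+ i.
have Nn : N ^+ n = 0 by rewrite /N -opprB exprNn An mulr0.
have AB : A *m B = 1%:M.
  have := subrX1 N n; rewrite Nn sub0r => /(congr1 -%R); rewrite opprK -mulNr.
  by rewrite {1}/N opprB subKr => /esym.
by exists B => //; exact: mulmx1C.
Qed.

Definition univ_gen : set U := [set a | exists X i j, a = univ_mx X i j].

Local Notation B := (generated univ_gen).
Local Notation v := (@generated_val k U univ_gen).

Definition gen_mx X : 'M[B]_(dim X) := \matrix_(i, j)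
  Generated (@generated_sub k U univ_gen (univ_mx X i j)
    (ex_intro _ X (ex_intro _ i (ex_intro _ j erefl)))).

Lemma map_gen_mx X : map_mx v (gen_mx X) = univ_mx X.
Proof. by apply/matrixP => i j; rewrite 2!mxE. Qed.

Lemma map_generated_inj m n : injective (map_mx v : 'M[B]_(m, n) -> 'M[U]_(m, n)).
Proof.
move=> A C /matrixP AC; apply/matrixP => i j; apply: generated_val_inj.
by have := AC i j; rewrite !mxE.
Qed.

(** The tensor identities descend along the injection into O(U). Invertibility does not, and is
    obtained from unipotence, the inverse being a polynomial in the matrix. *)
Lemma gen_mx_tensor_aut : tensor_aut (fun X => mulmxr (gen_mx X) : {linear _ -> _}).
Proof.
split=> [X|X Y f fe x|X Y x y|x] /=.
- have [n Mn] := univ_mx_nilpotent X.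
  have [|C MC CM] := @nilpotent_inverse _ _ (gen_mx X) n.
    apply: map_generated_inj; rewrite map_mx0 -[RHS]Mn -map_gen_mx.
    elim: {Mn} n => [|n IHn]; first by rewrite !expr0 [LHS]map_mx1.
    by rewrite !exprS [LHS]map_mxM IHn map_mxB map_mx1.
  exists (mulmxr C) => x /=; first by rewrite -mulmxA MC mulmx1.
  by rewrite -mulmxA CM mulmx1.
- apply: map_generated_inj; rewrite /base_lfun !map_mxM.
  rewrite !map_gen_mx (map_base_mx (generated_incl univ_gen)).
  by rewrite -!mulmxA univ_mx_nat.
- apply: map_generated_inj; rewrite map_mxM [X in _ *m X](map_gen_mx (urep_tens X Y)).
  rewrite !(map_base_tens (generated_incl univ_gen)) !map_mxM !map_gen_mx.
  exact: univ_mx_tens.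
- apply: map_generated_inj.
  by rewrite map_mxM [X in _ *m X](map_gen_mx (urep_unit G k)) univ_mx_unit mulmx1.
Qed.

(* The universal automorphism is defined over the subalgebra generated by its
   matrix coefficients, which yields a retraction of O(U) onto it. *)
Lemma univ_mx_generates : alg_generated univ_gen.
Proof.
have [y yE] := theta_surj repr_U gen_mx_tensor_aut.
have yM X : map_mx y (univ_mx X) = gen_mx X.
  by apply/row_matrixP => i; rewrite !rowE -thetaE yE.
have vy : point_map (generated_incl univ_gen) y =1 universal_point.
  apply: (theta_inj repr_U) => X w; rewrite !thetaE; congr (_ *m _).
  apply/matrixP => i j; rewrite [LHS]mxE [RHS]mxE /=.
  have /matrixP/(_ i j) := yM X; rewrite [LHS]mxE => ->.
  by rewrite mxE.
move=> S Sc SX a; rewrite -[a]/(universal_point a) -vy /=.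
by case: (y a) => b /= /generated_predP; apply.
Qed.

(** A single coefficient suffices: direct sums absorb addition, tensor products multiplication, and
    the unit representation gives 1. *)
Lemma coef_surj (a : U) : exists X (w : X) xi, a = coef w xi.
Proof.
move: a; apply: (alg_generated_ind univ_mx_generates).
- exists (urep_unit G k), (1 : k^o), (\1%VF : 'End(k^o)).
  by rewrite coef_unit id_lfunE scale1r.
- move=> c _ _ [X [w [xi ->]]] [Y [u [eta ->]]]; rewrite -coefZ.
  by have [Z [z [zeta ->]]] := coef_add (c *: w) u xi eta; exists Z, z, zeta.
- move=> _ _ [X [w [xi ->]]] [Y [u [eta ->]]].
  by have [z [zeta ->]] := coefM w u xi eta; exists (urep_tens X Y), z, zeta.
- move=> _ [X [i [j ->]]]; rewrite univ_mx_coef.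
  by exists X, (basis_vec X i), (coordinate X j).
Qed.
End Tannaka.

(** * Unitriangular comodule matrices *)

Section MultiplicativeMatrices.
Variables (k : fieldType) (U : affineGroup k).

(** In the coproduct of the conjugate, the sum over the middle index contracts Q P to the identity
    between the two copies of [N]. *)
Lemma mult_matrix_conj d (N : 'M[U]_d) (P Q : 'M[k]_d) :
    mult_matrix N -> Q *m P = 1%:M ->
  mult_matrix (map_mx (in_alg U) P *m N *m map_mx (in_alg U) Q).
Proof.
move=> Nm QP Z b bl i j.
set M := _ *m _ *m _.
have ME i' j' : M i' j' = \sum_a \sum_c (P i' a * Q c j') *: N a c.
  rewrite exchange_big mxE; apply: eq_bigr => c _.
  rewrite mxE mulr_suml; apply: eq_bigr => a _.
  by rewrite !mxE /= mulr_algl mulr_algr scalerA mulrC.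
have MEp i' j' : M i' j' = \sum_(p : 'I_d * 'I_d) (P i' p.1 * Q p.2 j') *: N p.1 p.2.
  by rewrite ME pair_big.
rewrite MEp (linear_combination _ _ _ (comul_sum_linear bl)).
under eq_bigr do rewrite Nm //.
transitivity (\sum_(p : 'I_d * 'I_d) \sum_(q : 'I_d * 'I_d) \sum_l
    (P i p.1 * Q p.2 l * (P l q.1 * Q q.2 j)) *: b (N p.1 p.2) (N q.1 q.2)); last first.
  under eq_bigr do rewrite exchange_big.
  rewrite exchange_big; apply: eq_bigr => l _.
  rewrite MEp (linear_combination _ _ _ (bl.1 _)); apply: eq_bigr => p _.
  rewrite MEp (linear_combination _ _ _ (bl.2 _)) scaler_sumr; apply: eq_bigr => q _.
  by rewrite scalerA.
have QPE c c' : \sum_l Q c l * P l c' = (c == c')%:R.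
  by have /matrixP/(_ c c') := QP; rewrite !mxE.
transitivity (\sum_(p : 'I_d * 'I_d) \sum_(q : 'I_d * 'I_d)
    (P i p.1 * Q q.2 j * (p.2 == q.1)%:R) *: b (N p.1 p.2) (N q.1 q.2)); last first.
  apply: eq_bigr => p _; apply: eq_bigr => q _.
  rewrite -scaler_suml -QPE mulr_sumr; congr (_ *: _); apply: eq_bigr => l _.
  by rewrite [P l _ * Q _ j]mulrC mulrACA.
rewrite -(pair_big xpredT xpredT
  (fun x y => (P i x * Q y j) *: \sum_l b (N x l) (N l y))) /=.
rewrite -(pair_big xpredT xpredT (fun x y => \sum_(q : 'I_d * 'I_d)
    (P i x * Q q.2 j * (y == q.1)%:R) *: b (N x y) (N q.1 q.2))) /=.
apply: eq_bigr => x _.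
under [RHS]eq_bigr => y _ do rewrite -(pair_big xpredT xpredT (fun u w =>
    (P i x * Q w j * (y == u)%:R) *: b (N x y) (N u w))) /=.
under [RHS]eq_bigr => y _ do rewrite exchange_big.
rewrite [RHS]exchange_big; apply: eq_bigr => y _.
rewrite scaler_sumr; apply: eq_bigr => l _.
rewrite (bigD1 l) //= eqxx mulr1 big1 ?addr0 // => u ul.
by rewrite eq_sym (negPf ul) mulr0 scale0r.
Qed.

Lemma mult_matrix_block m n (A : 'M[U]_m) (B : 'M[U]_n) :
  mult_matrix A -> mult_matrix B -> mult_matrix (block_mx A 0 0 B).
Proof.
move=> Am Bm Z b bl i j.
have b0l y : b 0 y = 0 by exact: (linear0 (linear_pack (bl.1 y))).
have b0r x : b x 0 = 0 by exact: (linear0 (linear_pack (bl.2 x))).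
have c0 : \sum_(p <- comul (0 : U)) b p.1 p.2 = 0.
  exact: (linear0 (linear_pack (comul_sum_linear bl))).
rewrite big_split_ord /=.
case: (split_ordP i) => a ->; case: (split_ordP j) => c ->.
- rewrite block_mxEul Am // [X in _ + X]big1 ?addr0.
    by apply: eq_bigr => l _; rewrite !block_mxEul.
  by move=> l _; rewrite block_mxEur mxE b0l.
- rewrite block_mxEur mxE c0 !big1 ?addr0 // => l _.
    by rewrite block_mxEur mxE b0l.
  by rewrite block_mxEur [X in b _ X]mxE b0r.
- rewrite block_mxEdl mxE c0 !big1 ?addr0 // => l _.
    by rewrite block_mxEdl [X in b _ X]mxE b0r.
  by rewrite block_mxEdl mxE b0l.
- rewrite block_mxEdr Bm // [X in X + _]big1 ?add0r.
    by apply: eq_bigr => l _; rewrite !block_mxEdr.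
  by move=> l _; rewrite block_mxEdl mxE b0l.
Qed.

Definition entries d (M : 'M[U]_d) : set U := [set a | exists i j, a = M i j].

Definition in_unitriangular (a : U) := exists d (M : 'M[U]_d),
  [/\ upper_unitriangular M, mult_matrix M & a \in generated_pred (entries M)].

Lemma generated_pred_sub (X Y : set U) : X `<=` Y ->
  {subset generated_pred X <= generated_pred Y}.
Proof.
move=> XY a /generated_predP aX; apply/generated_predP => S Sc SY.
by apply: aX => // x /XY; exact: SY.
Qed.

(** Block sums collect the matrices found for the single elements; the resulting entries generate
    O(U) as soon as [s] does. *)
Lemma in_unitriangular_seq (s : seq U) : (forall a, in_unitriangular a) ->
  exists d (M : 'M[U]_d), [/\ upper_unitriangular M, mult_matrix M &
    forall a, a \in s -> a \in generated_pred (entries M)].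
Proof.
move=> H; elim: s => [|a s [n [B [Bu Bm BE]]]].
  exists 0%N, 0; split=> //; first by split=> -[].
  by move=> Z b bl [].
have [m [A [Au Am AE]]] := H a.
exists (m + n)%N, (block_mx A 0 0 B); split.
- exact: upper_unitriangular_block.
- exact: mult_matrix_block.
- move=> x; rewrite inE => /orP[/eqP->|/BE].
    apply: generated_pred_sub AE => _ [i [j ->]].
    by exists (lshift n i), (lshift n j); rewrite block_mxEul.
  apply: generated_pred_sub => _ [i [j ->]].
  by exists (rshift m i), (rshift m j); rewrite block_mxEdr.
Qed.

Lemma algebraic_unipotent : (forall a, in_unitriangular a) -> algebraic U -> unipotent U.
Proof.
move=> H [s sgen]; have [d [M [[M1 M0] Mm sM]]] := in_unitriangular_seq s H.
exists d, M; split=> //; first exact/mult_matrixP.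
by move=> S Sc SM; apply: sgen => // a /sM /generated_predP; apply.
Qed.

End MultiplicativeMatrices.

(** * The universal property *)

Section KPointMorphism.
Variables (k : topologicalFieldType) (V : affineGroup k) (x : kpoints V).

Lemma kpointP c a b : x (c *: a + b) = c * x a + x b :> k.
Proof. exact: linearP. Qed.

Lemma kpointM a b : x (a * b) = x a * x b :> k.
Proof. exact: rmorphM. Qed.

Lemma kpoint1 : x 1 = 1 :> k.
Proof. exact: rmorph1. Qed.

Lemma kpoint0 : x 0 = 0 :> k.
Proof. exact: linear0. Qed.

Lemma kpointB a b : x (a - b) = x a - x b :> k.
Proof. exact: linearB. Qed.
End KPointMorphism.

Section Completion.
Variables (G : topologicalGroupType) (k : topologicalFieldType).
Hypothesis char0 : [pchar k] =i pred0.
Variable U : affineGroup k.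
Variable theta : forall R : comAlgType k, points U R -> endo_family G R.
Hypothesis repr_U : represents_aut theta.
Implicit Types X Y : urep G k.

Local Notation K := (k^o : comAlgType k).

Definition act_family g : endo_family G K :=
  fun X => mulmxr (map_mx (in_alg K) (f2mx (urep_act X g))).

Lemma act_tensor_aut g : tensor_aut (act_family g).
Proof.
split=> [X|X Y f fe x|X Y x y|x] /=.
- have inv h h' : (h * h')%g = 1%g ->
      cancel (act_family h' X) (act_family h X).
    move=> hh x; rewrite /= -mulmxA -map_mxM -f2mx_comp -urep_actM hh urep_act1.
    by rewrite f2mx_id map_mx1 mulmx1.
  by exists (act_family g^-1%g X); apply: inv; rewrite ?mulVg ?mulgV.
- rewrite /base_lfun -!mulmxA -!map_mxM -!f2mx_compHom; congr (_ *m map_mx _ (f2mx _)).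
  by apply/lfunP => v; rewrite !comp_lfunE fe.
- by have := base_tens_lfun (R := K) (urep_act X g) (urep_act Y g) x y.
- by rewrite [f2mx _]f2mx_id map_mx1 mulmx1.
Qed.

Definition can_point g : kpoints U := sval (cid (theta_surj repr_U (act_tensor_aut g))).

Lemma can_point_canonical : canonical_hom theta can_point.
Proof. by move=> g X w; rewrite /can_point; case: cid => x xE /=; rewrite xE. Qed.

Lemma can_point_mx g X : map_mx (can_point g) (univ_mx theta X) =
  map_mx (in_alg K) (f2mx (urep_act X g)).
Proof.
apply/row_matrixP => i; rewrite !rowE -(thetaE repr_U).
exact: can_point_canonical.
Qed.

Lemma can_point_coef g X (v : X) xi : can_point g (coef theta v xi) = xi (urep_act X g v).
Proof.
pose c : {lrmorphism U -> k^o} := can_point g.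
transitivity ((base_vec K v *m map_mx (in_alg K) (f2mx (urep_act X g)) *m
  form_col K xi) 0 0).
  rewrite -can_point_mx /coef.
  have -> : base_vec K v = map_mx c (base_vec U v) by exact/esym/(map_base_mx c).
  have -> : form_col K xi = map_mx c (form_col U xi).
    by apply/colP => i; rewrite !mxE rmorph_alg.
  by rewrite -!map_mxM [RHS]mxE.
rewrite -/(base_lfun _ _) base_vec_lfun base_vec_form.
exact: mulr1.
Qed.

(* The image of G is Zariski dense in U. *)
Lemma can_point_inj a b : (forall g, can_point g a = can_point g b) -> a = b.
Proof.
move=> ab; apply/eqP; rewrite -subr_eq0; apply/eqP.
have [X [v [xi abE]]] := coef_surj repr_U (a - b); rewrite abE.
have xi0 g : xi (urep_act X g v) = 0.
  rewrite -can_point_coef -abE.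
  by rewrite kpointB ab subrr.
have xiv : xi v = 0 by rewrite -(xi0 1%g) urep_act1 id_lfunE.
by rewrite (coef_const repr_U) ?xiv ?scale0r // => g; rewrite xi0.
Qed.

Lemma can_point_continuous a : continuous (fun g => can_point g a : k).
Proof.
have [X [v [xi ->]]] := coef_surj repr_U a.
under eq_fun do rewrite can_point_coef.
exact: urep_continuous.
Qed.

Lemma can_point_deg a : exists n, deg_lt n (fun g => can_point g a : k).
Proof.
have [X [v [xi ->]]] := coef_surj repr_U a; have [n dn] := urep_deg X.
by exists n; apply: eq_deg_lt (dn xi v) => g; rewrite can_point_coef.
Qed.

Lemma can_pointM g h : can_point (g * h)%g =1 point_mul (can_point g) (can_point h).
Proof.
apply: (theta_inj repr_U) => X w.
rewrite (theta_mul repr_U) /= !can_point_canonical /base_lfun urep_actM f2mx_comp.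
by rewrite map_mxM mulmxA.
Qed.

Lemma can_point_hom : continuous_hom can_point.
Proof.
split; first exact: can_pointM.
by apply: continuous_kpoints => // a; exact: can_point_continuous.
Qed.

Lemma hom_comul (V W : affineGroup k) (phi : G -> kpoints V) (f : {lrmorphism W -> V}) :
    (forall g h, phi (g * h)%g =1 point_mul (phi g) (phi h)) ->
    group_comorphism f -> forall g h a,
  phi (g * h)%g (f a) = \sum_(p <- comul a) (phi g (f p.1) * phi h (f p.2) : k).
Proof.
move=> phiM fc g h a; rewrite phiM.
rewrite [LHS](tensor_eq_sum (b := fun x y => (phi g x * phi h y : k^o)) (fc a)).
  by rewrite big_map.
by apply: separately_linear_mul => c x y; rewrite linearP.
Qed.

Lemma hom_matrix (V W : affineGroup k) (phi : G -> kpoints V)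
    (f : {lrmorphism W -> V}) d (N : 'M[W]_d) :
    (forall g h, phi (g * h)%g =1 point_mul (phi g) (phi h)) ->
    group_comorphism f -> mult_matrix N -> forall g h,
  map_mx (fun a => phi (g * h)%g (f a) : k) N =
  map_mx (fun a => phi g (f a) : k) N *m map_mx (fun a => phi h (f a) : k) N.
Proof.
move=> phiM fc Nm g h; apply/matrixP => i j; rewrite !mxE (hom_comul phiM fc).
rewrite (Nm _ (fun x y => (phi g (f x) * phi h (f y) : k^o))).
  by apply: eq_bigr => l _; rewrite !mxE.
apply: (separately_linear_mul (f := fun x => phi g (f x))
  (g := fun y => phi h (f y)));
  by move=> c x y; rewrite !linearP.
Qed.

Lemma hom_points_hom (V : affineGroup k) (f : {lrmorphism V -> U}) :
  group_comorphism f -> continuous_hom (fun g => hom_points f (can_point g) : kpoints V).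
Proof.
move=> fc; split; last first.
  by apply: continuous_kpoints => // a; exact: can_point_continuous.
by move=> g h a; exact: (hom_comul can_pointM fc).
Qed.

(** A comodule matrix of V restricts to a representation of G with entries of finite degree, which
    some [Q] over k unitriangularizes. Since [f] is injective and G is dense in U, the conjugate by
    [Q] is already unitriangular over O(V). *)
Lemma quotient_in_unitriangular (V : affineGroup k) (f : {lrmorphism V -> U}) :
  quotient_comorphism f -> forall a : V, in_unitriangular a.
Proof.
move=> [fc finj] a; have [d [N [C [Nm N1 aE]]]] := locally_finite a.
pose rho g : 'M[k]_d := map_mx (fun a => can_point g (f a) : k) N.
have rhoM g h : rho (g * h)%g = rho g *m rho h by exact: (hom_matrix can_pointM fc).
have ext (x y : V) : (forall g, can_point g (f x) = can_point g (f y)) -> x = y.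
  by move=> /can_point_inj/finj.
(* Multiplicativity alone only makes [rho 1] idempotent. The identity N = N rho(1) holds at all
   points from G, hence over O(V), and the counit turns it into 1 = rho(1). *)
have rho1 : rho 1%g = 1%:M.
  have NE : N = N *m map_mx (in_alg V) (rho 1%g).
    apply/matrixP => i j; apply: ext => g.
    have /matrixP/(_ i j) := rhoM g 1%g; rewrite mulg1 !mxE => ->.
    rewrite !linear_sum; apply: eq_bigr => l _; rewrite !mxE mulr_algr !linearZ /=.
    by rewrite mulrC.
  apply/matrixP => i j; have /matrixP/(_ i j) := NE => /(congr1 (counit V)).
  rewrite N1 => nE; rewrite [RHS]mxE nE [(N *m _) i j]mxE linear_sum.
  rewrite (bigD1 i) //= big1 ?addr0.
    by rewrite [map_mx _ _ _ _]mxE mulr_algr linearZ /= N1 eqxx; exact/esym/mulr1.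
  move=> l li; rewrite [map_mx _ _ _ _]mxE mulr_algr linearZ /= N1 eq_sym (negPf li).
  exact: mulr0.
have [|Q Qu QP] := deg_lt_unitriangularizable rho1 rhoM.
  move=> i j; have [n dn] := can_point_deg (f (N i j)).
  by exists n; apply: eq_deg_lt dn => g; rewrite mxE.
pose M := map_mx (in_alg V) (invmx Q) *m N *m map_mx (in_alg V) Q.
have ME g i j : can_point g (f (M i j)) = (invmx Q *m rho g *m Q) i j.
  rewrite !mxE !linear_sum; apply: eq_bigr => l _.
  rewrite !mxE mulr_algr !linearZ /= [RHS]mulrC; congr (_ * _).
  rewrite !linear_sum; apply: eq_bigr => l' _.
  by rewrite !mxE mulr_algl !linearZ.
exists d, M; split.
- split=> [i|i j ji]; apply: ext => g; rewrite ME.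
    by rewrite (QP g).1 rmorph1 kpoint1.
  by rewrite (QP g).2 // linear0 kpoint0.
- by apply: mult_matrix_conj => //; exact: mulmxV.
(* Conjugating back puts the entries of [N], and with them [a], in the algebra generated by the
   entries of [M]. *)
- have NE : N = map_mx (in_alg V) Q *m M *m map_mx (in_alg V) (invmx Q).
    rewrite /M !mulmxA -map_mxM mulmxV // map_mx1 mul1mx -mulmxA -map_mxM mulmxV //.
    by rewrite map_mx1 mulmx1.
  rewrite aE; do 2!apply: rpred_sum => ? _; apply: rpredZ; rewrite NE mxE.
  apply: rpred_sum => l _; rewrite [map_mx _ _ _ _]mxE mulr_algr; apply: rpredZ.
  rewrite mxE; apply: rpred_sum => l' _; rewrite [map_mx _ _ _ _]mxE mulr_algl.
  by apply: rpredZ; apply: generated_sub; exists l', l.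
Qed.

Lemma representing_pro_unipotent : pro_unipotent U.
Proof.
by move=> V f fq; apply: algebraic_unipotent; exact: quotient_in_unitriangular fq.
Qed.

(** * Lifting a continuous homomorphism to U *)

Section Universal.
Variables (V : affineGroup k) (phi : G -> kpoints V).
Hypotheses (proV : pro_unipotent V) (phi_hom : continuous_hom phi).

(** Within a unipotent quotient the liftable elements form a subalgebra, so it suffices to lift the
    entries of [M], which [phi] turns into a continuous unitriangular representation of G. *)
Lemma hom_coordinate_lift (a : V) : exists b, forall g, can_point g b = phi g a.
Proof.
have [phiM phiC] := phi_hom.
have [Q [f [a' [[fc _] Qu ->]]]] := pro_unipotent_exhaust a proV.
have [d [M [Mu Mm Mg]]] := unipotentP Qu.
have f1 : f 1 = 1 by exact: rmorph1.
have fP c x y : f (c *: x + y) = c *: f x + f y by exact: linearP.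
have fM x y : f (x * y) = f x * f y by exact: rmorphM.
have f0 : f 0 = 0 by exact: linear0.
move: a'; apply: (alg_generated_ind Mg).
- by exists 1 => g; rewrite f1 !kpoint1.
- by move=> c x y [u uE] [w wE]; exists (c *: u + w) => g; rewrite fP !kpointP uE wE.
- by move=> x y [u uE] [w wE]; exists (u * w) => g; rewrite fM !kpointM uE wE.
- move=> _ [i [j ->]].
  pose rho g : 'M[k]_d := map_mx (fun a => phi g (f a) : k) M.
  have [g||i' j'|X [xi [v E]]] := unitriangular_urep (rho := rho) _ _ _ i j.
  + split=> [l|l l' ll']; rewrite mxE; first by rewrite Mu.1 f1 kpoint1.
    by rewrite Mu.2 // f0 kpoint0.
  + exact: hom_matrix.
  + under eq_fun do rewrite mxE.
    exact: kpoints_coordinate_continuous.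
  by exists (coef theta v xi) => g; rewrite can_point_coef E mxE.
Qed.

(** By [can_point_inj] the chosen lift is the only one, which is also why lifting is linear and
    multiplicative. *)
Definition lift_fun a : U := sval (cid (hom_coordinate_lift a)).

Lemma lift_funE a g : can_point g (lift_fun a) = phi g a.
Proof. by rewrite /lift_fun; case: cid. Qed.

Lemma lift_linear : linear lift_fun.
Proof.
by move=> c a b; apply: can_point_inj => g; rewrite kpointP !lift_funE kpointP.
Qed.

Lemma lift_monoid_morphism : monoid_morphism lift_fun.
Proof.
split=> [|a b]; apply: can_point_inj => g.
  by rewrite lift_funE [LHS]kpoint1 [RHS]kpoint1.
by rewrite [RHS]kpointM !lift_funE [LHS]kpointM.
Qed.

Definition lift : {lrmorphism V -> U} := lrmorphism_pack lift_linear lift_monoid_morphism.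

(** Pairs of points from G separate the tensors over O(U), and at such a pair the claim is that
    [phi] is multiplicative. *)
Lemma lift_comorphism : group_comorphism lift.
Proof.
have [phiM _] := phi_hom.
have sep : separating (fun g => can_point g : {linear U -> k^o}).
  by move=> a a0; apply: can_point_inj => g; rewrite a0 linear0.
move=> a; apply: (tensor_eq_separating sep sep) => g h.
rewrite big_map -[LHS]/(point_mul (can_point g) (can_point h) (lift a)) -can_pointM.
rewrite lift_funE phiM; apply: eq_bigr => p _ /=.
by rewrite !lift_funE.
Qed.

End Universal.
End Completion.

Theorem theorem2p9 (G : topologicalGroupType) (k : topologicalFieldType)
    (hausdorff_k : hausdorff_space k) (char0_k : [pchar k]%R =i pred0)
    (U : affineGroup k)
    (theta : forall R : comAlgType k, points U R -> endo_family G R)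
    (repr_U : represents_aut theta) :
  exists c : G -> kpoints U, canonical_hom theta c /\ malcev_completion c.
Proof.
exists (can_point repr_U); split; first exact: can_point_canonical.
split.
- exact: representing_pro_unipotent repr_U.
- exact: can_point_hom.
- by move=> V f _ fc; exact: hom_points_hom.
- move=> V phi proV phi_hom; exists (lift char0_k repr_U proV phi_hom); split.
  + exact: lift_comorphism.
  + by move=> g a; exact: lift_funE.
  + move=> f' _ f'E a; apply: (can_point_inj (repr_U := repr_U)) => g.
    by rewrite [RHS]lift_funE -f'E.
Qed.
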